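(* Let $\gamma_1,\gamma_2\in\mathbb{R}$ and $s>\frac32$. For every $z_0=(u_0,\rho_0)\in H^s(\mathbb{S})\times H^{s-1}(\mathbb{S})$ there exist a maximal $T=T(\|z_0\|_{H^s\times H^{s-1}})>0$ and a unique solution $z=(u,\rho)$ of the system $$u_t-(u+\gamma_1)u_x=P(D)\Big(2\mu_0u+\tfrac12u_x^2+\tfrac12\rho^2\Big),\qquad \rho_t-(u+2\gamma_2)\rho_x=u_x\rho,$$ $u(0,\cdot)=u_0$, $\rho(0,\cdot)=\rho_0$, $u,\rho$ $1$-periodic in $x$, with $\mu_0=\int_{\mathbb{S}}u_0\,dx$, such that $z\in C([0,T);H^s\times H^{s-1})\cap C^1([0,T);H^{s-1}\times H^{s-2})$. Moreover, the mapping $z_0\mapsto z(\cdot,z_0)$ from $H^s\times H^{s-1}$ to $C([0,T);H^s\times H^{s-1})\cap C^1([0,T);H^{s-1}\times H^{s-2})$ is continuous.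
   Context: $\mathbb{S}=\mathbb{R}/\mathbb{Z}$ and $H^s=H^s(\mathbb{S})$ is the periodic Sobolev space. $P(D)$ is the Fourier multiplier operator on periodic functions with symbol $-\frac{2\pi i\beta}{\delta(\beta)+4\pi^2\beta^2}$ ($\beta\in\mathbb{Z}$), where $\delta(0)=1$ and $\delta(\beta)=0$ for $\beta\ne0$. *)

(* Defs.v *)
From Stdlib Require Import Reals ZArith.
From Coquelicot Require Import Coquelicot.
Open Scope R_scope.

(** * Periodic distributions on S = R/Z, represented by their Fourier
    coefficients  a : Z -> C  (a k = \hat f(k) = int_S f(x) e^{-2 pi i k x} dx). *)
Definition fseq := Z -> C.

Definition summableZ (f : Z -> R) : Prop :=
  ex_series (fun n : nat => f (Z.of_nat n)) /\
  ex_series (fun n : nat => f (- Z.of_nat (S n))%Z).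
Definition sumZ (f : Z -> R) : R :=
  Series (fun n : nat => f (Z.of_nat n)) + Series (fun n : nat => f (- Z.of_nat (S n))%Z).
(** Sums over Z of complex sequences (used only for absolutely convergent ones). *)
Definition csumZ (f : Z -> C) : C :=
  (sumZ (fun k => Re (f k)), sumZ (fun k => Im (f k))).

Definition sweight (r : R) (k : Z) : R := Rpower (1 + 4 * PI ^ 2 * (IZR k) ^ 2) r.

(** H^r(S) (real-valued elements): Hermitian symmetric coefficient sequences
    with  sum_k (1+4 pi^2 k^2)^r |a_k|^2 < oo. *)
Definition inH (r : R) (a : fseq) : Prop :=
  (forall k, a (- k)%Z = Cconj (a k)) /\
  summableZ (fun k => sweight r k * (Cmod (a k)) ^ 2).
Definition normH (r : R) (a : fseq) : R :=
  sqrt (sumZ (fun k => sweight r k * (Cmod (a k)) ^ 2)).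
Definition normHH (r : R) (a b : fseq) : R := sqrt (normH r a ^ 2 + normH (r - 1) b ^ 2).

Definition fadd (a b : fseq) : fseq := fun k => Cplus (a k) (b k).
Definition fsub (a b : fseq) : fseq := fun k => Cminus (a k) (b k).
Definition fscal (c : R) (a : fseq) : fseq := fun k => Cmult (RtoC c) (a k).
Definition fconst (c : R) : fseq := fun k => if Z.eqb k 0 then RtoC c else RtoC 0.
Definition dx (a : fseq) : fseq := fun k => Cmult (0, 2 * PI * IZR k) (a k).
(** Product of functions = convolution of Fourier coefficients. *)
Definition fmul (a b : fseq) : fseq := fun k => csumZ (fun j => Cmult (a j) (b (k - j)%Z)).
Definition mean (a : fseq) : R := Re (a 0%Z).

Definition deltaZ (k : Z) : R := if Z.eqb k 0 then 1 else 0.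
Definition PD (a : fseq) : fseq := fun k =>
  Cmult (Cdiv (0, - 2 * PI * IZR k) (RtoC (deltaZ k + 4 * PI ^ 2 * (IZR k) ^ 2))) (a k).

Definition Fu (g1 mu0 : R) (u rho : fseq) : fseq :=
  fadd (fmul (fadd u (fconst g1)) (dx u))
       (PD (fadd (fscal (2 * mu0) u)
                 (fadd (fscal (1/2) (fmul (dx u) (dx u))) (fscal (1/2) (fmul rho rho))))).
Definition Frho (g2 : R) (u rho : fseq) : fseq :=
  fadd (fmul (fadd u (fconst (2 * g2))) (dx rho)) (fmul (dx u) rho).

Definition inI (T : Rbar) (t : R) : Prop := 0 <= t /\ Rbar_lt (Finite t) T.

Definition contH (r : R) (T : Rbar) (f : R -> fseq) : Prop :=
  (forall t, inI T t -> inH r (f t)) /\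
  forall t, inI T t -> forall eps, 0 < eps -> exists delta, 0 < delta /\
    forall t', inI T t' -> Rabs (t' - t) < delta -> normH r (fsub (f t') (f t)) < eps.

Definition derivH (r : R) (T : Rbar) (f f' : R -> fseq) : Prop :=
  forall t, inI T t -> forall eps, 0 < eps -> exists delta, 0 < delta /\
    forall h, h <> 0 -> inI T (t + h) -> Rabs h < delta ->
      normH r (fsub (fscal (/ h) (fsub (f (t + h)) (f t))) (f' t)) < eps.

Definition IsSol (g1 g2 s : R) (u0 rho0 : fseq) (T : Rbar) (u rho : R -> fseq) : Prop :=
  contH s T u /\ contH (s - 1) T rho /\
  contH (s - 1) T (fun t => Fu g1 (mean u0) (u t) (rho t)) /\
  contH (s - 2) T (fun t => Frho g2 (u t) (rho t)) /\
  derivH (s - 1) T u (fun t => Fu g1 (mean u0) (u t) (rho t)) /\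
  derivH (s - 2) T rho (fun t => Frho g2 (u t) (rho t)) /\
  u 0 = u0 /\ rho 0 = rho0.

(* Main.v *)
(** Everything is done on Fourier coefficients. A trilinear sum over k, j with weight <k>^(1-s) + <j>^(1-s) + <k-j>^(1-s) is bounded by the three l2 norms because s > 3/2, so each product and commutator estimate reduces to a pointwise inequality between weights. Exchanging the two frequencies in the transport term antisymmetrises its symbol and recovers the lost derivative; this gives energy bounds for the Galerkin truncations, uniform over the family of weights <k>^s (1 + L min(1, |k|/N)), and a Gronwall estimate for differences in H^(1/2) x H^(-1/2). Choosing L, N so that the data stay bounded in the weighted norm makes the tails of solutions uniformly small, which upgrades low-norm convergence to convergence in H^s x H^(s-1). Existence, uniqueness and continuity of the flow on a time interval depending only on the norm follow, and the maximal solution and continuous dependence on [0,T'] are obtained by concatenation. *)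
Require Import Defs.
From Stdlib Require Import Reals ZArith List FinFun Lra Lia Psatz FunctionalExtensionality ClassicalEpsilon.
From Coquelicot Require Import Coquelicot.
Import ListNotations.
Open Scope R_scope.


(** * Sums over Z *)

(** The transport terms cost one derivative: the right-hand side maps H^s x H^(s-1) only to H^(s-1)
    x H^(s-2). No fixed point argument closes in the solution space, and Gronwall controls
    differences of solutions only in a weaker norm. The level H^(1/2) x H^(-1/2) keeps the gap of
    one derivative between u and rho; the comparison uses an exponent s' with 3/2 < s' < s, so that
    truncation at frequency n costs O(n^(s'-s)).

    Returning to the strong norm is the difficulty that the Bona-Smith method solves by regularising
    the data. Here the data are untouched and the weight is changed: for N large the factor 1 + L
    min(1, |k|/N) costs almost nothing on fixed data, yet modes beyond N of the solution become
    O(1/L), because no energy constant depends on L or N. That uniformity comes from the concavity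
    of the factor in |k|.

    The coefficient mu_0 depends on the data, so it is a separate parameter of the equation:
    compared solutions may have different values of it, and a shift of the time origin leaves it
    unchanged. *)

Fixpoint lsum (l : list Z) (f : Z -> R) : R :=
  match l with nil => 0 | k :: l' => f k + lsum l' f end.

Lemma lsum_ext l f g : (forall k, In k l -> f k = g k) -> lsum l f = lsum l g.
Proof.
  induction l as [|k l IH]; simpl; intros H; [easy|].
  rewrite (H k), IH; auto.
Qed.

Lemma lsum_le l f g : (forall k, In k l -> f k <= g k) -> lsum l f <= lsum l g.
Proof.
  induction l as [|k l IH]; simpl; intros H; [lra|].
  apply Rplus_le_compat; auto.
Qed.

Lemma lsum_zero l : lsum l (fun _ => 0) = 0.
Proof. induction l; simpl; lra. Qed.

Lemma lsum_pos l f : (forall k, In k l -> 0 <= f k) -> 0 <= lsum l f.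
Proof. intros H. rewrite <- (lsum_zero l). now apply lsum_le. Qed.

Lemma lsum_plus l f g : lsum l (fun k => f k + g k) = lsum l f + lsum l g.
Proof. induction l; simpl; lra. Qed.

Lemma lsum_scal l c f : lsum l (fun k => c * f k) = c * lsum l f.
Proof. induction l; simpl; lra. Qed.

Lemma lsum_minus l f g : lsum l (fun k => f k - g k) = lsum l f - lsum l g.
Proof. induction l; simpl; lra. Qed.

Lemma lsum_abs l f : Rabs (lsum l f) <= lsum l (fun k => Rabs (f k)).
Proof.
  induction l as [|k l IH]; simpl; [rewrite Rabs_R0; lra|].
  eapply Rle_trans; [apply Rabs_triang | lra].
Qed.

Lemma lsum_app l l' f : lsum (l ++ l') f = lsum l f + lsum l' f.
Proof. induction l; simpl; lra. Qed.

Lemma lsum_map l g f : lsum (map g l) f = lsum l (fun k => f (g k)).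
Proof. induction l; simpl; lra. Qed.

Lemma lsum_swap l l' (f : Z -> Z -> R) :
  lsum l (fun k => lsum l' (f k)) = lsum l' (fun j => lsum l (fun k => f k j)).
Proof.
  induction l as [|k l IH]; simpl.
  - now rewrite lsum_zero.
  - now rewrite IH, lsum_plus.
Qed.

Lemma lsum_incl l l' f : NoDup l -> incl l l' -> (forall k, 0 <= f k) ->
  lsum l f <= lsum l' f.
Proof.
  revert l'; induction l as [|k l IH]; intros l' Hl Hi Hf; simpl.
  - now apply lsum_pos.
  - inversion Hl as [|? ? Hk Hl']; subst.
    destruct (in_split k l') as (l1 & l2 & ->); [apply Hi; now left|].
    rewrite lsum_app; simpl.
    assert (lsum l f <= lsum (l1 ++ l2) f); [|rewrite lsum_app in *; lra].
    apply IH; auto. intros x Hx.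
    assert (Hx' : In x (l1 ++ k :: l2)) by (apply Hi; now right).
    apply in_app_or in Hx'. apply in_or_app.
    destruct Hx' as [?|[->|?]]; tauto.
Qed.

(** The sum of (f t - g)^2 is a nonnegative quadratic polynomial in t; its value at the minimum b /
    a gives the inequality. *)
Lemma lsum_CS l f g :
  (lsum l (fun k => f k * g k)) ^ 2 <= lsum l (fun k => f k ^ 2) * lsum l (fun k => g k ^ 2).
Proof.
  set (a := lsum l (fun k => f k ^ 2)); set (b := lsum l (fun k => f k * g k));
  set (c := lsum l (fun k => g k ^ 2)).
  assert (H : forall t, 0 <= a * t ^ 2 - 2 * b * t + c).
  { intros t. replace (a * t ^ 2 - 2 * b * t + c) with (lsum l (fun k => (f k * t - g k) ^ 2)).
    - apply lsum_pos; intros; apply pow2_ge_0.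
    - unfold a, b, c. clear. induction l; simpl in *; [ring|]. rewrite IHl. ring. }
  assert (Ha : 0 <= a) by (apply lsum_pos; intros; apply pow2_ge_0).
  (* For a = 0 the polynomial is affine; were b nonzero, it would equal -1 at (c + 1) / (2 b). *)
  destruct (Req_dec a 0) as [E|E].
  - assert (b = 0); [|subst; nra].
    destruct (Req_dec b 0) as [|Eb]; auto. exfalso.
    specialize (H ((c + 1) / (2 * b))). rewrite E in H.
    replace (0 * ((c + 1) / (2 * b)) ^ 2 - 2 * b * ((c + 1) / (2 * b)) + c) with (-1) in H by (field; auto).
    lra.
  - specialize (H (b / a)).
    replace (a * (b / a) ^ 2 - 2 * b * (b / a) + c) with ((a * c - b ^ 2) / a) in H by (field; auto).
    assert (0 <= (a * c - b ^ 2) / a * a) by (apply Rmult_le_pos; lra).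
    replace ((a * c - b ^ 2) / a * a) with (a * c - b ^ 2) in H0 by (field; auto). lra.
Qed.

Lemma lsum_CS_bound l f g A B : 0 <= A -> 0 <= B ->
  lsum l (fun k => f k ^ 2) <= A ^ 2 -> lsum l (fun k => g k ^ 2) <= B ^ 2 ->
  lsum l (fun k => f k * g k) <= A * B.
Proof.
  intros HA HB H1 H2.
  apply Rle_trans with (Rabs (lsum l (fun k => f k * g k))); [apply Rle_abs|].
  rewrite <- (Rabs_pos_eq (A * B)) by nra.
  apply Rsqr_le_abs_0. rewrite !Rsqr_pow2.
  eapply Rle_trans; [apply lsum_CS|].
  rewrite Rpow_mult_distr. apply Rmult_le_compat; auto; apply lsum_pos; intros; apply pow2_ge_0.
Qed.

Lemma lsum_derive l (f : Z -> R -> R) (f' : Z -> R) t :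
  (forall k, In k l -> is_derive (f k) t (f' k)) ->
  is_derive (fun t => lsum l (fun k => f k t)) t (lsum l f').
Proof.
  induction l as [|k l IH]; simpl; intros H.
  - apply (is_derive_const (V := R_NormedModule)).
  - apply (is_derive_plus (V := R_NormedModule)); auto.
Qed.

Lemma lsum_continuous l (f : Z -> R -> R) t :
  (forall k, In k l -> continuous (f k) t) ->
  continuous (fun t => lsum l (fun k => f k t)) t.
Proof.
  induction l as [|k l IH]; simpl; intros H.
  - apply continuous_const.
  - apply (continuous_plus (V := R_NormedModule)); auto.
Qed.

Lemma lsum_lim l (f : nat -> Z -> R) (g : Z -> R) :
  (forall k, In k l -> is_lim_seq (fun n => f n k) (g k)) ->
  is_lim_seq (fun n => lsum l (f n)) (lsum l g).
Proof.
  induction l as [|k l IH]; simpl; intros H.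
  - apply is_lim_seq_const.
  - apply (is_lim_seq_plus' (fun n => f n k) (fun n => lsum l (f n))); auto.
Qed.

(** Adding k and -k together makes the partial sums invariant under reflection of the frequency. *)
Fixpoint range (n : nat) : list Z :=
  match n with
  | O => [0%Z]
  | S m => Z.of_nat (S m) :: (- Z.of_nat (S m))%Z :: range m
  end.

Lemma in_range n k : In k (range n) <-> (Z.abs k <= Z.of_nat n)%Z.
Proof.
  induction n as [|n IH]; cbn [range In].
  - simpl; lia.
  - rewrite IH. lia.
Qed.

Lemma range_NoDup n : NoDup (range n).
Proof.
  induction n as [|n IH]; cbn [range].
  - repeat constructor; simpl; tauto.
  - constructor; [|constructor; auto].
    + cbn [In]. rewrite in_range. lia.
    + rewrite in_range. lia.
Qed.

Lemma incl_range l : exists n, incl l (range n).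
Proof.
  induction l as [|k l [n Hn]].
  - exists O. intros x [].
  - exists (n + Z.to_nat (Z.abs k))%nat. intros x [<-|Hx]; rewrite in_range.
    + lia.
    + apply Hn, in_range in Hx. lia.
Qed.

(** The negative half starts at -1, so its partial sum has index n where the other has S n. At
    [range 0] the negative half would be empty, hence the successor. *)
Lemma lsum_range n f :
  lsum (range (S n)) f =
  sum_n (fun n => f (Z.of_nat n)) (S n) + sum_n (fun n => f (- Z.of_nat (S n))%Z) n.
Proof.
  induction n as [|n IH].
  - rewrite sum_Sn, !sum_O. unfold plus; simpl. lra.
  - change (range (S (S n))) with (Z.of_nat (S (S n)) :: (- Z.of_nat (S (S n)))%Z :: range (S n)).
    cbn [lsum]. rewrite IH, (sum_Sn _ (S n)), (sum_Sn (fun n => f (- Z.of_nat (S n))%Z) n).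
    unfold plus; simpl. lra.
Qed.

Lemma sumZ_lim f : summableZ f -> is_lim_seq (fun n => lsum (range n) f) (sumZ f).
Proof.
  intros [[l1 H1] [l2 H2]].
  apply is_lim_seq_incr_1.
  unfold sumZ. rewrite (is_series_unique _ _ H1), (is_series_unique _ _ H2).
  apply is_lim_seq_ext with
    (fun n => sum_n (fun n => f (Z.of_nat n)) (S n) + sum_n (fun n => f (- Z.of_nat (S n))%Z) n).
  { intros n. now rewrite lsum_range. }
  apply is_lim_seq_plus'.
  - apply (is_lim_seq_incr_1 (sum_n (fun n => f (Z.of_nat n))) l1). exact H1.
  - exact H2.
Qed.

Lemma ex_series_bounded (a : nat -> R) B : (forall n, 0 <= a n) ->
  (forall n, sum_n a n <= B) -> ex_series a.
Proof.
  intros Ha HB.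
  destruct (ex_finite_lim_seq_incr (sum_n a) B) as [l Hl]; auto.
  - intros n. rewrite sum_Sn. unfold plus; simpl. generalize (Ha (S n)); lra.
  - now exists l.
Qed.

Lemma sum_n_nonneg (a : nat -> R) n : (forall n, 0 <= a n) -> 0 <= sum_n a n.
Proof.
  intros H; induction n; [rewrite sum_O; auto|].
  rewrite sum_Sn; unfold plus; simpl; generalize (H (S n)); lra.
Qed.

Lemma summableZ_nonneg f B : (forall k, 0 <= f k) ->
  (forall n, lsum (range n) f <= B) -> summableZ f.
Proof.
  intros Hf HB.
  assert (H : forall n, sum_n (fun n => f (Z.of_nat n)) (S n) <= B /\
            sum_n (fun n => f (- Z.of_nat (S n))%Z) n <= B).
  { intros n. generalize (HB (S n)). rewrite lsum_range.
    generalize (sum_n_nonneg (fun n => f (Z.of_nat n)) (S n) (fun n => Hf _)).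
    generalize (sum_n_nonneg (fun n => f (- Z.of_nat (S n))%Z) n (fun n => Hf _)). lra. }
  split; apply ex_series_bounded with B; auto.
  - intros n. eapply Rle_trans; [|apply (proj1 (H n))].
    rewrite sum_Sn. unfold plus; simpl. generalize (Hf (Z.of_nat (S n))). simpl. lra.
  - intros n. apply H.
Qed.

Lemma summableZ_abs f : summableZ (fun k => Rabs (f k)) -> summableZ f.
Proof. intros [H1 H2]; split; now apply ex_series_Rabs. Qed.

Lemma lsum_le_sumZ f l : (forall k, 0 <= f k) -> summableZ f -> NoDup l ->
  lsum l f <= sumZ f.
Proof.
  intros Hf Hs Hl. destruct (incl_range l) as [n Hn].
  apply (is_lim_seq_le_loc (fun _ => lsum l f) (fun n => lsum (range n) f) (lsum l f) (sumZ f));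
    [|apply is_lim_seq_const|now apply sumZ_lim].
  exists n. intros m Hm. apply lsum_incl; auto.
  intros x Hx. apply Hn in Hx. rewrite in_range in *. lia.
Qed.

Lemma sumZ_le f B : summableZ f -> (forall n, lsum (range n) f <= B) -> sumZ f <= B.
Proof.
  intros Hs HB.
  apply (is_lim_seq_le (fun n => lsum (range n) f) (fun _ => B) (sumZ f) B); auto;
    [now apply sumZ_lim|apply is_lim_seq_const].
Qed.

(** * Absolutely convergent complex sums *)

Definition clsum (l : list Z) (c : Z -> C) : C :=
  (lsum l (fun k => Re (c k)), lsum l (fun k => Im (c k))).

Lemma clsum_cons k l c : clsum (k :: l) c = Cplus (c k) (clsum l c).
Proof. unfold clsum, Cplus; simpl. destruct (c k); reflexivity. Qed.

Lemma clsum_mod l c : Cmod (clsum l c) <= lsum l (fun k => Cmod (c k)).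
Proof.
  induction l as [|k l IH].
  - simpl. replace (clsum [] c) with (RtoC 0) by reflexivity. rewrite Cmod_0. lra.
  - rewrite clsum_cons. simpl. eapply Rle_trans; [apply Cmod_triangle|lra].
Qed.

Lemma Re_mult_clsum z l c : Re (Cmult z (clsum l c)) = lsum l (fun k => Re (Cmult z (c k))).
Proof.
  unfold clsum. destruct z as [x y]. unfold Cmult, Re; simpl.
  rewrite <- !lsum_scal, <- lsum_minus. reflexivity.
Qed.

(** Absolute summability over Z, in a form that is visibly stable under injective relabelling of the
    frequencies. *)
Definition abs_bdd (c : Z -> C) : Prop :=
  exists B, forall l, NoDup l -> lsum l (fun k => Cmod (c k)) <= B.

Lemma Re_le_Cmod z : Rabs (Re z) <= Cmod z.
Proof. eapply Rle_trans; [apply Rmax_l|apply (Rmax_Cmod z)]. Qed.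
Lemma Im_le_Cmod z : Rabs (Im z) <= Cmod z.
Proof. eapply Rle_trans; [apply Rmax_r|apply (Rmax_Cmod z)]. Qed.

Lemma abs_bdd_Re c : abs_bdd c -> summableZ (fun k => Re (c k)).
Proof.
  intros [B HB]. apply summableZ_abs, summableZ_nonneg with B.
  - intros; apply Rabs_pos.
  - intros n. eapply Rle_trans; [|apply (HB (range n)), range_NoDup].
    apply lsum_le; intros; apply Re_le_Cmod.
Qed.
Lemma abs_bdd_Im c : abs_bdd c -> summableZ (fun k => Im (c k)).
Proof.
  intros [B HB]. apply summableZ_abs, summableZ_nonneg with B.
  - intros; apply Rabs_pos.
  - intros n. eapply Rle_trans; [|apply (HB (range n)), range_NoDup].
    apply lsum_le; intros; apply Im_le_Cmod.
Qed.

Lemma Cmod_lim (a : nat -> C) (z : C) :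
  is_lim_seq (fun n => Re (a n)) (Re z) -> is_lim_seq (fun n => Im (a n)) (Im z) ->
  is_lim_seq (fun n => Cmod (a n)) (Cmod z).
Proof.
  intros H1 H2. unfold Cmod.
  apply (is_lim_seq_continuous sqrt (fun n => fst (a n) ^ 2 + snd (a n) ^ 2)).
  { apply continuity_pt_sqrt. generalize (pow2_ge_0 (fst z)), (pow2_ge_0 (snd z)); lra. }
  simpl. apply is_lim_seq_plus'; apply is_lim_seq_mult'; auto; apply is_lim_seq_mult';
    auto; apply is_lim_seq_const.
Qed.

(** Lets bounds on finite convolution sums pass to [csumZ]. *)
Lemma csumZ_lim_Cmod c : abs_bdd c ->
  is_lim_seq (fun n => Cmod (clsum (range n) c)) (Cmod (csumZ c)).
Proof.
  intros H. apply Cmod_lim; simpl; apply sumZ_lim; [now apply abs_bdd_Re|now apply abs_bdd_Im].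
Qed.

Lemma lsum_supp l l' f : NoDup l -> NoDup l' -> (forall k, ~ In k l -> f k = 0) -> incl l l' ->
  lsum l' f = lsum l f.
Proof.
  revert l' f; induction l as [|k l IH]; intros l' f Hl Hl' H0 Hi; simpl.
  - rewrite <- (lsum_zero l'). apply lsum_ext; auto.
  - inversion Hl as [|? ? Hk Hln]; subst.
    destruct (in_split k l') as (l1 & l2 & ->); [apply Hi; now left|].
    rewrite lsum_app; simpl.
    apply NoDup_remove in Hl' as [Hl' Hk'].
    (* With its value at k erased, the function vanishes off the tail [l], as the induction
       hypothesis demands. *)
    set (g := fun j => if Z.eq_dec j k then 0 else f j).
    assert (E : lsum (l1 ++ l2) f = lsum l f); [|rewrite lsum_app in E; lra].
    transitivity (lsum (l1 ++ l2) g); [|transitivity (lsum l g)].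
    + apply lsum_ext. intros j Hj. unfold g. destruct (Z.eq_dec j k); subst; tauto.
    + apply IH; auto.
      * intros j Hj. unfold g. destruct (Z.eq_dec j k); auto. apply H0. simpl. intuition congruence.
      * intros x Hx. assert (Hx' : In x (l1 ++ k :: l2)) by (apply Hi; now right).
        apply in_app_or in Hx'. apply in_or_app.
        destruct Hx' as [?|[->|?]]; tauto.
    + apply lsum_ext. intros j Hj. unfold g. destruct (Z.eq_dec j k); subst; tauto.
Qed.

Lemma lim_eq (u : nat -> R) a b : is_lim_seq u (Finite a) -> (exists n, forall m, (n <= m)%nat -> u m = b) -> a = b.
Proof.
  intros H [n Hn].
  assert (H' : is_lim_seq u b).
  { apply is_lim_seq_ext_loc with (fun _ => b); [|apply is_lim_seq_const].
    exists n. intros m Hm. symmetry; auto. }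
  apply is_lim_seq_unique in H. apply is_lim_seq_unique in H'. rewrite H in H'. now inversion H'.
Qed.

Lemma csumZ_fin l c : NoDup l -> (forall k, ~ In k l -> c k = RtoC 0) -> csumZ c = clsum l c.
Proof.
  intros Hl H0.
  assert (Hb : abs_bdd c).
  { exists (lsum l (fun k => Cmod (c k))). intros l' Hl'.
    assert (Hz : forall k, ~ In k l -> Cmod (c k) = 0) by (intros; rewrite H0, Cmod_0; auto).
    rewrite <- (lsum_supp l (nodup Z.eq_dec (l ++ l')) (fun k => Cmod (c k))); auto.
    - apply lsum_incl; auto; [|intros; apply Cmod_ge_0].
      intros x Hx. apply nodup_In, in_or_app; auto.
    - apply NoDup_nodup.
    - intros x Hx. apply nodup_In, in_or_app; auto. }
  destruct (incl_range l) as [n Hn].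
  assert (Hin : forall m, (n <= m)%nat -> incl l (range m)).
  { intros m Hm x Hx. apply Hn in Hx. rewrite in_range in *. lia. }
  unfold csumZ, clsum. f_equal.
  - apply lim_eq with (1 := sumZ_lim _ (abs_bdd_Re _ Hb)). exists n. intros m Hm.
    apply lsum_supp; auto using range_NoDup. intros k Hk. now rewrite H0.
  - apply lim_eq with (1 := sumZ_lim _ (abs_bdd_Im _ Hb)). exists n. intros m Hm.
    apply lsum_supp; auto using range_NoDup. intros k Hk. now rewrite H0.
Qed.

Lemma sumZ_plus f g : summableZ f -> summableZ g -> sumZ (fun k => f k + g k) = sumZ f + sumZ g.
Proof.
  intros [F1 F2] [G1 G2]. unfold sumZ. rewrite !Series_plus; auto. lra.
Qed.
Lemma sumZ_minus f g : summableZ f -> summableZ g -> sumZ (fun k => f k - g k) = sumZ f - sumZ g.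
Proof.
  intros [F1 F2] [G1 G2]. unfold sumZ. rewrite !Series_minus; auto. lra.
Qed.

Lemma csumZ_plus c d : abs_bdd c -> abs_bdd d ->
  csumZ (fun k => Cplus (c k) (d k)) = Cplus (csumZ c) (csumZ d).
Proof.
  intros Hc Hd. unfold csumZ, Cplus; simpl. f_equal.
  - rewrite <- sumZ_plus; auto using abs_bdd_Re.
  - rewrite <- sumZ_plus; auto using abs_bdd_Im.
Qed.
Lemma csumZ_minus c d : abs_bdd c -> abs_bdd d ->
  csumZ (fun k => Cminus (c k) (d k)) = Cminus (csumZ c) (csumZ d).
Proof.
  intros Hc Hd. unfold csumZ, Cminus, Cplus, Copp; simpl. f_equal.
  - fold (Rminus (sumZ (fun k => Re (c k))) (sumZ (fun k => Re (d k)))).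
    rewrite <- sumZ_minus; auto using abs_bdd_Re.
  - fold (Rminus (sumZ (fun k => Im (c k))) (sumZ (fun k => Im (d k)))).
    rewrite <- sumZ_minus; auto using abs_bdd_Im.
Qed.

(** * Weights and kernel inequalities *)

(* Japanese bracket: [jp r] is <k>^r, whose square is [sweight r]. *)
Definition jb (k : Z) : R := sqrt (1 + 4 * PI ^ 2 * (IZR k) ^ 2).
Definition jp (r : R) (k : Z) : R := Rpower (jb k) r.

Lemma jb_arg_pos k : 1 <= 1 + 4 * PI ^ 2 * (IZR k) ^ 2.
Proof. generalize (pow2_ge_0 (PI * IZR k)). nra. Qed.

Lemma jb_sq k : jb k ^ 2 = 1 + (2 * PI * IZR k) ^ 2.
Proof.
  unfold jb. rewrite pow2_sqrt; [ring|]. generalize (jb_arg_pos k); lra.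
Qed.

Lemma jb_ge1 k : 1 <= jb k.
Proof. unfold jb. rewrite <- sqrt_1 at 1. apply sqrt_le_1_alt, jb_arg_pos. Qed.

Lemma jb_pos k : 0 < jb k.
Proof. generalize (jb_ge1 k); lra. Qed.

Lemma le_of_sq x y : 0 <= y -> x ^ 2 <= y ^ 2 -> x <= y.
Proof. intros. nra. Qed.

Lemma jb_ge k : 2 * PI * Rabs (IZR k) <= jb k.
Proof.
  apply le_of_sq; [generalize (jb_ge1 k); lra|].
  rewrite jb_sq, !Rpow_mult_distr, pow2_abs. lra.
Qed.

Lemma PI_bounds : 3 < PI <= 4.
Proof. generalize PI2_3_2, PI_4. unfold Rdiv. lra. Qed.

Lemma jb_ge_abs k : Rabs (IZR k) <= jb k.
Proof. generalize (jb_ge k) PI_bounds (Rabs_pos (IZR k)); nra. Qed.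

(** The bracket is the Euclidean norm of (1, 2 pi k), so this is the triangle inequality in the
    plane. *)
Lemma jb_lip k j : jb k <= jb j + 2 * PI * Rabs (IZR (k - j)).
Proof.
  generalize PI_bounds (Rabs_pos (IZR (k - j))) (jb_ge j) (jb_ge1 j); intros HP Hd Hj H1.
  apply le_of_sq; [nra|].
  replace ((jb j + 2 * PI * Rabs (IZR (k - j))) ^ 2)
    with (jb j ^ 2 + 2 * (2 * PI) * (jb j * Rabs (IZR (k - j))) + (2 * PI) ^ 2 * (Rabs (IZR (k - j)) ^ 2)) by ring.
  rewrite pow2_abs, !jb_sq.
  assert (H : (2 * PI) * (IZR j * IZR (k - j)) <= jb j * Rabs (IZR (k - j))).
  { eapply Rle_trans; [apply Rle_abs|]. rewrite !Rabs_mult, (Rabs_pos_eq 2), (Rabs_pos_eq PI) by lra.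
    nra. }
  rewrite minus_IZR in *. 
  assert ((2 * PI) * ((2 * PI) * (IZR j * (IZR k - IZR j))) <= (2 * PI) * (jb j * Rabs (IZR k - IZR j))) by
    (apply Rmult_le_compat_l; lra).
  nra.
Qed.

Lemma jb_even k : jb (- k) = jb k.
Proof. unfold jb. rewrite opp_IZR. f_equal. ring. Qed.

Lemma jb_mono j k : Rabs (IZR j) <= Rabs (IZR k) -> jb j <= jb k.
Proof.
  intros H. unfold jb. apply sqrt_le_1_alt.
  assert (IZR j ^ 2 <= IZR k ^ 2).
  { rewrite <- (pow2_abs (IZR j)), <- (pow2_abs (IZR k)). apply pow_incr. split; auto. apply Rabs_pos. }
  generalize (pow2_ge_0 PI); nra.
Qed.

Lemma jb_triangle k j : jb k <= jb j + jb (k - j).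
Proof. generalize (jb_lip k j) (jb_ge (k - j)). lra. Qed.

Lemma jb_peetre k j : jb j <= 2 * jb k * jb (k - j).
Proof.
  generalize (jb_triangle j k) (jb_ge1 k) (jb_ge1 (k - j)).
  replace (j - k)%Z with (- (k - j))%Z by ring. rewrite jb_even. nra.
Qed.

Lemma jp_pos r k : 0 < jp r k.
Proof. apply exp_pos. Qed.

Lemma jp_plus r q k : jp (r + q) k = jp r k * jp q k.
Proof. apply Rpower_plus. Qed.

Lemma jp_0 k : jp 0 k = 1.
Proof. apply Rpower_O, jb_pos. Qed.

Lemma jp_1 k : jp 1 k = jb k.
Proof. apply Rpower_1, jb_pos. Qed.

Lemma jp_opp r k : jp r k * jp (- r) k = 1.
Proof. rewrite <- jp_plus, Rplus_opp_r. apply jp_0. Qed.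

Lemma jp_even r k : jp r (- k) = jp r k.
Proof. unfold jp. now rewrite jb_even. Qed.

Lemma jp_le_exp r q k : r <= q -> jp r k <= jp q k.
Proof.
  intros H. unfold jp. destruct (Req_dec (jb k) 1) as [E|E].
  - rewrite E. unfold Rpower. rewrite ln_1, !Rmult_0_r. lra.
  - apply Rle_Rpower; auto. apply jb_ge1.
Qed.

Lemma jp_ge1 r k : 0 <= r -> 1 <= jp r k.
Proof. intros. rewrite <- (jp_0 k). now apply jp_le_exp. Qed.

Lemma jp_mono r j k : 0 <= r -> jb j <= jb k -> jp r j <= jp r k.
Proof. intros. apply Rle_Rpower_l; auto. split; auto. apply jb_pos. Qed.

Lemma jp_inv r k : jp (- r) k = / jp r k.
Proof. unfold jp. apply Rpower_Ropp. Qed.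

Lemma jp_anti r j k : r <= 0 -> jb j <= jb k -> jp r k <= jp r j.
Proof.
  intros H1 H2. replace r with (- (- r)) by ring. rewrite !(jp_inv (- r)).
  apply Rinv_le_contravar; [apply jp_pos|]. apply jp_mono; lra.
Qed.

Lemma jp_sq r k : jp r k ^ 2 = sweight r k.
Proof.
  unfold jp, sweight, jb. rewrite <- Rpower_sqrt by (generalize (jb_arg_pos k); lra).
  rewrite Rpower_mult, <- Rsqr_pow2. unfold Rsqr. rewrite <- Rpower_plus. f_equal. lra.
Qed.

(* Bounded by [1 + L], so that [vw q L N] is equivalent to [jp q], but equal to [1 + L] for |k| >= N; quasi-concavity in |k| keeps all constants independent of [L] and [N]. *)
Definition mw (L N : R) (k : Z) : R := 1 + L * Rmin 1 (Rabs (IZR k) / N).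
Definition vw (q L N : R) (k : Z) : R := jp q k * mw L N k.
(** Each summand is a square-summable factor in one of the three interacting frequencies. Being
    symmetric in them, the sum can be reached whichever frequency is the smallest. *)
Definition Th (r : R) (k j : Z) : R := jp (1 - r) k + jp (1 - r) j + jp (1 - r) (k - j).

Section Weights.
Variables L N : R.
Hypothesis HL : 0 <= L.
Hypothesis HN : 0 < N.

Lemma mw_min_bounds k : 0 <= Rmin 1 (Rabs (IZR k) / N) <= 1.
Proof.
  split; [|apply Rmin_l]. apply Rmin_glb; [lra|].
  apply Rmult_le_pos; [apply Rabs_pos|]. left. now apply Rinv_0_lt_compat.
Qed.

Lemma mw_ge1 k : 1 <= mw L N k.
Proof. unfold mw. generalize (mw_min_bounds k). nra. Qed.

Lemma mw_le k : mw L N k <= 1 + L.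
Proof. unfold mw. generalize (mw_min_bounds k). nra. Qed.

Lemma mw_even k : mw L N (- k) = mw L N k.
Proof. unfold mw. now rewrite opp_IZR, Rabs_Ropp. Qed.

Lemma mw_mono j k : Rabs (IZR j) <= Rabs (IZR k) -> mw L N j <= mw L N k.
Proof.
  intros H. unfold mw. apply Rplus_le_compat_l, Rmult_le_compat_l; auto.
  apply Rle_min_compat_l. apply Rmult_le_compat_r; auto. left. now apply Rinv_0_lt_compat.
Qed.

(** A concave function of |k| that is nonnegative at 0 has a nonincreasing ratio to |k|. Together
    with monotonicity this is all that the bounds below use, which is why they are free of [L] and
    [N]. *)
Lemma mw_quasi j k : Rabs (IZR j) <= Rabs (IZR k) ->
  mw L N k * Rabs (IZR j) <= mw L N j * Rabs (IZR k).
Proof.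
  intros H. unfold mw. generalize (Rabs_pos (IZR j)); intros Hj.
  assert (Rmin 1 (Rabs (IZR k) / N) * Rabs (IZR j) <= Rmin 1 (Rabs (IZR j) / N) * Rabs (IZR k)); [|nra].
  assert (Hi : 0 < / N) by now apply Rinv_0_lt_compat.
  unfold Rdiv. unfold Rmin at 2. destruct (Rle_dec 1 (Rabs (IZR j) * / N)).
  - generalize (Rmin_l 1 (Rabs (IZR k) * / N)). nra.
  - generalize (Rmin_r 1 (Rabs (IZR k) * / N)). nra.
Qed.

Lemma vw_pos q k : 0 < vw q L N k.
Proof. apply Rmult_lt_0_compat; [apply jp_pos|]. generalize (mw_ge1 k); lra. Qed.

Lemma vw_ge q k : jp q k <= vw q L N k.
Proof. unfold vw. generalize (jp_pos q k) (mw_ge1 k). nra. Qed.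

Lemma vw_even q k : vw q L N (- k) = vw q L N k.
Proof. unfold vw. now rewrite jp_even, mw_even. Qed.

Lemma vw_mono q j k : 0 <= q -> Rabs (IZR j) <= Rabs (IZR k) -> vw q L N j <= vw q L N k.
Proof.
  intros Hq H. unfold vw. apply Rmult_le_compat.
  - left; apply jp_pos.
  - generalize (mw_ge1 j); lra.
  - apply jp_mono; auto. now apply jb_mono.
  - now apply mw_mono.
Qed.

Lemma vw_S q k : vw (1 + q) L N k = jb k * vw q L N k.
Proof. unfold vw. rewrite jp_plus, jp_1. ring. Qed.

(** Doubling property: by [mw_quasi], doubling the frequency at most doubles [mw]. *)
Lemma vw_half q j k : 0 <= q -> Rabs (IZR k) <= 2 * Rabs (IZR j) ->
  vw q L N k <= 2 * Rpower 2 q * vw q L N j.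
Proof.
  intros Hq H. unfold vw.
  assert (H1 : jb k <= 2 * jb j).
  { apply le_of_sq; [generalize (jb_ge1 j); lra|].
    rewrite Rpow_mult_distr, !jb_sq, !(Rpow_mult_distr (2 * PI)).
    assert (IZR k ^ 2 <= 4 * IZR j ^ 2).
    { rewrite <- (pow2_abs (IZR k)), <- (pow2_abs (IZR j)). generalize (Rabs_pos (IZR k)); nra. }
    generalize (pow2_ge_0 (2 * PI)); nra. }
  assert (H2 : jp q k <= Rpower 2 q * jp q j).
  { unfold jp. rewrite Rpower_mult_distr; [|lra|apply jb_pos].
    apply Rle_Rpower_l; auto. split; auto. apply jb_pos. }
  assert (H3 : mw L N k <= 2 * mw L N j).
  { generalize (mw_ge1 j); intros Hj. destruct (Rle_dec (Rabs (IZR k)) (Rabs (IZR j))) as [H3|H3].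
    - generalize (mw_mono _ _ H3). lra.
    - generalize (mw_quasi j k ltac:(lra)) (Rabs_pos (IZR j)); intros H4 H5.
      assert (0 < Rabs (IZR j)) by lra.
      apply Rmult_le_reg_r with (Rabs (IZR j)); auto. nra. }
  replace (2 * Rpower 2 q * (jp q j * mw L N j)) with ((Rpower 2 q * jp q j) * (2 * mw L N j)) by ring.
  apply Rmult_le_compat; auto.
  - left; apply jp_pos.
  - generalize (mw_ge1 k); lra.
Qed.

Lemma vw_inv_le q k : 1 <= vw q L N k * jp (- q) k.
Proof. rewrite <- (jp_opp q k). apply Rmult_le_compat_r; [left; apply jp_pos|apply vw_ge]. Qed.

(** One of j and k - j has modulus at least |k| / 2, and its weight dominates by doubling. *)
Lemma vw_subadd q k j : 0 <= q ->
  vw q L N k <= 2 * Rpower 2 q * (vw q L N j + vw q L N (k - j)).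
Proof.
  intros Hq.
  assert (H2 : 0 < Rpower 2 q) by apply exp_pos.
  generalize (vw_pos q j) (vw_pos q (k - j)); intros Hj Hkj.
  destruct (Rle_dec (Rabs (IZR k)) (2 * Rabs (IZR j))) as [H|H].
  - eapply Rle_trans; [apply (vw_half q j k Hq H)|]. apply Rmult_le_compat_l; lra.
  - eapply Rle_trans; [apply (vw_half q (k - j) k Hq)|apply Rmult_le_compat_l; lra].
    rewrite minus_IZR. generalize (Rabs_triang_inv (IZR k) (IZR j)). lra.
Qed.

Lemma Th_pos r k j : 0 < Th r k j.
Proof. unfold Th. generalize (jp_pos (1 - r) k) (jp_pos (1 - r) j) (jp_pos (1 - r) (k - j)). lra. Qed.

(** Algebra property at level r - 1. [vw_subadd] leaves the weight of only one factor; the other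
    weight w is inserted at the price 1 <= w <.>^(1-r), a summand of [Th]. *)
Lemma vw_kernel r k j : 1 <= r ->
  vw (r - 1) L N k <= 2 * Rpower 2 (r - 1) * (vw (r - 1) L N j * vw (r - 1) L N (k - j)) * Th r k j.
Proof.
  intros Hr.
  eapply Rle_trans; [apply (vw_subadd (r - 1) k j); lra|].
  assert (H2 : 0 < Rpower 2 (r - 1)) by apply exp_pos.
  rewrite (Rmult_assoc (2 * Rpower 2 (r - 1))). apply Rmult_le_compat_l; [lra|].
  generalize (vw_pos (r - 1) j) (vw_pos (r - 1) (k - j)) (vw_inv_le (r - 1) j) (vw_inv_le (r - 1) (k - j)).
  replace (- (r - 1)) with (1 - r) by ring. unfold Th.
  generalize (jp_pos (1 - r) k) (jp_pos (1 - r) j) (jp_pos (1 - r) (k - j)).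
  generalize (vw (r - 1) L N j) (vw (r - 1) L N (k - j)) (jp (1 - r) k) (jp (1 - r) j) (jp (1 - r) (k - j)).
  intros a b x y z Hx Hy Hz Ha Hb H1 H3.
  assert (0 <= a * b * x) by (apply Rmult_le_pos; [|lra]; apply Rmult_le_pos; lra).
  assert (b <= b * (a * y)) by nra.
  assert (a <= a * (b * z)) by nra. lra.
Qed.

End Weights.

(** Replaces the mean value theorem for x -> x^(2q) in [vw_diff]. *)
Lemma pow_bernoulli a n : 0 <= a <= 1 -> 1 - INR n * (1 - a) <= a ^ n.
Proof.
  intros Ha. induction n as [|n IH].
  - simpl. lra.
  - rewrite S_INR. simpl. assert (0 <= INR n) by apply pos_INR.
    assert (a ^ n <= 1) by (rewrite <- (pow1 n); apply pow_incr; lra).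
    assert (0 <= a ^ n) by (apply pow_le; lra). nra.
Qed.

(** Discrete derivative bound: the squared weight varies by a relative amount O(|k - j| / <k>). The
    ratios [a], [al], [be] of the two brackets, their powers and the factors [mw] are in [0, 1], and
    each is close to 1 by that amount. *)
Lemma vw_diff q : 0 <= q -> exists C, 0 <= C /\ forall L N k j, 0 <= L -> 0 < N ->
  Rabs (IZR j) <= Rabs (IZR k) ->
  vw q L N k ^ 2 - vw q L N j ^ 2 <= C * Rabs (IZR (k - j)) / jb k * vw q L N k ^ 2.
Proof.
  intros Hq.
  (* An integer n > 2 q suffices: a^n <= a^(2q) = al^2 for a <= 1, so Bernoulli bounds 1 - al^2 by n
     (1 - a). *)
  destruct (INR_unbounded (2 * q)) as [n Hn].
  (* 8 bounds 2 pi in [jb_lip]; 18 = 2 * 9 comes from 1 - be^2 <= 2 (1 - be). *)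
  exists (8 * INR n + 18). split; [generalize (pos_INR n); lra|].
  intros L N k j HL HN H.
  set (a := jb j / jb k). set (al := jp q j / jp q k). set (be := mw L N j / mw L N k).
  generalize (jb_pos k) (jp_pos q k) (mw_ge1 L N HL HN k) (jb_pos j) (jp_pos q j) (mw_ge1 L N HL HN j).
  intros Hk1 Hk2 Hk3 Hj1 Hj2 Hj3.
  set (d := Rabs (IZR (k - j))). assert (Hd : 0 <= d) by apply Rabs_pos.
  assert (Ha : 0 < a <= 1).
  { split; [now apply Rdiv_lt_0_compat|]. apply Rmult_le_reg_r with (jb k); auto.
    unfold a. field_simplify; [|lra]. now apply jb_mono. }
  assert (Ha1 : 1 - a <= 8 * (d / jb k)).
  { apply Rmult_le_reg_r with (jb k); auto. unfold a. 
    replace ((1 - jb j / jb k) * jb k) with (jb k - jb j) by (field; lra).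
    replace (8 * (d / jb k) * jb k) with (8 * d) by (field; lra).
    generalize (jb_lip k j) PI_bounds. fold d. nra. }
  assert (Hal : 1 - INR n * (1 - a) <= al ^ 2).
  { eapply Rle_trans; [apply pow_bernoulli; lra|].
    assert (E : al = Rpower a q).
    { unfold al, jp, a, Rdiv. rewrite <- Rpower_mult_distr; auto; [|now apply Rinv_0_lt_compat].
      f_equal. unfold Rpower. rewrite ln_Rinv; auto. rewrite <- exp_Ropp. f_equal. ring. }
    rewrite E, <- Rpower_pow by lra. simpl. rewrite Rmult_1_r, <- Rpower_plus.
    unfold Rpower. assert (ln a <= 0) by (rewrite <- ln_1; apply Rcomplements.ln_le; lra).
    destruct (Req_dec (INR n * ln a) ((q + q) * ln a)) as [->|E']; [lra|].
    left. apply exp_increasing. nra. }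
  assert (Hal1 : 0 <= al <= 1).
  { unfold al. split; [left; now apply Rdiv_lt_0_compat|].
    apply Rmult_le_reg_r with (jp q k); auto. field_simplify; [|lra].
    apply jp_mono; auto. now apply jb_mono. }
  assert (Hbe1 : 0 <= be <= 1).
  { unfold be. split; [left; apply Rdiv_lt_0_compat; lra|].
    apply Rmult_le_reg_r with (mw L N k); [lra|]. field_simplify; [|lra]. now apply mw_mono. }
  assert (Hbe : 1 - be <= 9 * (d / jb k)).
  { assert (0 <= d / jb k) by (apply Rdiv_le_0_compat; auto).
    destruct (Z.eq_dec k 0) as [->|Hk0].
    - rewrite Rabs_R0 in H. assert (j = 0%Z) as ->.
      { apply eq_IZR. generalize (Rabs_pos (IZR j)) (Rle_abs (IZR j)) (Rle_abs (- IZR j)).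
        rewrite Rabs_Ropp. lra. }
      unfold be. rewrite Rdiv_diag by lra. lra.
    - assert (Hk : 1 <= Rabs (IZR k)) by (rewrite <- abs_IZR; apply IZR_le; lia).
      assert (Hb : (Rabs (IZR k) - Rabs (IZR j)) / Rabs (IZR k) >= 1 - be).
      { apply Rle_ge, Rmult_le_reg_r with (Rabs (IZR k)); [lra|].
        apply Rmult_le_reg_r with (mw L N k); [lra|]. unfold be.
        replace ((1 - mw L N j / mw L N k) * Rabs (IZR k) * mw L N k)
          with (mw L N k * Rabs (IZR k) - mw L N j * Rabs (IZR k)) by (field; lra).
        replace ((Rabs (IZR k) - Rabs (IZR j)) / Rabs (IZR k) * Rabs (IZR k) * mw L N k)
          with (mw L N k * Rabs (IZR k) - mw L N k * Rabs (IZR j)) by (field; lra).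
        generalize (mw_quasi L N HL HN j k H). lra. }
      apply Rge_le in Hb. eapply Rle_trans; [apply Hb|].
      (* <k> <= 1 + 2 pi |k| <= 9 |k| as |k| >= 1; this fails at k = 0, which was treated apart. *)
      assert (Hk9 : jb k <= 9 * Rabs (IZR k)).
      { generalize (jb_lip k 0) PI_bounds. rewrite Z.sub_0_r.
        unfold jb at 2. replace (1 + 4 * PI ^ 2 * 0 ^ 2) with 1 by ring. rewrite sqrt_1. nra. }
      apply Rmult_le_reg_r with (Rabs (IZR k)); [lra|].
      replace ((Rabs (IZR k) - Rabs (IZR j)) / Rabs (IZR k) * Rabs (IZR k)) with (Rabs (IZR k) - Rabs (IZR j)) by (field; lra).
      apply Rle_trans with d.
      + unfold d. rewrite minus_IZR. apply Rabs_triang_inv.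
      + replace (9 * (d / jb k) * Rabs (IZR k)) with (d * (9 * Rabs (IZR k) / jb k)) by (field; lra).
        rewrite <- (Rmult_1_r d) at 1. apply Rmult_le_compat_l; auto.
        apply Rmult_le_reg_r with (jb k); auto. field_simplify; lra. }
  assert (E : vw q L N j = vw q L N k * (al * be)).
  { unfold vw, al, be. field. lra. }
  rewrite E. set (P := vw q L N k).
  replace (P ^ 2 - (P * (al * be)) ^ 2) with ((1 - al ^ 2 * be ^ 2) * P ^ 2) by ring.
  apply Rmult_le_compat_r; [apply pow2_ge_0|].
  replace ((8 * INR n + 18) * d / jb k) with (INR n * (8 * (d / jb k)) + 2 * (9 * (d / jb k))) by (field; lra).
  assert (0 <= INR n) by apply pos_INR.
  assert (INR n * (1 - a) <= INR n * (8 * (d / jb k))) by (apply Rmult_le_compat_l; auto).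
  assert (1 - al ^ 2 * be ^ 2 <= (1 - al ^ 2) + (1 - be ^ 2)).
  { assert (0 <= al ^ 2 <= 1) by nra. assert (0 <= be ^ 2 <= 1) by nra. nra. }
  nra.
Qed.

Lemma Th_sym r k j : Th r j k = Th r k j.
Proof.
  unfold Th. replace (j - k)%Z with (- (k - j))%Z by ring. rewrite jp_even. ring.
Qed.

(** Up to 2 pi, the modulus of the antisymmetrised symbol of the transport term in the energy of
    weight w. *)
Definition symb (w : Z -> R) (k j : Z) : R := Rabs (IZR j * w k ^ 2 - IZR k * w j ^ 2).

Lemma symb_sym w k j : symb w j k = symb w k j.
Proof. unfold symb. rewrite <- Rabs_Ropp. f_equal. ring. Qed.

(** The two values of q are the levels of u and rho, transported by the same coefficient of level r.
    The symbol is split as j (w(k)^2 - w(j)^2) - (k - j) w(j)^2 with |j| <= |k|. *)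
Lemma symb_vw q r : 1 <= r -> q = r \/ q = r - 1 -> exists C, 0 <= C /\ forall L N k j,
  0 <= L -> 0 < N ->
  symb (vw q L N) k j <= C * (vw q L N k * vw q L N j * vw r L N (k - j)) * Th r k j.
Proof.
  intros Hr Hq.
  assert (Hq0 : 0 <= q) by (destruct Hq; lra).
  destruct (vw_diff q Hq0) as (C & HC & HD).
  set (c2 := 2 * Rpower 2 (r - 1)). assert (Hc2 : 0 < c2) by (unfold c2; generalize (exp_pos ((r - 1) * ln 2)); unfold Rpower; lra).
  exists (C * c2 + 1). split; [nra|]. intros L N.
  assert (G : forall k j, 0 <= L -> 0 < N -> Rabs (IZR j) <= Rabs (IZR k) ->
    symb (vw q L N) k j <= (C * c2 + 1) * (vw q L N k * vw q L N j * vw r L N (k - j)) * Th r k j).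
  { intros k j HL HN H. unfold symb.
    specialize (HD L N k j HL HN H).
    assert (HM := vw_mono L N HL HN q j k Hq0 H).
    generalize (vw_pos L N HL HN q k) (vw_pos L N HL HN q j) (vw_pos L N HL HN r (k - j)) (Th_pos r k j).
    intros P1 P2 P3 P4.
    set (w := vw q L N) in *. set (d := Rabs (IZR (k - j))) in *. assert (Hd : 0 <= d) by apply Rabs_pos.
    (* Here the derivative falls on the coefficient: <k-j> = <k-j>^r <k-j>^(1-r). *)
    assert (B2 : d * w j ^ 2 <= w k * w j * vw r L N (k - j) * Th r k j).
    { apply Rle_trans with (w k * w j * (vw r L N (k - j) * jp (1 - r) (k - j))).
      - replace (d * w j ^ 2) with (w j * w j * d) by ring.
        apply Rmult_le_compat; auto; try nra.
        apply Rle_trans with (jb (k - j)); [apply jb_ge_abs|].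
        unfold vw. rewrite Rmult_assoc, (Rmult_comm (mw _ _ _)), <- Rmult_assoc, <- jp_plus.
        replace (r + (1 - r)) with 1 by ring. rewrite jp_1.
        generalize (jb_pos (k - j)) (mw_ge1 L N HL HN (k - j)). nra.
      - rewrite <- !Rmult_assoc. apply Rmult_le_compat_l.
        + apply Rmult_le_pos; [apply Rmult_le_pos|]; lra.
        + unfold Th. generalize (jp_pos (1 - r) k) (jp_pos (1 - r) j). lra. }
    (* [vw_diff] trades the loss of |j| for |j| |k-j| / <k>; the factors <j> and <k-j> raise the
       kernel of level r - 1 to the required levels. *)
    assert (B1 : Rabs (IZR j) * (C * d / jb k * w k ^ 2) <= C * c2 * (w k * w j * vw r L N (k - j)) * Th r k j).
    { generalize (vw_kernel L N HL HN r k j Hr). fold c2. intros HK.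
      assert (HV := vw_S L N).
      assert (Er : vw r L N (k - j) = jb (k - j) * vw (r - 1) L N (k - j)).
      { rewrite <- HV; auto. f_equal; ring. }
      generalize (vw_pos L N HL HN (r - 1) k) (vw_pos L N HL HN (r - 1) j) (vw_pos L N HL HN (r - 1) (k - j)).
      intros Q1 Q2 Q3.
      generalize (jb_pos k) (jb_pos j) (jb_ge_abs (k - j)) (jb_ge_abs j) (jb_mono j k H).
      fold d. intros J1 J2 J3 J4 J5.
      assert (K : Rabs (IZR j) * d / jb k * w k <= c2 * (w j * vw r L N (k - j)) * Th r k j).
      { assert (X : Rabs (IZR j) * d * vw (r - 1) L N k <=
           c2 * (jb j * vw (r - 1) L N j * (jb (k - j) * vw (r - 1) L N (k - j))) * Th r k j).
        { apply Rle_trans with (jb j * jb (k - j) * (c2 * (vw (r - 1) L N j * vw (r - 1) L N (k - j)) * Th r k j)).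
          - apply Rmult_le_compat; try lra.
            + apply Rmult_le_pos; auto. apply Rabs_pos.
            + apply Rmult_le_compat; auto. apply Rabs_pos.
          - apply Req_le. ring. }
        rewrite Er. unfold w. destruct Hq as [->| ->].
        - assert (Ek : forall i, vw r L N i = jb i * vw (r - 1) L N i) by (intros; rewrite <- HV; auto; f_equal; ring).
          rewrite (Ek k), (Ek j). 
          replace (Rabs (IZR j) * d / jb k * (jb k * vw (r - 1) L N k)) with (Rabs (IZR j) * d * vw (r - 1) L N k) by (field; lra).
          exact X.
        - apply Rmult_le_reg_r with (jb k); auto.
          replace (Rabs (IZR j) * d / jb k * vw (r - 1) L N k * jb k) with (Rabs (IZR j) * d * vw (r - 1) L N k) by (field; lra).
          eapply Rle_trans; [apply X|].
          replace (c2 * (jb j * vw (r - 1) L N j * (jb (k - j) * vw (r - 1) L N (k - j))) * Th r k j)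
            with (c2 * (vw (r - 1) L N j * (jb (k - j) * vw (r - 1) L N (k - j))) * Th r k j * jb j) by ring.
          apply Rmult_le_compat_l; auto.
          assert (0 < jb (k - j)) by apply jb_pos.
          apply Rmult_le_pos; [|lra]. apply Rmult_le_pos; [lra|].
          apply Rmult_le_pos; [lra|]. apply Rmult_le_pos; lra. }
      replace (Rabs (IZR j) * (C * d / jb k * w k ^ 2)) with (C * w k * (Rabs (IZR j) * d / jb k * w k)) by (field; lra).
      replace (C * c2 * (w k * w j * vw r L N (k - j)) * Th r k j)
        with (C * w k * (c2 * (w j * vw r L N (k - j)) * Th r k j)) by ring.
      apply Rmult_le_compat_l; [nra|auto]. }
    replace (IZR j * w k ^ 2 - IZR k * w j ^ 2) with (IZR j * (w k ^ 2 - w j ^ 2) + - (IZR (k - j) * w j ^ 2))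
      by (rewrite minus_IZR; ring).
    eapply Rle_trans; [apply Rabs_triang|]. rewrite Rabs_Ropp, !Rabs_mult. fold d.
    rewrite (Rabs_pos_eq (w j ^ 2)) by apply pow2_ge_0.
    rewrite (Rabs_pos_eq (w k ^ 2 - w j ^ 2)) by nra.
    assert (Rabs (IZR j) * (w k ^ 2 - w j ^ 2) <= Rabs (IZR j) * (C * d / jb k * w k ^ 2))
      by (apply Rmult_le_compat_l; auto; apply Rabs_pos).
    lra. }
  (* Both sides are symmetric in k and j, since the weights are even. *)
  intros k j HL HN. destruct (Rle_dec (Rabs (IZR j)) (Rabs (IZR k))) as [H|H]; auto.
  rewrite symb_sym. specialize (G j k HL HN ltac:(lra)).
  rewrite Th_sym in G. replace (j - k)%Z with (- (k - j))%Z in G by ring.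
  rewrite vw_even in G; auto. rewrite (Rmult_comm (vw q L N j)) in G. exact G.
Qed.

(** <x>^(1/2) <= <y>^(1/2) + <z>^(1/2). The first summand leaves <z>^(1-r), the second <y>^(-1/2)
    <z>^(3/2-r). *)
Lemma low_kernel r x y z : 3 / 2 <= r -> jb x <= jb y + jb z ->
  jp (1/2) x * jp (- (1/2)) y * jp (1 - r) z <= jp (1 - r) y + 2 * jp (1 - r) z.
Proof.
  intros Hr H.
  assert (S1 : forall k, jp (1/2) k = sqrt (jb k)).
  { intros k. unfold jp. rewrite <- Rpower_sqrt by apply jb_pos. f_equal. lra. }
  assert (H1 : jp (1/2) x <= jp (1/2) y + jp (1/2) z).
  { rewrite !S1. eapply Rle_trans; [apply sqrt_le_1_alt, H|].
    apply le_of_sq; [generalize (sqrt_pos (jb y)) (sqrt_pos (jb z)); lra|].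
    rewrite pow2_sqrt by (generalize (jb_pos y) (jb_pos z); lra).
    generalize (pow2_sqrt (jb y) (Rlt_le _ _ (jb_pos y))) (pow2_sqrt (jb z) (Rlt_le _ _ (jb_pos z)))
     (sqrt_pos (jb y)) (sqrt_pos (jb z)). nra. }
  generalize (jp_pos (- (1/2)) y) (jp_pos (1 - r) z) (jp_pos (1/2) y) (jp_pos (1/2) z) (jp_opp (1/2) y).
  intros P1 P2 P3 P4 P5.
  assert (E : jp (3/2 - r) z = jp (1/2) z * jp (1 - r) z) by (rewrite <- jp_plus; f_equal; lra).
  apply Rle_trans with (jp (1 - r) z + jp (- (1/2)) y * jp (3/2 - r) z).
  - rewrite E.
    replace (jp (1 - r) z) with (jp (1/2) y * jp (- (1/2)) y * jp (1 - r) z) at 2 by (rewrite P5; ring).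
    assert (0 < jp (- (1/2)) y * jp (1 - r) z) by nra. nra.
  (* Both exponents are nonpositive, by r >= 3/2, and add up to 1 - r: replacing the larger bracket
     by the smaller one gives <y>^(1-r) or <z>^(1-r). *)
  - generalize (jp_pos (1 - r) y); intros P6.
    destruct (Rle_dec (jb y) (jb z)) as [H2|H2].
    + assert (jp (- (1/2)) y * jp (3/2 - r) z <= jp (1 - r) y); [|lra].
      replace (jp (1 - r) y) with (jp (- (1/2)) y * jp (3/2 - r) y) by (rewrite <- jp_plus; f_equal; lra).
      apply Rmult_le_compat_l; [lra|]. apply jp_anti; lra.
    + assert (jp (- (1/2)) y * jp (3/2 - r) z <= jp (1 - r) z); [|lra].
      replace (jp (1 - r) z) with (jp (- (1/2)) z * jp (3/2 - r) z) by (rewrite <- jp_plus; f_equal; lra).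
      apply Rmult_le_compat_r; [left; apply jp_pos|]. apply jp_anti; lra.
Qed.


(** Pointwise condition under which, by [nle_fmul], multiplication maps the spaces of weights [wa]
    and [wb] into that of weight [wc]. *)
Definition kernel (r : R) (wc wa wb : Z -> R) (C : R) : Prop :=
  forall k j, wc k <= C * (wa j * wb (k - j)%Z) * Th r k j.

Lemma jb_triangle_swap k j : jb j <= jb k + jb (k - j).
Proof. generalize (jb_triangle j k). replace (j - k)%Z with (- (k - j))%Z by ring. now rewrite jb_even. Qed.

Lemma jb_triangle_diff k j : jb (k - j) <= jb k + jb j.
Proof.
  generalize (jb_triangle (k - j) k). replace (k - j - k)%Z with (- j)%Z by ring. now rewrite jb_even.
Qed.

Ltac low_pos := repeat match goal with
  | |- context [jp ?a ?b] =>
    lazymatch goal with H : 0 < jp a b |- _ => fail | _ => assert (0 < jp a b) by apply jp_pos end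
  end.

Lemma jp_cancel a b k : a + b = 0 -> jp a k * jp b k = 1.
Proof. intros H. rewrite <- jp_plus, H. apply jp_0. Qed.

Lemma kernel_low1 r : 3 / 2 <= r -> kernel r (jp (1/2)) (jp (1/2)) (jp (r - 1)) 2.
Proof.
  intros Hr k j.
  generalize (low_kernel r k j (k - j) Hr (jb_triangle k j)) (jp_cancel (1/2) (-(1/2)) j ltac:(lra))
    (jp_cancel (r-1) (1 - r) (k - j) ltac:(lra)).
  unfold Th. intros H1 H2 H3. low_pos.
  replace (jp (1/2) k) with ((jp (1/2) j * jp (r - 1) (k - j)) * (jp (1/2) k * jp (-(1/2)) j * jp (1 - r) (k - j))).
  - rewrite (Rmult_comm 2), (Rmult_assoc _ 2). apply Rmult_le_compat_l; [|low_pos; lra].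
    apply Rmult_le_pos; lra.
  - transitivity (jp (1/2) k * (jp (1/2) j * jp (-(1/2)) j) * (jp (r - 1) (k - j) * jp (1 - r) (k - j))); [ring|].
    rewrite H2, H3; ring.
Qed.

Lemma kernel_low2 r : 3 / 2 <= r -> kernel r (jp (-(1/2))) (jp (-(1/2))) (jp (r - 1)) 2.
Proof.
  intros Hr k j.
  generalize (low_kernel r j k (k - j) Hr (jb_triangle_swap k j)) (jp_cancel (1/2) (-(1/2)) j ltac:(lra))
    (jp_cancel (r-1) (1 - r) (k - j) ltac:(lra)).
  unfold Th. intros H1 H2 H3. low_pos.
  replace (jp (-(1/2)) k) with ((jp (-(1/2)) j * jp (r - 1) (k - j)) * (jp (1/2) j * jp (-(1/2)) k * jp (1 - r) (k - j))).
  - rewrite (Rmult_comm 2), (Rmult_assoc _ 2). apply Rmult_le_compat_l; [|low_pos; lra].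
    apply Rmult_le_pos; lra.
  - transitivity (jp (-(1/2)) k * (jp (1/2) j * jp (-(1/2)) j) * (jp (r - 1) (k - j) * jp (1 - r) (k - j))); [ring|].
    rewrite H2, H3; ring.
Qed.

Lemma kernel_swap r wc wa wb C : kernel r wc wa wb C -> kernel r wc wb wa C.
Proof.
  intros H k j. eapply Rle_trans; [apply (H k (k - j)%Z)|].
  replace (k - (k - j))%Z with j by ring. apply Req_le. unfold Th.
  replace (k - (k - j))%Z with j by ring. ring.
Qed.

(** After multiplication by <k-j> <= <k> + <j>, the two terms are those of [kernel_low1] and
    [kernel_low2]. It serves the product of a difference of u with the derivative of rho. *)
Lemma kernel_low3 r : 3 / 2 <= r -> kernel r (jp (-(1/2))) (jp (1/2)) (jp (r - 2)) 4.
Proof.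
  intros Hr k j.
  generalize (kernel_low1 r Hr k j) (kernel_low2 r Hr k j). intros H1 H2.
  generalize (jb_triangle_diff k j); intros H3.
  assert (E1 : forall i, jp (1/2) i = jp (-(1/2)) i * jb i) by (intros; rewrite <- (jp_1 i), <- jp_plus; f_equal; lra).
  assert (E2 : forall i, jp (r - 1) i = jp (r - 2) i * jb i) by (intros; rewrite <- (jp_1 i), <- jp_plus; f_equal; lra).
  rewrite (E1 k), (E2 (k - j)%Z) in H1. rewrite (E2 (k - j)%Z) in H2.
  generalize (jb_pos k) (jb_pos j) (jb_pos (k - j)) (jp_pos (-(1/2)) k); intros.
  apply Rmult_le_reg_r with (jb (k - j)); auto.
  apply Rle_trans with (jp (-(1/2)) k * jb k + jp (-(1/2)) k * jb j); [nra|].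
  assert (jp (-(1/2)) k * jb j <= 2 * (jp (-(1/2)) j * (jp (r - 2) (k - j) * jb (k - j))) * Th r k j * jb j) by nra.
  rewrite E1 in *. lra.
Qed.

(** The squared weight is the bracket itself, so its Lipschitz bound replaces [vw_diff]. *)
Lemma symb_low1 r k j : 3 / 2 <= r ->
  symb (jp (1/2)) k j <= 16 * (jp (1/2) k * jp (1/2) j * jp r (k - j)) * Th r k j.
Proof.
  intros Hr. unfold symb.
  assert (E : forall i, jp (1/2) i ^ 2 = jb i).
  { intros i. rewrite <- (jp_1 i). replace 1 with (1/2+1/2) at 2 by lra. rewrite jp_plus. ring. }
  rewrite !E.
  assert (B : Rabs (IZR j * jb k - IZR k * jb j) <= 16 * (jp (1/2) k * jp (1/2) j) * Rabs (IZR (k - j))).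
  { assert (G : forall k j, jb j <= jb k -> Rabs (IZR j * jb k - IZR k * jb j) <= 16 * (jp (1/2) k * jp (1/2) j) * Rabs (IZR (k - j))).
    { clear k j. intros k j H.
      assert (H1 : jb j <= jp (1/2) k * jp (1/2) j).
      { rewrite <- E. simpl. rewrite Rmult_1_r. apply Rmult_le_compat_r; [left; apply jp_pos|].
        apply jp_mono; lra. }
      replace (IZR j * jb k - IZR k * jb j) with (IZR j * (jb k - jb j) + - (IZR (k - j) * jb j)) by (rewrite minus_IZR; ring).
      eapply Rle_trans; [apply Rabs_triang|]. rewrite Rabs_Ropp, !Rabs_mult.
      rewrite (Rabs_pos_eq (jb k - jb j)) by lra. rewrite (Rabs_pos_eq (jb j)) by (left; apply jb_pos).
      generalize (jb_lip k j) (jb_ge_abs j) PI_bounds (Rabs_pos (IZR (k - j))) (Rabs_pos (IZR j)) (jb_ge1 j); intros.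
      assert (jb k - jb j <= 8 * Rabs (IZR (k - j))) by nra.
      assert (Rabs (IZR j) * (jb k - jb j) <= jb j * (8 * Rabs (IZR (k - j)))) by (apply Rmult_le_compat; lra).
      nra. }
    destruct (Rle_dec (jb j) (jb k)); auto.
    specialize (G j k ltac:(lra)). rewrite <- Rabs_Ropp.
    replace (- (IZR j * jb k - IZR k * jb j)) with (IZR k * jb j - IZR j * jb k) by ring.
    eapply Rle_trans; [apply G|]. rewrite !minus_IZR, Rabs_minus_sym. apply Req_le. ring. }
  eapply Rle_trans; [apply B|].
  generalize (jp_pos (1/2) k) (jp_pos (1/2) j); intros.
  replace (16 * (jp (1/2) k * jp (1/2) j * jp r (k - j)) * Th r k j)
    with (16 * (jp (1/2) k * jp (1/2) j) * (jp r (k - j) * Th r k j)) by ring.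
  apply Rmult_le_compat_l; [nra|].
  apply Rle_trans with (jp r (k - j) * jp (1 - r) (k - j)).
  - rewrite <- jp_plus. replace (r + (1 - r)) with 1 by ring. rewrite jp_1. apply jb_ge_abs.
  - apply Rmult_le_compat_l; [left; apply jp_pos|]. unfold Th.
    generalize (jp_pos (1 - r) k) (jp_pos (1 - r) j). lra.
Qed.

(** With the decreasing weight <k>^(-1) and <j> <= <k>, the symbol is at most 9 |k-j| / <j>.
    [low_kernel] then shares the negative power between k and j. *)
Lemma symb_low2 r k j : 3 / 2 <= r ->
  symb (jp (-(1/2))) k j <= 36 * (jp (-(1/2)) k * jp (-(1/2)) j * jp r (k - j)) * Th r k j.
Proof.
  intros Hr.
  assert (G : forall k j, jb j <= jb k -> symb (jp (-(1/2))) k j <= 36 * (jp (-(1/2)) k * jp (-(1/2)) j * jp r (k - j)) * Th r k j).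
  { clear k j. intros k j H. unfold symb.
    assert (E : forall i, jp (-(1/2)) i ^ 2 = / jb i).
    { intros i. rewrite <- (jp_1 i), <- jp_inv. replace (-(1)) with (-(1/2) + -(1/2)) by lra. rewrite jp_plus. ring. }
    rewrite !E.
    generalize (jb_pos k) (jb_pos j); intros Pk Pj.
    replace (IZR j * / jb k - IZR k * / jb j) with (- ((IZR j * (jb k - jb j) + IZR (k - j) * jb k) * (/ jb k * / jb j)))
      by (rewrite minus_IZR; field; lra).
    generalize (jb_lip k j) (jb_mono) (jb_ge_abs j) PI_bounds (Rabs_pos (IZR (k - j))) (Rabs_pos (IZR j)) (jb_ge_abs (k - j)); intros.
    set (d := Rabs (IZR (k - j))) in *.
    assert (Ik : 0 < / jb k) by now apply Rinv_0_lt_compat.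
    assert (Ij : 0 < / jb j) by now apply Rinv_0_lt_compat.
    assert (B : Rabs (- ((IZR j * (jb k - jb j) + IZR (k - j) * jb k) * (/ jb k * / jb j))) <= 9 * d * / jb j).
    { rewrite Rabs_Ropp, Rabs_mult, (Rabs_pos_eq (/ jb k * / jb j)) by nra.
      apply Rle_trans with ((9 * d * jb k) * (/ jb k * / jb j)).
      - apply Rmult_le_compat_r; [nra|].
        eapply Rle_trans; [apply Rabs_triang|]. rewrite !Rabs_mult. fold d.
        rewrite (Rabs_pos_eq (jb k - jb j)), (Rabs_pos_eq (jb k)) by lra.
        assert (jb k - jb j <= 8 * d) by nra.
        assert (Rabs (IZR j) * (jb k - jb j) <= jb k * (8 * d)) by (apply Rmult_le_compat; lra).
        lra.
      - apply Req_le. field. lra. }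
    eapply Rle_trans; [apply B|].
    generalize (low_kernel r k j (k - j) Hr (jb_triangle k j)); intros LK.
    assert (T : jp (1/2) k * jp (-(1/2)) j * jp (1 - r) (k - j) <= 2 * Th r k j).
    { eapply Rle_trans; [apply LK|]. unfold Th. low_pos. lra. }
    assert (A : jb (k - j) * / jb j = (jp (-(1/2)) k * jp (-(1/2)) j * jp r (k - j)) * (jp (1/2) k * jp (-(1/2)) j * jp (1 - r) (k - j))).
    { transitivity ((jp (1/2) k * jp (-(1/2)) k) * (jp (-(1/2)) j * jp (-(1/2)) j) * (jp r (k - j) * jp (1 - r) (k - j))); [|ring].
      rewrite (jp_cancel (1/2)) by lra. rewrite <- !jp_plus.
      replace (-(1/2) + -(1/2)) with (-(1)) by lra. replace (r + (1 - r)) with 1 by ring.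
      rewrite jp_inv, !jp_1. ring. }
    assert (0 < jp (-(1/2)) k * jp (-(1/2)) j * jp r (k - j)).
    { apply Rmult_lt_0_compat; [apply Rmult_lt_0_compat|]; apply jp_pos. }
    assert (d * / jb j <= jb (k - j) * / jb j) by (apply Rmult_le_compat_r; lra).
    assert ((jp (-(1/2)) k * jp (-(1/2)) j * jp r (k - j)) * (jp (1/2) k * jp (-(1/2)) j * jp (1 - r) (k - j)) <=
      (jp (-(1/2)) k * jp (-(1/2)) j * jp r (k - j)) * (2 * Th r k j)) by (apply Rmult_le_compat_l; lra).
    generalize (Th_pos r k j); intros. nra. }
  destruct (Rle_dec (jb j) (jb k)); auto.
  rewrite symb_sym. specialize (G j k ltac:(lra)).
  rewrite Th_sym in G. replace (j - k)%Z with (- (k - j))%Z in G by ring. rewrite jp_even in G.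
  rewrite (Rmult_comm (jp (-(1/2)) j)) in G. exact G.
Qed.

(** * Trilinear estimates in weighted l2 *)

(** Integral test in telescoping form: with q = 2 r - 3 > 0 the terms are at most x^(-q-1),
    dominated by increments of x^(-q) / q. The 3 accounts for the frequencies -1, 0 and 1. *)
Lemma tau_sum r : 3 / 2 < r -> exists S, 0 < S /\
  forall l, NoDup l -> lsum l (fun k => jp (1 - r) k ^ 2) <= S ^ 2.
Proof.
  intros Hr. set (q := 2 * r - 3). assert (Hq : 0 < q) by (unfold q; lra).
  assert (Hb : forall n, lsum (range (S n)) (fun k => jp (1 - r) k ^ 2) <=
    3 + 2 / q - 2 / q * Rpower (INR (S n)) (- q)).
  { assert (Hk : forall n k, Z.abs k = Z.of_nat (S n) -> jp (1 - r) k ^ 2 <= Rpower (INR (S n)) (- q - 1)).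
    { intros n k Hk. assert (H : INR (S n) <= jb k).
      { rewrite INR_IZR_INZ, <- Hk, abs_IZR. apply jb_ge_abs. }
      assert (H0 : 0 < INR (S n)) by (apply lt_0_INR; lia).
      rewrite <- Rsqr_pow2. unfold Rsqr. rewrite <- jp_plus.
      replace (1 - r + (1 - r)) with (- (q + 1)) by (unfold q; ring).
      replace (- q - 1) with (- (q + 1)) by ring.
      rewrite jp_inv, Rpower_Ropp. apply Rinv_le_contravar; [apply exp_pos|].
      apply Rle_Rpower_l; [lra|split; lra]. }
    assert (H1 : forall k, jp (1 - r) k ^ 2 <= 1).
    { intros k. assert (jp (1 - r) k <= 1) by (eapply Rle_trans; [apply (jp_le_exp _ 0)|rewrite jp_0]; lra).
      generalize (jp_pos (1 - r) k). nra. }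
    induction n as [|n IH].
    - cbn -[pow jp INR]. generalize (H1 0%Z) (H1 1%Z) (H1 (-1)%Z). simpl INR.
      unfold Rpower at 1. rewrite ln_1, Rmult_0_r, exp_0. lra.
    - change (range (S (S n))) with (Z.of_nat (S (S n)) :: (- Z.of_nat (S (S n)))%Z :: range (S n)).
      cbn [lsum].
      generalize (Hk (S n) (Z.of_nat (S (S n))) ltac:(lia)) (Hk (S n) (- Z.of_nat (S (S n)))%Z ltac:(lia)).
      set (x := INR (S (S n))) in *. set (y := INR (S n)) in *.
      assert (Hx : x = y + 1) by (unfold x, y; now rewrite (S_INR (S n))).
      assert (Hy : 0 < y) by (apply lt_0_INR; lia).
      (* For y = x - 1 this reads (1 - 1/x)^(-q) >= 1 + q/x, obtained from exp(z) >= 1 + z used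
         twice. *)
      assert (K : Rpower x (- q) + q * Rpower x (- q - 1) <= Rpower y (- q)).
      { replace (Rpower y (- q)) with (Rpower x (- q) * Rpower (y / x) (- q)).
        2:{ rewrite Rpower_mult_distr; [f_equal; field; lra|lra|apply Rdiv_lt_0_compat; lra]. }
        replace (- q - 1) with (- q + - (1)) by ring. rewrite Rpower_plus, (Rpower_Ropp x 1), Rpower_1 by lra.
        assert (0 < Rpower x (- q)) by apply exp_pos.
        assert (1 + q * / x <= Rpower (y / x) (- q)); [|nra].
        unfold Rpower. eapply Rle_trans; [|apply exp_ineq1_le].
        assert (Hz : 0 < y / x) by (apply Rdiv_lt_0_compat; lra).
        generalize (exp_ineq1_le (ln (y / x))). rewrite exp_ln by auto.
        replace (y / x) with (1 - / x) at 2 by (rewrite Hx; field; lra). nra. }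
      intros H2 H3.
      assert (2 / q * (Rpower x (- q) + q * Rpower x (- q - 1)) <= 2 / q * Rpower y (- q)).
      { apply Rmult_le_compat_l; auto. left. apply Rdiv_lt_0_compat; lra. }
      replace (2 / q * (Rpower x (- q) + q * Rpower x (- q - 1))) with
        (2 / q * Rpower x (- q) + 2 * Rpower x (- q - 1)) in H by (field; lra).
      lra. }
  assert (H2 : 0 < 2 / q) by (apply Rdiv_lt_0_compat; lra).
  (* The bound exceeds 1, so it is at most its own square. *)
  exists (3 + 2 / q). split; [lra|]. intros l Hl.
  destruct (incl_range l) as [n Hn].
  apply Rle_trans with (lsum (range (S n)) (fun k => jp (1 - r) k ^ 2)).
  - apply lsum_incl; auto; [|intros; apply pow2_ge_0].
    intros x Hx. apply Hn in Hx. rewrite in_range in *. lia.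
  - eapply Rle_trans; [apply Hb|]. assert (0 < Rpower (INR (S n)) (- q)) by apply exp_pos. nra.
Qed.

(* The weighted l2 norm of [a] is at most [B]; bounding all sums over duplicate-free lists makes the infinite sum converge unconditionally. *)
Definition nle (w : Z -> R) (a : fseq) (B : R) : Prop :=
  0 <= B /\ forall l, NoDup l -> lsum l (fun k => (w k * Cmod (a k)) ^ 2) <= B ^ 2.

Definition sqb (x : Z -> R) (B : R) : Prop :=
  0 <= B /\ forall l, NoDup l -> lsum l (fun k => x k ^ 2) <= B ^ 2.

Lemma NoDup_map_sub k l : NoDup l -> NoDup (map (fun j => k - j)%Z l).
Proof.
  apply Injective_map_NoDup. intros x y H. lia.
Qed.
Lemma NoDup_map_subl i l : NoDup l -> NoDup (map (fun k => k - i)%Z l).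
Proof.
  apply Injective_map_NoDup. intros x y H. lia.
Qed.

Lemma sqb_shift x X k l : sqb x X -> NoDup l -> lsum l (fun j => x (k - j)%Z ^ 2) <= X ^ 2.
Proof.
  intros [_ H] Hl. rewrite <- (lsum_map l (fun j => k - j)%Z (fun i => x i ^ 2)).
  now apply H, NoDup_map_sub.
Qed.
Lemma sqb_shiftl x X j l : sqb x X -> NoDup l -> lsum l (fun k => x (k - j)%Z ^ 2) <= X ^ 2.
Proof.
  intros [_ H] Hl. rewrite <- (lsum_map l (fun k => k - j)%Z (fun i => x i ^ 2)).
  now apply H, NoDup_map_subl.
Qed.

Lemma lsum_scalr l c f : lsum l (fun k => f k * c) = lsum l f * c.
Proof. induction l; simpl; lra. Qed.

Section Trilinear.
Variables (r S : R).
Hypothesis HS0 : 0 < S.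
Hypothesis HS : forall l, NoDup l -> lsum l (fun k => jp (1 - r) k ^ 2) <= S ^ 2.

(** For each summand of [Th], Cauchy-Schwarz pairs it with the factor at the same frequency, and a
    second Cauchy-Schwarz handles the other two. Only x and y get shifted, so z needs its bound on
    [l1] alone. *)
Lemma trilinear x y z X Y Z l1 l2 :
  (forall k, 0 <= x k) -> (forall k, 0 <= y k) -> (forall k, 0 <= z k) ->
  sqb x X -> sqb y Y -> 0 <= Z -> lsum l1 (fun k => z k ^ 2) <= Z ^ 2 -> NoDup l1 -> NoDup l2 ->
  lsum l1 (fun k => lsum l2 (fun j => x j * y (k - j)%Z * z k * Th r k j)) <= 3 * S * X * Y * Z.
Proof.
  intros Hx Hy Hz HX HY HZ0 HZ N1 N2.
  assert (X0 := proj1 HX). assert (Y0 := proj1 HY).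
  set (t := jp (1 - r)).
  assert (Ht : forall k, 0 <= t k) by (intros; left; apply jp_pos).
  assert (XY0 := Rmult_le_pos _ _ X0 Y0).
  assert (T1 : lsum l1 (fun k => lsum l2 (fun j => x j * y (k - j)%Z * z k * t k)) <= S * X * Y * Z).
  { apply Rle_trans with (lsum l1 (fun k => (t k * z k) * (X * Y))).
    - apply lsum_le. intros k _.
      rewrite (lsum_ext l2 _ (fun j => (t k * z k) * (x j * y (k - j)%Z))) by (intros; ring).
      rewrite lsum_scal. apply Rmult_le_compat_l; [apply Rmult_le_pos; auto|].
      apply lsum_CS_bound; auto; [now apply HX|]. now apply sqb_shift.
    - rewrite lsum_scalr. replace (S * X * Y * Z) with ((S * Z) * (X * Y)) by ring.
      apply Rmult_le_compat_r; auto. apply lsum_CS_bound; auto; try lra; now apply HS. }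
  assert (T2 : lsum l1 (fun k => lsum l2 (fun j => x j * y (k - j)%Z * z k * t j)) <= S * X * Y * Z).
  { rewrite lsum_swap.
    apply Rle_trans with (lsum l2 (fun j => (t j * x j) * (Y * Z))).
    - apply lsum_le. intros j _.
      rewrite (lsum_ext l1 _ (fun k => (t j * x j) * (y (k - j)%Z * z k))) by (intros; ring).
      rewrite lsum_scal. apply Rmult_le_compat_l; [apply Rmult_le_pos; auto|].
      apply lsum_CS_bound; auto. now apply sqb_shiftl.
    - rewrite lsum_scalr. replace (S * X * Y * Z) with ((S * X) * (Y * Z)) by ring.
      apply Rmult_le_compat_r; [now apply Rmult_le_pos|]. apply lsum_CS_bound; auto; try lra; try (now apply HS); now apply HX. }
  assert (T3 : lsum l1 (fun k => lsum l2 (fun j => x j * y (k - j)%Z * z k * t (k - j)%Z)) <= S * X * Y * Z).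
  (* The new variable i = k - j runs over a set depending on k; it is enlarged to a fixed range
     before the sums are exchanged. *)
  { destruct (incl_range l1) as [n1 H1]. destruct (incl_range l2) as [n2 H2].
    set (L := range (n1 + n2)).
    apply Rle_trans with (lsum l1 (fun k => lsum L (fun i => (t i * y i) * (z k * x (k - i)%Z)))).
    - apply lsum_le. intros k Hk.
      rewrite (lsum_ext l2 _ (fun j => (fun i => (t i * y i) * (z k * x (k - i)%Z)) (k - j)%Z)).
      2:{ intros j _. replace (k - (k - j))%Z with j by ring. ring. }
      rewrite <- (lsum_map l2 (fun j => (k - j)%Z) (fun i => t i * y i * (z k * x (k - i)%Z))).
      apply lsum_incl.
      + now apply NoDup_map_sub.
      + intros i Hi. apply in_map_iff in Hi as (j & <- & Hj).
        apply H1, in_range in Hk. apply H2, in_range in Hj. apply in_range. lia.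
      + intros i. repeat apply Rmult_le_pos; auto.
    - rewrite lsum_swap.
      apply Rle_trans with (lsum L (fun i => (t i * y i) * (X * Z))).
      + apply lsum_le. intros i _. rewrite lsum_scal.
        apply Rmult_le_compat_l; [apply Rmult_le_pos; auto|].
        rewrite (Rmult_comm X). apply lsum_CS_bound; auto. now apply sqb_shiftl.
      + rewrite lsum_scalr. replace (S * X * Y * Z) with ((S * Y) * (X * Z)) by ring.
        apply Rmult_le_compat_r; [now apply Rmult_le_pos|]. apply lsum_CS_bound; auto; try lra; try (apply HS, range_NoDup); apply HY, range_NoDup. }
  replace (3 * S * X * Y * Z) with (S * X * Y * Z + S * X * Y * Z + S * X * Y * Z) by ring.
  eapply Rle_trans; [|apply Rplus_le_compat; [apply Rplus_le_compat; [apply T1|apply T2]|apply T3]].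
  rewrite <- !lsum_plus. apply Req_le, lsum_ext. intros k _.
  rewrite <- !lsum_plus. apply lsum_ext. intros j _. unfold Th, t. ring.
Qed.

(** The condition under which [fmul a b] is a genuine convolution and may be expanded bilinearly. *)
Definition conv (a b : fseq) : Prop := forall k, abs_bdd (fun j => Cmult (a j) (b (k - j)%Z)).

Lemma nle_sqb w a A : nle w a A -> sqb (fun k => w k * Cmod (a k)) A.
Proof. exact (fun H => H). Qed.

(** Product estimate in dual form, tested against z with both sums finite, so that no convergence is
    presupposed. *)
Lemma kernel_sum wc wa wb K a b A B z Z l1 l2 :
  (forall k, 0 < wc k) -> (forall k, 0 < wa k) -> (forall k, 0 < wb k) -> 0 <= K ->
  kernel r wc wa wb K -> nle wa a A -> nle wb b B -> (forall k, 0 <= z k) ->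
  0 <= Z -> lsum l1 (fun k => z k ^ 2) <= Z ^ 2 -> NoDup l1 -> NoDup l2 ->
  lsum l1 (fun k => z k * (wc k * lsum l2 (fun j => Cmod (Cmult (a j) (b (k - j)%Z))))) <= K * (3 * S * A * B * Z).
Proof.
  intros Hc Ha Hb HK0 HK HA HB Hz HZ HZ2 N1 N2.
  eapply Rle_trans; [|apply Rmult_le_compat_l; [exact HK0|];
    apply (trilinear (fun k => wa k * Cmod (a k)) (fun k => wb k * Cmod (b k)) z A B Z l1 l2); auto].
  - rewrite <- lsum_scal. apply lsum_le. intros k _. rewrite <- !lsum_scal.
    apply lsum_le. intros j _. rewrite Cmod_mult.
    specialize (HK k j).
    assert (0 <= Cmod (a j) * Cmod (b (k - j)%Z) * z k).
    { apply Rmult_le_pos; auto. apply Rmult_le_pos; apply Cmod_ge_0. }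
    replace (z k * (wc k * (Cmod (a j) * Cmod (b (k - j)%Z)))) with (wc k * (Cmod (a j) * Cmod (b (k - j)%Z) * z k)) by ring.
    eapply Rle_trans; [apply Rmult_le_compat_r; [exact H|exact HK]|]. apply Req_le. ring.
  - intros k. apply Rmult_le_pos; [now left|apply Cmod_ge_0].
  - intros k. apply Rmult_le_pos; [now left|apply Cmod_ge_0].
Qed.

(** [kernel_sum] tested on the single frequency k. *)
Lemma conv_kernel wc wa wb K a b A B :
  (forall k, 0 < wc k) -> (forall k, 0 < wa k) -> (forall k, 0 < wb k) -> 0 <= K ->
  kernel r wc wa wb K -> nle wa a A -> nle wb b B -> conv a b.
Proof.
  intros Hc Ha Hb HK0 HK HA HB k.
  exists (K * (3 * S * A * B * 1) / wc k). intros l Hl.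
  assert (H := kernel_sum wc wa wb K a b A B (fun _ => 1) 1 [k] l Hc Ha Hb HK0 HK HA HB).
  simpl lsum in H at 3. 
  apply Rmult_le_reg_l with (wc k); auto.
  replace (wc k * (K * (3 * S * A * B * 1) / wc k)) with (K * (3 * S * A * B * 1)) by (field; specialize (Hc k); lra).
  eapply Rle_trans; [|apply H]; auto; try lra.
  - simpl. apply Req_le. ring.
  - intros; lra.
  - simpl; lra.
  - repeat constructor; simpl; tauto.
Qed.

Lemma nle_fmul wc wa wb K a b A B :
  (forall k, 0 < wc k) -> (forall k, 0 < wa k) -> (forall k, 0 < wb k) -> 0 <= K ->
  kernel r wc wa wb K -> nle wa a A -> nle wb b B -> nle wc (fmul a b) (3 * S * K * A * B).
Proof.
  intros Hc Ha Hb HK0 HK HA HB.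
  assert (Hcv := conv_kernel wc wa wb K a b A B Hc Ha Hb HK0 HK HA HB).
  assert (H0 : 0 <= 3 * S * K * A * B).
  { assert (A0 := proj1 HA). assert (B0 := proj1 HB). repeat apply Rmult_le_pos; lra. }
  split; auto. intros l Hl.
  set (z := fun k => wc k * Cmod (fmul a b k)).
  assert (Hz : forall k, 0 <= z k) by (intros; apply Rmult_le_pos; [now left|apply Cmod_ge_0]).
  set (Q := lsum l (fun k => z k ^ 2)). fold Q.
  assert (HQ : 0 <= Q) by (apply lsum_pos; intros; apply pow2_ge_0).
  (* Duality with the product itself as test function. Only the inner sum passes to the limit;
     dividing by sqrt Q gives the bound. *)
  assert (M : Q <= (3 * S * K * A * B) * sqrt Q).
  { apply (is_lim_seq_le
      (fun m => lsum l (fun k => z k * (wc k * Cmod (clsum (range m) (fun j => Cmult (a j) (b (k - j)%Z))))))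
      (fun _ => (3 * S * K * A * B) * sqrt Q) Q ((3 * S * K * A * B) * sqrt Q)).
    - intros m.
      eapply Rle_trans; [|eapply Rle_trans;
        [apply (kernel_sum wc wa wb K a b A B z (sqrt Q) l (range m)); auto using range_NoDup, sqrt_pos|]].
      + apply lsum_le. intros k _. apply Rmult_le_compat_l; auto. apply Rmult_le_compat_l; [now left|].
        apply clsum_mod.
      + rewrite pow2_sqrt; auto. apply Rle_refl.
      + apply Req_le. ring.
    - replace (Finite Q) with (Finite (lsum l (fun k => z k * (wc k * Cmod (fmul a b k))))).
      + apply lsum_lim. intros k _.
        apply (is_lim_seq_scal_l _ (z k) (wc k * Cmod (fmul a b k))).
        apply (is_lim_seq_scal_l _ (wc k) (Cmod (fmul a b k))).
        apply csumZ_lim_Cmod, Hcv.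
      + f_equal. apply lsum_ext. intros; unfold z; ring.
    - apply is_lim_seq_const. }
  assert (HsQ := sqrt_pos Q). assert (Hs2 := pow2_sqrt Q HQ).
  change (Q <= (3 * S * K * A * B) ^ 2). rewrite <- Hs2. apply pow_incr. split; auto.
  rewrite <- Hs2 in M at 1. nra.
Qed.

Lemma fmul_fin a g l k : NoDup l -> (forall j, ~ In j l -> g j = RtoC 0) ->
  fmul a g k = clsum l (fun j => Cmult (a (k - j)%Z) (g j)).
Proof.
  intros Hl Hg. unfold fmul.
  rewrite (csumZ_fin (map (fun j => (k - j)%Z) l)).
  - unfold clsum. rewrite !lsum_map. f_equal; apply lsum_ext; intros j _;
    now replace (k - (k - j))%Z with j by ring.
  - now apply NoDup_map_sub.
  - intros i Hi. rewrite (Hg (k - i)%Z), Cmult_0_r; auto.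
    intros H. apply Hi. apply in_map_iff. exists (k - i)%Z. split; auto. ring.
Qed.

(* Exchanging [k] and [j] in the double sum turns the symbol [j w(k)^2] into its antisymmetrisation [j w(k)^2 - k w(j)^2], which gains the lost derivative. *)
Lemma transport w wa K a f A F l :
  (forall k, 0 < w k) -> (forall k, 0 < wa k) -> 0 <= K ->
  (forall k j, symb w k j <= K * (w k * w j * wa (k - j)%Z) * Th r k j) ->
  (forall k, a (- k)%Z = Cconj (a k)) -> nle wa a A -> nle w f F ->
  NoDup l -> (forall k, ~ In k l -> f k = RtoC 0) ->
  Rabs (lsum l (fun k => w k ^ 2 * Re (Cmult (Cconj (f k)) (fmul a (dx f) k)))) <= 12 * S * K * A * F ^ 2.
Proof.
  intros Hw Hwa HK0 HK Hherm HA HF Hl Hf.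
  set (G := fun k j => Re (Cmult (Cmult Ci (a (k - j)%Z)) (Cmult (Cconj (f k)) (f j)))).
  set (T := fun k j => w k ^ 2 * (2 * PI * IZR j) * G k j).
  assert (E : lsum l (fun k => w k ^ 2 * Re (Cmult (Cconj (f k)) (fmul a (dx f) k))) =
              lsum l (fun k => lsum l (fun j => T k j))).
  { apply lsum_ext. intros k _. rewrite (fmul_fin a (dx f) l k Hl).
    - rewrite Re_mult_clsum, <- lsum_scal. apply lsum_ext. intros j _. unfold T, G, dx.
      destruct (a (k - j)%Z), (f k), (f j). unfold Cmult, Cconj, Ci, Re, Im; simpl. ring.
    - intros j Hj. unfold dx. rewrite Hf, Cmult_0_r; auto. }
  (* The coefficient is real-valued, hence Hermitian on the Fourier side, and Ci contributes the
     sign. *)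
  assert (GA : forall k j, G j k = - G k j).
  { intros k j. unfold G. replace (j - k)%Z with (- (k - j))%Z by ring. rewrite Hherm.
    destruct (a (k - j)%Z), (f k), (f j). unfold Cmult, Cconj, Ci, Re, Im; simpl. ring. }
  assert (E2 : 2 * lsum l (fun k => lsum l (fun j => T k j)) =
    lsum l (fun k => lsum l (fun j => 2 * PI * (IZR j * w k ^ 2 - IZR k * w j ^ 2) * G k j))).
  { replace (2 * lsum l (fun k => lsum l (fun j => T k j))) with
      (lsum l (fun k => lsum l (fun j => T k j)) + lsum l (fun j => lsum l (fun k => T k j))).
    2:{ rewrite (lsum_swap l l (fun j k => T k j)). ring. }
    rewrite <- lsum_plus. apply lsum_ext. intros k _. rewrite <- lsum_plus. apply lsum_ext. intros j _.
    unfold T. rewrite (GA k j). ring. }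
  rewrite E.
  assert (B : Rabs (2 * lsum l (fun k => lsum l (fun j => T k j))) <= 8 * K * (3 * S * F * A * F)).
  { rewrite E2. eapply Rle_trans; [apply lsum_abs|].
    apply Rle_trans with (8 * K * lsum l (fun k => lsum l (fun j =>
      (w j * Cmod (f j)) * (wa (k - j)%Z * Cmod (a (k - j)%Z)) * (w k * Cmod (f k)) * Th r k j))).
    - rewrite <- lsum_scal. apply lsum_le. intros k _.
      eapply Rle_trans; [apply lsum_abs|]. rewrite <- lsum_scal. apply lsum_le. intros j _.
      rewrite !Rabs_mult, (Rabs_pos_eq 2), (Rabs_pos_eq PI) by (generalize PI_bounds; lra).
      fold (symb w k j).
      assert (HG : Rabs (G k j) <= Cmod (a (k - j)%Z) * (Cmod (f k) * Cmod (f j))).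
      { unfold G. eapply Rle_trans; [apply Re_le_Cmod|]. rewrite !Cmod_mult, Cmod_conj.
        replace (Cmod Ci) with 1; [lra|]. unfold Cmod, Ci; simpl.
        replace (0 * (0 * 1) + 1 * (1 * 1)) with 1 by ring. now rewrite sqrt_1. }
      apply Rle_trans with (8 * symb w k j * (Cmod (a (k - j)%Z) * (Cmod (f k) * Cmod (f j)))).
      + apply Rmult_le_compat; auto.
        * apply Rmult_le_pos; [generalize PI_bounds; lra|apply Rabs_pos].
        * apply Rabs_pos.
        * apply Rmult_le_compat_r; [apply Rabs_pos|generalize PI_bounds; lra].
      + assert (0 <= 8 * (Cmod (a (k - j)%Z) * (Cmod (f k) * Cmod (f j)))).
        { apply Rmult_le_pos; [lra|]. repeat apply Rmult_le_pos; apply Cmod_ge_0. }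
        generalize (Rmult_le_compat_l _ _ _ H (HK k j)). lra.
    - apply Rmult_le_compat_l; [lra|].
      apply (trilinear (fun k => w k * Cmod (f k)) (fun k => wa k * Cmod (a k)) (fun k => w k * Cmod (f k)));
        auto using nle_sqb; try (intros; apply Rmult_le_pos; [now left|apply Cmod_ge_0]).
      + apply HF.
      + now apply HF. }
  rewrite Rabs_mult, (Rabs_pos_eq 2) in B by lra. nra.
Qed.

End Trilinear.

(** Common source of the bounds for scalars, derivatives, P(D), projections and changes of
    weight. *)
Lemma nle_le w w' a a' c B : 0 <= c -> (forall k, 0 < w k) ->
  (forall k, w k * Cmod (a k) <= c * (w' k * Cmod (a' k))) -> nle w' a' B -> nle w a (c * B).
Proof.
  intros Hc Hw H [HB HH]. split; [nra|]. intros l Hl.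
  apply Rle_trans with (lsum l (fun k => c ^ 2 * (w' k * Cmod (a' k)) ^ 2)).
  - apply lsum_le. intros k _. rewrite <- Rpow_mult_distr. apply pow_incr. split; auto.
    apply Rmult_le_pos; [now left|apply Cmod_ge_0].
  - rewrite lsum_scal, Rpow_mult_distr. apply Rmult_le_compat_l; [apply pow2_ge_0|auto].
Qed.

Lemma nle_ext w a b B : (forall k, a k = b k) -> nle w a B -> nle w b B.
Proof.
  intros H [HB HH]. split; auto. intros l Hl. rewrite <- (lsum_ext l (fun k => (w k * Cmod (a k)) ^ 2)); auto.
  intros; now rewrite H.
Qed.

Lemma nle_weak w a B B' : nle w a B -> B <= B' -> nle w a B'.
Proof.
  intros [HB HH] H. split; [lra|]. intros l Hl. eapply Rle_trans; [now apply HH|]. apply pow_incr; lra.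
Qed.

Lemma nle_add w a b A B : (forall k, 0 < w k) -> nle w a A -> nle w b B -> nle w (fadd a b) (A + B).
Proof.
  intros Hw [HA HA2] [HB HB2]. split; [lra|]. intros l Hl.
  apply Rle_trans with (lsum l (fun k => (w k * Cmod (a k)) ^ 2 + 2 * ((w k * Cmod (a k)) * (w k * Cmod (b k))) + (w k * Cmod (b k)) ^ 2)).
  - apply lsum_le. intros k _. unfold fadd.
    generalize (Cmod_triangle (a k) (b k)) (Cmod_ge_0 (Cplus (a k) (b k))) (Hw k). intros H1 H2 H3.
    replace ((w k * Cmod (a k)) ^ 2 + 2 * (w k * Cmod (a k) * (w k * Cmod (b k))) + (w k * Cmod (b k)) ^ 2)
      with ((w k * (Cmod (a k) + Cmod (b k))) ^ 2) by ring.
    apply pow_incr. split; [apply Rmult_le_pos; lra|]. apply Rmult_le_compat_l; lra.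
  - rewrite !lsum_plus, lsum_scal.
    generalize (HA2 l Hl) (HB2 l Hl) (lsum_CS_bound l _ _ A B HA HB (HA2 l Hl) (HB2 l Hl)). nra.
Qed.

Lemma nle_scal w a c B : (forall k, 0 < w k) -> nle w a B -> nle w (fscal c a) (Rabs c * B).
Proof.
  intros Hw. apply nle_le; auto; [apply Rabs_pos|]. intros k. unfold fscal. rewrite Cmod_mult, Cmod_R.
  apply Req_le; ring.
Qed.

Lemma nle_opp_eq w a b B : (forall k, Cmod (a k) = Cmod (b k)) -> nle w a B -> nle w b B.
Proof.
  intros H [HB HH]. split; auto. intros l Hl. rewrite <- (lsum_ext l (fun k => (w k * Cmod (a k)) ^ 2)); auto.
  intros; now rewrite H.
Qed.

Lemma nle_sub w a b A B : (forall k, 0 < w k) -> nle w a A -> nle w b B -> nle w (fsub a b) (A + B).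
Proof.
  intros Hw HA HB. apply nle_ext with (fadd a (fscal (-1) b)).
  - intros k. unfold fadd, fscal, fsub. ring.
  - replace B with (Rabs (-1) * B) by (rewrite Rabs_left; lra). apply nle_add; auto. now apply nle_scal.
Qed.

Lemma nle_sub_sym w a b B : nle w (fsub a b) B -> nle w (fsub b a) B.
Proof.
  apply nle_opp_eq. intros k. unfold fsub. rewrite <- Cmod_opp. f_equal. ring.
Qed.

Lemma nle_sub_trans w a b c A B : (forall k, 0 < w k) ->
  nle w (fsub a b) A -> nle w (fsub b c) B -> nle w (fsub a c) (A + B).
Proof.
  intros Hw HA HB. apply nle_ext with (fadd (fsub a b) (fsub b c)); [|now apply nle_add].
  intros k. unfold fadd, fsub. ring.
Qed.

Lemma nle_coef w a B k : nle w a B -> 0 < w k -> w k * Cmod (a k) <= B.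
Proof.
  intros [HB H] Hw. specialize (H [k]). simpl in H.
  assert (NoDup [k]) by (repeat constructor; simpl; tauto). specialize (H H0).
  apply le_of_sq; auto. simpl. lra.
Qed.

Lemma nle_const w c : (forall k, 0 < w k) -> nle w (fconst c) (w 0%Z * Rabs c).
Proof.
  intros Hw. split; [apply Rmult_le_pos; [now left|apply Rabs_pos]|]. intros l Hl.
  apply Rle_trans with (lsum (nodup Z.eq_dec (0%Z :: l)) (fun k => (w k * Cmod (fconst c k)) ^ 2)).
  - apply lsum_incl; auto; [|intros; apply pow2_ge_0]. intros x Hx. apply nodup_In. now right.
  - rewrite (lsum_supp [0%Z]).
    + simpl lsum. unfold fconst. simpl Z.eqb. cbv iota. rewrite Cmod_R. lra.
    + repeat constructor; simpl; tauto.
    + apply NoDup_nodup.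
    + intros k Hk. unfold fconst. destruct (Z.eqb_spec k 0); [subst; simpl in Hk; tauto|].
      rewrite Cmod_0. ring.
    + intros x [<-|[]]. apply nodup_In. now left.
Qed.

Lemma nle_zero w : (forall k, 0 < w k) -> nle w (fun _ => RtoC 0) 0.
Proof.
  intros. split; [lra|]. intros l _. rewrite (lsum_ext l _ (fun _ => 0)), lsum_zero; [lra|].
  intros. rewrite Cmod_0. ring.
Qed.

Lemma nle_cs w a b A B l : (forall k, 0 < w k) -> nle w a A -> nle w b B -> NoDup l ->
  Rabs (lsum l (fun k => w k ^ 2 * Re (Cmult (Cconj (a k)) (b k)))) <= A * B.
Proof.
  intros Hw [HA HA2] [HB HB2] Hl. eapply Rle_trans; [apply lsum_abs|].
  eapply Rle_trans; [|apply (lsum_CS_bound l _ _ A B HA HB (HA2 l Hl) (HB2 l Hl))].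
  apply lsum_le. intros k _. rewrite Rabs_mult, (Rabs_pos_eq (w k ^ 2)) by apply pow2_ge_0.
  apply Rle_trans with (w k ^ 2 * (Cmod (a k) * Cmod (b k))); [|apply Req_le; ring].
  apply Rmult_le_compat_l; [apply pow2_ge_0|]. eapply Rle_trans; [apply Re_le_Cmod|].
  rewrite Cmod_mult, Cmod_conj. lra.
Qed.

(** * Algebra of the nonlinearity *)

Definition herm (a : fseq) : Prop := forall k, a (- k)%Z = Cconj (a k).

Lemma range_opp n f : lsum (range n) (fun k => f (- k)%Z) = lsum (range n) f.
Proof.
  induction n as [|n IH]; cbn [range lsum]; [reflexivity|].
  rewrite IH, Z.opp_involutive. ring.
Qed.

(** The two one-sided series of [sumZ] are not exchanged by reflection, as 0 belongs to the first;
    the sums over [range n] are invariant. *)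
Lemma sumZ_opp f : summableZ f -> summableZ (fun k => f (- k)%Z) -> sumZ (fun k => f (- k)%Z) = sumZ f.
Proof.
  intros H1 H2. generalize (is_lim_seq_unique _ _ (sumZ_lim _ H1)) (is_lim_seq_unique _ _ (sumZ_lim _ H2)).
  rewrite (Lim_seq_ext _ _ (fun n => range_opp n f)). intros -> H. now inversion H.
Qed.

Lemma abs_bdd_opp c : abs_bdd c -> abs_bdd (fun k => c (- k)%Z).
Proof.
  intros [B HB]. exists B. intros l Hl.
  rewrite <- (lsum_map l Z.opp (fun k => Cmod (c k))). apply HB.
  apply Injective_map_NoDup; auto. intros x y; lia.
Qed.

Lemma csumZ_opp c : abs_bdd c -> csumZ (fun k => c (- k)%Z) = csumZ c.
Proof.
  intros H. assert (H' := abs_bdd_opp c H). unfold csumZ. f_equal.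
  - apply (sumZ_opp (fun k => Re (c k))); [now apply abs_bdd_Re|exact (abs_bdd_Re _ H')].
  - apply (sumZ_opp (fun k => Im (c k))); [now apply abs_bdd_Im|exact (abs_bdd_Im _ H')].
Qed.

Lemma csumZ_ext c d : (forall k, c k = d k) -> csumZ c = csumZ d.
Proof. intros H. f_equal. now apply functional_extensionality. Qed.

Lemma sumZ_opp_val f : sumZ (fun k => - f k) = - sumZ f.
Proof. unfold sumZ. rewrite !Series_opp. ring. Qed.

Lemma csumZ_conj c : csumZ (fun k => Cconj (c k)) = Cconj (csumZ c).
Proof. unfold csumZ, Cconj; simpl. f_equal. apply (sumZ_opp_val (fun k => Im (c k))). Qed.

Lemma Cconj_mult a b : Cconj (Cmult a b) = Cmult (Cconj a) (Cconj b).
Proof. unfold Cconj, Cmult; simpl. f_equal; ring. Qed.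

Lemma Cconj_plus a b : Cconj (Cplus a b) = Cplus (Cconj a) (Cconj b).
Proof. unfold Cconj, Cplus; simpl. f_equal; ring. Qed.

Lemma herm_fmul a b : conv a b -> herm a -> herm b -> herm (fmul a b).
Proof.
  intros Hc Ha Hb k. unfold fmul.
  rewrite <- (csumZ_opp _ (Hc (- k)%Z)), <- csumZ_conj. apply csumZ_ext. intros j.
  rewrite Cconj_mult, <- Ha, <- Hb. f_equal. f_equal. ring.
Qed.

Lemma herm_fadd a b : herm a -> herm b -> herm (fadd a b).
Proof. intros Ha Hb k. unfold fadd. now rewrite Ha, Hb, Cconj_plus. Qed.

Lemma herm_fscal c a : herm a -> herm (fscal c a).
Proof.
  intros Ha k. unfold fscal. rewrite Ha, Cconj_mult. f_equal. unfold Cconj, RtoC; simpl. f_equal; ring.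
Qed.

Lemma herm_fsub a b : herm a -> herm b -> herm (fsub a b).
Proof.
  intros Ha Hb k. unfold fsub. rewrite Ha, Hb. unfold Cconj, Cminus, Cplus, Copp; simpl. f_equal; ring.
Qed.

Lemma herm_fconst c : herm (fconst c).
Proof.
  intros k. unfold fconst. replace (Z.eqb (- k) 0) with (Z.eqb k 0).
  - destruct (Z.eqb k 0); unfold Cconj, RtoC; simpl; f_equal; ring.
  - destruct (Z.eqb_spec k 0), (Z.eqb_spec (- k) 0); auto; lia.
Qed.

Lemma herm_dx a : herm a -> herm (dx a).
Proof.
  intros Ha k. unfold dx. rewrite Ha, Cconj_mult, opp_IZR. f_equal. unfold Cconj; simpl. f_equal; ring.
Qed.

Lemma PD_symbol k : Cdiv (0, - 2 * PI * IZR k) (RtoC (deltaZ k + 4 * PI ^ 2 * IZR k ^ 2)) =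
  (0, - 2 * PI * IZR k / (deltaZ k + 4 * PI ^ 2 * IZR k ^ 2)).
Proof.
  assert (H : deltaZ k + 4 * PI ^ 2 * IZR k ^ 2 <> 0).
  { unfold deltaZ. destruct (Z.eqb_spec k 0) as [->|Hk]; [lra|].
    assert (0 < IZR k ^ 2).
    { rewrite <- Rsqr_pow2. apply Rsqr_pos_lt. now apply not_0_IZR. }
    assert (0 < PI ^ 2) by (generalize PI_bounds; nra). nra. }
  unfold Cdiv, Cmult, Cinv, RtoC; cbn [fst snd].
  generalize dependent (deltaZ k + 4 * PI ^ 2 * IZR k ^ 2). intros d H.
  f_equal; field; nra.
Qed.

Lemma herm_PD a : herm a -> herm (PD a).
Proof.
  intros Ha k. unfold PD. rewrite !PD_symbol, Ha, Cconj_mult. f_equal.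
  replace (deltaZ (- k)) with (deltaZ k).
  - rewrite opp_IZR. replace ((- IZR k) ^ 2) with (IZR k ^ 2) by ring.
    unfold Cconj; simpl. unfold Rdiv. f_equal; ring.
  - unfold deltaZ. destruct (Z.eqb_spec k 0), (Z.eqb_spec (- k) 0); auto; lia.
Qed.

(** P(D) gains one derivative: its symbol is 0 at k = 0 and of modulus 1 / (2 pi |k|) elsewhere, and
    (1 + 2 pi |k|) / (2 pi |k|) <= 2. *)
Lemma PD_mod a k : jb k * Cmod (PD a k) <= 2 * Cmod (a k).
Proof.
  unfold PD. rewrite PD_symbol, Cmod_mult, <- Rmult_assoc. apply Rmult_le_compat_r; [apply Cmod_ge_0|].
  generalize PI_bounds (jb_pos k); intros HP Hj.
  destruct (Z.eq_dec k 0) as [->|Hk].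
  - replace (0, - 2 * PI * 0 / (deltaZ 0 + 4 * PI ^ 2 * 0 ^ 2)) with (RtoC 0).
    + rewrite Cmod_0. lra.
    + unfold RtoC. f_equal. unfold Rdiv. ring.
  - unfold deltaZ. destruct (Z.eqb_spec k 0) as [|_]; [tauto|].
    assert (Hk0 : IZR k <> 0) by now apply not_0_IZR.
    assert (Hk1 : 1 <= Rabs (IZR k)) by (rewrite <- abs_IZR; apply IZR_le; lia).
    replace (0, - 2 * PI * IZR k / (0 + 4 * PI ^ 2 * IZR k ^ 2)) with (Cmult Ci (RtoC (- / (2 * PI * IZR k)))).
    + rewrite Cmod_mult, Cmod_R. replace (Cmod Ci) with 1.
      2:{ unfold Cmod, Ci; simpl. replace (0 * (0 * 1) + 1 * (1 * 1)) with 1 by ring. now rewrite sqrt_1. }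
      rewrite Rabs_Ropp, Rabs_inv, !Rabs_mult, (Rabs_pos_eq 2), (Rabs_pos_eq PI) by lra.
      assert (0 < 2 * PI * Rabs (IZR k)) by nra.
      apply Rmult_le_reg_r with (2 * PI * Rabs (IZR k)); auto. field_simplify; [|split; lra].
      generalize (jb_lip k 0). rewrite Z.sub_0_r.
      unfold jb at 2. replace (1 + 4 * PI ^ 2 * 0 ^ 2) with 1 by ring. rewrite sqrt_1. nra.
    + unfold Ci, RtoC, Cmult; simpl. f_equal; field; split; auto; lra.
Qed.

Lemma nle_PD w w' a B : (forall k, 0 < w' k) -> (forall k, w' k <= jb k * w k) -> (forall k, 0 < w k) ->
  nle w a B -> nle w' (PD a) (2 * B).
Proof.
  intros Hw' Hw Hw0. apply nle_le; auto; [lra|]. intros k.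
  apply Rle_trans with (w k * (jb k * Cmod (PD a k))).
  - generalize (Cmod_ge_0 (PD a k)) (Hw k). nra.
  - generalize (PD_mod a k) (Hw0 k). nra.
Qed.

Lemma nle_dx w w' a B : (forall k, 0 < w k) -> (forall k, w' k = jb k * w k) -> nle w' a B -> nle w (dx a) B.
Proof.
  intros Hw Hw' H. replace B with (1 * B) by ring. revert H. apply nle_le; auto; [lra|]. intros k.
  rewrite Hw'. unfold dx. rewrite Cmod_mult.
  replace (0, 2 * PI * IZR k) with (Cmult Ci (RtoC (2 * PI * IZR k))).
  - rewrite Cmod_mult, Cmod_R. replace (Cmod Ci) with 1.
    2:{ unfold Cmod, Ci; simpl. replace (0 * (0 * 1) + 1 * (1 * 1)) with 1 by ring. now rewrite sqrt_1. }
    rewrite !Rabs_mult, (Rabs_pos_eq 2), (Rabs_pos_eq PI) by (generalize PI_bounds; lra).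
    generalize (jb_ge k) (Hw k) (Cmod_ge_0 (a k)); intros.
    rewrite !Rmult_1_l. replace (jb k * w k * Cmod (a k)) with (w k * (jb k * Cmod (a k))) by ring.
    apply Rmult_le_compat_l; [lra|]. now apply Rmult_le_compat_r.
  - unfold Ci, RtoC, Cmult; simpl. f_equal; ring.
Qed.

Lemma nle_wle w w' a B : (forall k, 0 < w k) -> (forall k, w k <= w' k) -> nle w' a B -> nle w a B.
Proof.
  intros Hw H H1. replace B with (1 * B) by ring. revert H1. apply nle_le; auto; [lra|].
  intros k. rewrite Rmult_1_l. apply Rmult_le_compat_r; [apply Cmod_ge_0|auto].
Qed.

Lemma conv_fsubr a b c k : conv a b -> conv a c -> fmul a (fsub b c) k = Cminus (fmul a b k) (fmul a c k).
Proof.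
  intros H1 H2. unfold fmul. rewrite <- csumZ_minus; auto. apply csumZ_ext. intros j. unfold fsub. ring.
Qed.
Lemma conv_fsubl a b c k : conv a c -> conv b c -> fmul (fsub a b) c k = Cminus (fmul a c k) (fmul b c k).
Proof.
  intros H1 H2. unfold fmul. rewrite <- csumZ_minus; auto. apply csumZ_ext. intros j. unfold fsub. ring.
Qed.

Lemma dx_fsub a b : dx (fsub a b) = fsub (dx a) (dx b).
Proof. apply functional_extensionality. intros k. unfold dx, fsub. ring. Qed.

Lemma fmul_addl a b c k : conv a c -> conv b c -> fmul (fadd a b) c k = Cplus (fmul a c k) (fmul b c k).
Proof.
  intros H1 H2. unfold fmul. rewrite <- csumZ_plus; auto. apply csumZ_ext. intros j. unfold fadd. ring.
Qed.

(** Telescoping of the quadratic terms. Only the first term loses a derivative: in the others the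
    difference is undifferentiated or under P(D). *)
Lemma Fu_diff g mu mu' u rho v sg k :
  conv (fadd u (fconst g)) (dx u) -> conv (fadd u (fconst g)) (dx v) -> conv (fadd v (fconst g)) (dx v) ->
  conv u (dx v) -> conv v (dx v) -> conv (fconst g) (dx v) ->
  conv (dx u) (dx u) -> conv (dx u) (dx v) -> conv (dx v) (dx v) ->
  conv rho rho -> conv rho sg -> conv sg sg ->
  Cminus (Fu g mu u rho k) (Fu g mu' v sg k) =
  fadd (fmul (fadd u (fconst g)) (dx (fsub u v))) (fadd (fmul (fsub u v) (dx v))
   (PD (fadd (fadd (fscal (2 * mu) (fsub u v)) (fscal (2 * (mu - mu')) v))
     (fadd (fscal (1/2) (fadd (fmul (dx u) (dx (fsub u v))) (fmul (dx (fsub u v)) (dx v))))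
           (fscal (1/2) (fadd (fmul rho (fsub rho sg)) (fmul (fsub rho sg) sg))))))) k.
Proof.
  intros. rewrite !dx_fsub.
  assert (E1 := conv_fsubr (fadd u (fconst g)) (dx u) (dx v) k ltac:(auto) ltac:(auto)).
  assert (E2 := conv_fsubl u v (dx v) k ltac:(auto) ltac:(auto)).
  assert (E3 := conv_fsubr (dx u) (dx u) (dx v) k ltac:(auto) ltac:(auto)).
  assert (E4 := conv_fsubl (dx u) (dx v) (dx v) k ltac:(auto) ltac:(auto)).
  assert (E5 := conv_fsubr rho rho sg k ltac:(auto) ltac:(auto)).
  assert (E6 := conv_fsubl rho sg sg k ltac:(auto) ltac:(auto)).
  assert (E7 := fmul_addl u (fconst g) (dx v) k ltac:(auto) ltac:(auto)).
  assert (E8 := fmul_addl v (fconst g) (dx v) k ltac:(auto) ltac:(auto)).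
  revert E1 E2 E3 E4 E5 E6 E7 E8. unfold Fu, PD.
  generalize (Cdiv (0, - 2 * PI * IZR k) (RtoC (deltaZ k + 4 * PI ^ 2 * IZR k ^ 2))). intros X.
  (* With the products opaque, the claim is a ring identity modulo the bilinearity equations. *)
  repeat match goal with |- context [fmul ?a ?b] => generalize (fmul a b); intros ? end.
  unfold fadd, fsub, fscal. intros -> -> -> -> -> -> E7 E8. rewrite E7, E8.
  rewrite !RtoC_mult, !RtoC_minus. ring.
Qed.

Lemma Frho_diff g u rho v sg k :
  conv (fadd u (fconst g)) (dx rho) -> conv (fadd u (fconst g)) (dx sg) -> conv u (dx sg) ->
  conv v (dx sg) -> conv (fconst g) (dx sg) ->
  conv (dx u) rho -> conv (dx u) sg -> conv (dx v) sg ->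
  Cminus (fadd (fmul (fadd u (fconst g)) (dx rho)) (fmul (dx u) rho) k)
         (fadd (fmul (fadd v (fconst g)) (dx sg)) (fmul (dx v) sg) k) =
  fadd (fmul (fadd u (fconst g)) (dx (fsub rho sg))) (fadd (fmul (fsub u v) (dx sg))
   (fadd (fmul (dx u) (fsub rho sg)) (fmul (dx (fsub u v)) sg))) k.
Proof.
  intros. rewrite !dx_fsub.
  assert (E1 := conv_fsubr (fadd u (fconst g)) (dx rho) (dx sg) k ltac:(auto) ltac:(auto)).
  assert (E2 := conv_fsubl u v (dx sg) k ltac:(auto) ltac:(auto)).
  assert (E3 := conv_fsubr (dx u) rho sg k ltac:(auto) ltac:(auto)).
  assert (E4 := conv_fsubl (dx u) (dx v) sg k ltac:(auto) ltac:(auto)).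
  assert (E7 := fmul_addl u (fconst g) (dx sg) k ltac:(auto) ltac:(auto)).
  assert (E8 := fmul_addl v (fconst g) (dx sg) k ltac:(auto) ltac:(auto)).
  revert E1 E2 E3 E4 E7 E8.
  repeat match goal with |- context [fmul ?a ?b] => generalize (fmul a b); intros ? end.
  unfold fadd, fsub. intros -> -> -> -> E7 E8. rewrite E7, E8. ring.
Qed.

(** * Lipschitz and energy estimates *)

(** Half the time derivative of the weighted energy of a curve at a with velocity b. *)
Definition pairing (w : Z -> R) (l : list Z) (a b : fseq) : R :=
  lsum l (fun k => w k ^ 2 * Re (Cmult (Cconj (a k)) (b k))).

(** The transported function is supported in [l], so that both frequencies run over the same finite
    set and can be exchanged. *)
Definition transport_bound (w wa : Z -> R) (c : R) : Prop :=
  forall a f A F l, herm a -> nle wa a A -> nle w f F -> NoDup l ->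
  (forall k, ~ In k l -> f k = RtoC 0) -> Rabs (pairing w l f (fmul a (dx f))) <= c * A * F ^ 2.

Definition product_bound (wc wa wb : Z -> R) (c : R) : Prop :=
  forall a b A B, nle wa a A -> nle wb b B -> conv a b /\ nle wc (fmul a b) (c * A * B).

(** All that the evolution argument needs from harmonic analysis, with one constant. [est_alg],
    [est_tr1], [est_tr2] serve the energy of a single trajectory, uniformly in L and N; [est_neg]
    the rho-equation in H^(r-2); the low ones the differences in H^(1/2) x H^(-1/2). *)
Record estimates (r c : R) : Prop := {
  est_c : 1 <= c;
  est_alg : forall L N, 0 <= L -> 0 < N -> product_bound (vw (r - 1) L N) (vw (r - 1) L N) (vw (r - 1) L N) c;
  est_neg : product_bound (jp (r - 2)) (jp r) (jp (r - 2)) c;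
  est_low1 : product_bound (jp (1/2)) (jp (1/2)) (jp (r - 1)) c;
  est_low2 : product_bound (jp (-(1/2))) (jp (-(1/2))) (jp (r - 1)) c;
  est_low2' : product_bound (jp (-(1/2))) (jp (r - 1)) (jp (-(1/2))) c;
  est_low3 : product_bound (jp (-(1/2))) (jp (1/2)) (jp (r - 2)) c;
  est_tr1 : forall L N, 0 <= L -> 0 < N -> transport_bound (vw r L N) (vw r L N) c;
  est_tr2 : forall L N, 0 <= L -> 0 < N -> transport_bound (vw (r - 1) L N) (vw r L N) c;
  est_trl1 : transport_bound (jp (1/2)) (jp r) c;
  est_trl2 : transport_bound (jp (-(1/2))) (jp r) c }.

(** At L = 0 the weighted estimates become the plain Sobolev ones; N = 1 is an arbitrary positive
    choice. *)
Lemma mw0 k : mw 0 1 k = 1.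
Proof. unfold mw. ring. Qed.

Lemma vw0 q : vw q 0 1 = jp q.
Proof. apply functional_extensionality. intros k. unfold vw. rewrite mw0. ring. Qed.

(** Multiplied by <k>, this is [vw_kernel] with one power of <k-j> moved by <k-j> <= 2 <k> <j>; the
    extra <j> is the surplus of [jp r] over [jp (r - 1)]. *)
Lemma kernel_neg r : 1 <= r -> kernel r (jp (r - 2)) (jp r) (jp (r - 2)) (2 * (2 * Rpower 2 (r - 1))).
Proof.
  intros Hr k j. generalize (vw_kernel 0 1 (Rle_refl 0) Rlt_0_1 r k j Hr). rewrite vw0. intros H.
  set (c := 2 * Rpower 2 (r - 1)) in *.
  assert (Hc : 0 < c) by (unfold c; generalize (exp_pos ((r - 1) * ln 2)); unfold Rpower; lra).
  clearbody c.
  assert (E : forall q i, jp (q - 1) i * jb i = jp q i).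
  { intros. rewrite <- (jp_1 i), <- jp_plus. f_equal; ring. }
  assert (E2 : forall i, jp (r - 2) i * jb i = jp (r - 1) i).
  { intros. rewrite <- (jp_1 i), <- jp_plus. f_equal; ring. }
  rewrite <- (E2 k), <- (E2 (k - j)%Z) in H.
  generalize (jb_pos k) (jb_peetre j k). replace (j - k)%Z with (- (k - j))%Z by ring. rewrite jb_even. intros Hk _.
  assert (HP : jb (k - j) <= 2 * jb k * jb j).
  { generalize (jb_triangle_diff k j) (jb_ge1 k) (jb_ge1 j). nra. }
  apply Rmult_le_reg_r with (jb k); auto. eapply Rle_trans; [apply H|].
  replace (c * (jp (r - 1) j * (jp (r - 2) (k - j) * jb (k - j))) * Th r k j)
    with (c * jp (r - 1) j * jp (r - 2) (k - j) * Th r k j * jb (k - j)) by ring.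
  replace (2 * c * (jp r j * jp (r - 2) (k - j)) * Th r k j * jb k)
    with (c * jp (r - 1) j * jp (r - 2) (k - j) * Th r k j * (2 * jb k * jb j)) by (rewrite <- (E r j); ring).
  apply Rmult_le_compat_l; auto.
  left. repeat apply Rmult_lt_0_compat; auto using jp_pos, Th_pos.
Qed.

Lemma product_of_kernel r S wc wa wb K c : 0 < S ->
  (forall l, NoDup l -> lsum l (fun k => jp (1 - r) k ^ 2) <= S ^ 2) ->
  (forall k, 0 < wc k) -> (forall k, 0 < wa k) -> (forall k, 0 < wb k) -> 0 <= K ->
  kernel r wc wa wb K -> 3 * S * K <= c -> product_bound wc wa wb c.
Proof.
  intros HS0 HS Hc Ha Hb HK0 HK Hle a b A B HA HB. split.
  - eapply conv_kernel with (wc := wc) (wa := wa) (wb := wb); eauto.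
  - eapply nle_weak; [eapply nle_fmul with (wc := wc) (wa := wa) (wb := wb); eauto|].
    apply Rmult_le_compat_r; [apply HB|]. apply Rmult_le_compat_r; [apply HA|]. auto.
Qed.

Lemma transport_of_symb r S w wa K c : 0 < S ->
  (forall l, NoDup l -> lsum l (fun k => jp (1 - r) k ^ 2) <= S ^ 2) ->
  (forall k, 0 < w k) -> (forall k, 0 < wa k) -> 0 <= K ->
  (forall k j, symb w k j <= K * (w k * w j * wa (k - j)%Z) * Th r k j) -> 12 * S * K <= c ->
  transport_bound w wa c.
Proof.
  intros HS0 HS Hw Ha HK0 HK Hle a f A F l Hh HA HF Hl Hf.
  eapply Rle_trans; [eapply transport with (wa := wa); eauto|].
  apply Rmult_le_compat_r; [apply pow2_ge_0|]. apply Rmult_le_compat_r; [apply HA|]. auto.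
Qed.

Lemma estimates_exist r : 3 / 2 < r -> exists c, estimates r c.
Proof.
  intros Hr. destruct (tau_sum r Hr) as (S & HS0 & HS).
  set (K0 := 2 * Rpower 2 (r - 1)).
  assert (HK0 : 0 < K0) by (unfold K0; generalize (exp_pos ((r - 1) * ln 2)); unfold Rpower; lra).
  destruct (symb_vw r r ltac:(lra) (or_introl eq_refl)) as (K1 & HK1 & H1).
  destruct (symb_vw (r - 1) r ltac:(lra) (or_intror eq_refl)) as (K2 & HK2 & H2).
  set (M := K0 + K1 + K2 + 40).
  assert (HM : forall K, 0 <= K <= M -> 3 * S * K <= 12 * S * M + 1 /\ 12 * S * K <= 12 * S * M + 1).
  { intros K HK. assert (S * K <= S * M) by (apply Rmult_le_compat_l; lra).
    assert (0 <= S * K) by (apply Rmult_le_pos; lra). lra. }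
  exists (3 * S * (2 * K0) + 12 * S * M + 1).
  assert (S * K0 > 0) by nra.
  split.
  - assert (0 < S * M) by (apply Rmult_lt_0_compat; unfold M; lra). lra.
  - intros L N HL HN. apply (product_of_kernel r S _ _ _ K0); auto using vw_pos; try lra.
    + intros k j. now apply vw_kernel; try lra.
    + generalize (proj1 (HM K0 ltac:(unfold M; lra))). lra.
  - apply (product_of_kernel r S _ _ _ (2 * K0)); auto using jp_pos; try lra.
    + apply kernel_neg; lra.
    + assert (0 < S * M) by (apply Rmult_lt_0_compat; unfold M; lra). lra.
  - apply (product_of_kernel r S _ _ _ 2); auto using jp_pos; try lra.
    + apply kernel_low1; lra.
    + generalize (proj1 (HM 2 ltac:(unfold M; lra))). lra.
  - apply (product_of_kernel r S _ _ _ 2); auto using jp_pos; try lra.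
    + apply kernel_low2; lra.
    + generalize (proj1 (HM 2 ltac:(unfold M; lra))). lra.
  - apply (product_of_kernel r S _ _ _ 2); auto using jp_pos; try lra.
    + apply kernel_swap, kernel_low2; lra.
    + generalize (proj1 (HM 2 ltac:(unfold M; lra))). lra.
  - apply (product_of_kernel r S _ _ _ 4); auto using jp_pos; try lra.
    + apply kernel_low3; lra.
    + generalize (proj1 (HM 4 ltac:(unfold M; lra))). lra.
  - intros L N HL HN. apply (transport_of_symb r S _ _ K1); auto using vw_pos.
    generalize (proj2 (HM K1 ltac:(unfold M; lra))). lra.
  - intros L N HL HN. apply (transport_of_symb r S _ _ K2); auto using vw_pos.
    generalize (proj2 (HM K2 ltac:(unfold M; lra))). lra.
  - apply (transport_of_symb r S _ _ 16); auto using jp_pos; try lra.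
    + intros; apply symb_low1; lra.
    + generalize (proj2 (HM 16 ltac:(unfold M; lra))). lra.
  - apply (transport_of_symb r S _ _ 36); auto using jp_pos; try lra.
    + intros; apply symb_low2; lra.
    + generalize (proj2 (HM 36 ltac:(unfold M; lra))). lra.
Qed.

Lemma pairing_plus w l a b b' : pairing w l a (fadd b b') = pairing w l a b + pairing w l a b'.
Proof.
  unfold pairing. rewrite <- lsum_plus. apply lsum_ext. intros k _. unfold fadd.
  destruct (a k), (b k), (b' k). unfold Cmult, Cconj, Cplus, Re; simpl. ring.
Qed.

Lemma pairing_ext w l a b b' : (forall k, b k = b' k) -> pairing w l a b = pairing w l a b'.
Proof. intros H. apply lsum_ext. intros. now rewrite H. Qed.

Lemma pairing_le w l a b A B : (forall k, 0 < w k) -> nle w a A -> nle w b B -> NoDup l ->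
  Rabs (pairing w l a b) <= A * B.
Proof. apply nle_cs. Qed.

(* The rho-equation with transport constant [g = 2 g2]. *)
Definition Fr (g : R) (u rho : fseq) : fseq := fadd (fmul (fadd u (fconst g)) (dx rho)) (fmul (dx u) rho).

Lemma Fr_Frho g2 u rho : Frho g2 u rho = Fr (2 * g2) u rho.
Proof. reflexivity. Qed.

Lemma nle_dx_jp q a B : nle (jp q) a B -> nle (jp (q - 1)) (dx a) B.
Proof.
  apply nle_dx; [intros; apply jp_pos|]. intros k. rewrite <- (jp_1 k), <- jp_plus. f_equal; ring.
Qed.

Lemma nle_jp_le q q' a B : q <= q' -> nle (jp q') a B -> nle (jp q) a B.
Proof. intros H. apply nle_wle; [intros; apply jp_pos|]. intros; now apply jp_le_exp. Qed.

Lemma jp_at0 q : jp q 0 = 1.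
Proof.
  unfold jp, jb. replace (1 + 4 * PI ^ 2 * 0 ^ 2) with 1 by ring. rewrite sqrt_1.
  unfold Rpower. now rewrite ln_1, Rmult_0_r, exp_0.
Qed.

Lemma nle_const_jp q g B : Rabs g <= B -> nle (jp q) (fconst g) B.
Proof.
  intros H. eapply nle_weak; [apply nle_const; intros; apply jp_pos|]. rewrite jp_at0. lra.
Qed.

(** * The nonlinearity at two different states *)

Section Lipschitz.
Variables (r c : R).
Hypothesis Hr : 3 / 2 < r.
Hypothesis E : estimates r c.

Lemma alg_jp : product_bound (jp (r - 1)) (jp (r - 1)) (jp (r - 1)) c.
Proof. generalize (est_alg r c E 0 1 (Rle_refl 0) Rlt_0_1). now rewrite vw0. Qed.

Variables (g mu mu' R0 : R) (u rho v sg : fseq).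
Hypothesis HR : 1 <= R0.
Hypothesis Hg : Rabs g <= R0.
Hypothesis Hu : nle (jp r) u R0.
Hypothesis Hv : nle (jp r) v R0.
Hypothesis Hrho : nle (jp (r - 1)) rho R0.
Hypothesis Hsg : nle (jp (r - 1)) sg R0.

Let Hu' : nle (jp (r - 1)) u R0. Proof. revert Hu. apply nle_jp_le; lra. Qed.
Let Hv' : nle (jp (r - 1)) v R0. Proof. revert Hv. apply nle_jp_le; lra. Qed.
Let Hug : nle (jp r) (fadd u (fconst g)) (2 * R0).
Proof. replace (2 * R0) with (R0 + R0) by ring. apply nle_add; auto using jp_pos, nle_const_jp. Qed.
Let Hvg : nle (jp r) (fadd v (fconst g)) (2 * R0).
Proof. replace (2 * R0) with (R0 + R0) by ring. apply nle_add; auto using jp_pos, nle_const_jp. Qed.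
Let Hug' : nle (jp (r - 1)) (fadd u (fconst g)) (2 * R0).
Proof. revert Hug. apply nle_jp_le; lra. Qed.
Let Hvg' : nle (jp (r - 1)) (fadd v (fconst g)) (2 * R0).
Proof. revert Hvg. apply nle_jp_le; lra. Qed.
Let Hdu : nle (jp (r - 1)) (dx u) R0. Proof. now apply nle_dx_jp. Qed.
Let Hdv : nle (jp (r - 1)) (dx v) R0. Proof. now apply nle_dx_jp. Qed.
Let Hdrho : nle (jp (r - 2)) (dx rho) R0.
Proof. replace (r - 2) with (r - 1 - 1) by ring. now apply nle_dx_jp. Qed.
Let Hdsg : nle (jp (r - 2)) (dx sg) R0.
Proof. replace (r - 2) with (r - 1 - 1) by ring. now apply nle_dx_jp. Qed.
Let Hcg : forall q, nle (jp q) (fconst g) R0. Proof. intros; now apply nle_const_jp. Qed.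

Let conv_alg a b A B : nle (jp (r - 1)) a A -> nle (jp (r - 1)) b B -> conv a b.
Proof. intros HA HB. apply (alg_jp a b A B HA HB). Qed.
Let conv_neg a b A B : nle (jp r) a A -> nle (jp (r - 2)) b B -> conv a b.
Proof. intros HA HB. apply (est_neg r c E a b A B HA HB). Qed.

(** The argument of P(D) in [Fu_diff]. [Ddu] and [Ddr] collect everything except the transported
    difference. *)
Definition Dpd : fseq :=
  fadd (fadd (fscal (2 * mu) (fsub u v)) (fscal (2 * (mu - mu')) v))
     (fadd (fscal (1/2) (fadd (fmul (dx u) (dx (fsub u v))) (fmul (dx (fsub u v)) (dx v))))
           (fscal (1/2) (fadd (fmul rho (fsub rho sg)) (fmul (fsub rho sg) sg)))).
Definition Ddu : fseq := fadd (fmul (fsub u v) (dx v)) (PD Dpd).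
Definition Ddr : fseq :=
  fadd (fmul (fsub u v) (dx sg)) (fadd (fmul (dx u) (fsub rho sg)) (fmul (dx (fsub u v)) sg)).

Lemma Fu_sub k : fsub (Fu g mu u rho) (Fu g mu' v sg) k =
  fadd (fmul (fadd u (fconst g)) (dx (fsub u v))) Ddu k.
Proof.
  unfold fsub at 1. apply Fu_diff; eapply conv_alg; eauto.
Qed.

Lemma Fr_sub k : fsub (Fr g u rho) (Fr g v sg) k =
  fadd (fmul (fadd u (fconst g)) (dx (fsub rho sg))) Ddr k.
Proof.
  unfold fsub at 1. apply Frho_diff; solve [eapply conv_alg; eauto | eapply conv_neg; eauto].
Qed.

Lemma herm_Fu : herm u -> herm rho -> herm (Fu g mu u rho).
Proof.
  intros H1 H2. unfold Fu. apply herm_fadd.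
  - apply herm_fmul; [eapply conv_alg; eauto| |now apply herm_dx].
    apply herm_fadd; auto using herm_fconst.
  - apply herm_PD. repeat apply herm_fadd; apply herm_fscal; auto; apply herm_fmul; auto using herm_dx;
      eapply conv_alg; eauto.
Qed.

Lemma herm_Fr : herm u -> herm rho -> herm (Fr g u rho).
Proof.
  intros H1 H2. unfold Fr. apply herm_fadd; apply herm_fmul; auto using herm_dx, herm_fadd, herm_fconst.
  - eapply conv_neg; eauto.
  - eapply conv_alg; eauto.
Qed.

(** A bound that loses one derivative: enough for the clipped field, truncation errors and time
    derivatives, but not for Gronwall. *)
Lemma Lip_Fu d e : nle (jp r) (fsub u v) d -> nle (jp (r - 1)) (fsub rho sg) d ->
  Rabs mu <= R0 -> Rabs (mu - mu') <= e ->
  nle (jp (r - 1)) (fsub (Fu g mu u rho) (Fu g mu' v sg)) (12 * c * R0 * (d + e)).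
Proof.
  intros Hw He Hmu Hme.
  assert (Hc := est_c r c E). assert (d0 := proj1 Hw).
  assert (e0 : 0 <= e) by (eapply Rle_trans; [apply Rabs_pos|apply Hme]).
  assert (Hdw := nle_dx_jp _ _ _ Hw). assert (Hw' := nle_jp_le (r - 1) r _ _ ltac:(lra) Hw).
  assert (P : forall k, 0 < jp (r - 1) k) by (intros; apply jp_pos).
  apply nle_ext with (fadd (fmul (fadd u (fconst g)) (dx (fsub u v))) Ddu); [intros; symmetry; apply Fu_sub|].
  assert (A1 := proj2 (alg_jp _ _ _ _ Hug' Hdw)).
  assert (A2 := proj2 (alg_jp _ _ _ _ Hw' Hdv)).
  assert (A3 := proj2 (alg_jp _ _ _ _ Hdu Hdw)).
  assert (A4 := proj2 (alg_jp _ _ _ _ Hdw Hdv)).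
  assert (A5 := proj2 (alg_jp _ _ _ _ Hrho He)).
  assert (A6 := proj2 (alg_jp _ _ _ _ He Hsg)).
  assert (B1 := nle_add _ _ _ _ _ P A3 A4). assert (B2 := nle_add _ _ _ _ _ P A5 A6).
  assert (B3 := nle_add _ _ _ _ _ P (nle_scal _ _ (1/2) _ P B1) (nle_scal _ _ (1/2) _ P B2)).
  assert (B4 := nle_add _ _ _ _ _ P (nle_scal _ _ (2 * mu) _ P Hw') (nle_scal _ _ (2 * (mu - mu')) _ P Hv')).
  assert (B5 := nle_add _ _ _ _ _ P B4 B3).
  assert (B6 : nle (jp (r - 1)) (PD Dpd)
    (2 * ((Rabs (2 * mu) * d + Rabs (2 * (mu - mu')) * R0) +
    (Rabs (1 / 2) * (c * R0 * d + c * d * R0) + Rabs (1 / 2) * (c * R0 * d + c * d * R0))))).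
  { apply nle_PD with (jp (r - 1)); auto. intros k. generalize (jb_ge1 k) (jp_pos (r - 1) k). nra. }
  eapply nle_weak; [exact (nle_add _ _ _ _ _ P A1 (nle_add _ _ _ _ _ P A2 B6))|].
  rewrite !Rabs_mult, (Rabs_pos_eq 2), (Rabs_pos_eq (1/2)) by lra.
  assert (Rabs mu * d <= R0 * d) by (apply Rmult_le_compat_r; auto).
  assert (Rabs (mu - mu') * R0 <= e * R0) by (apply Rmult_le_compat_r; lra).
  assert (1 * (R0 * d) <= c * (R0 * d)) by (apply Rmult_le_compat_r; nra).
  assert (1 * (R0 * e) <= c * (R0 * e)) by (apply Rmult_le_compat_r; nra).
  assert (0 <= R0 * d) by nra. assert (0 <= R0 * e) by nra. lra.
Qed.

Lemma Lip_Fr d : nle (jp r) (fsub u v) d -> nle (jp (r - 1)) (fsub rho sg) d ->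
  nle (jp (r - 2)) (fsub (Fr g u rho) (Fr g v sg)) (12 * c * R0 * d).
Proof.
  intros Hw He.
  assert (Hc := est_c r c E). assert (d0 := proj1 Hw).
  assert (Hdw := nle_dx_jp _ _ _ Hw).
  assert (Hde := nle_dx_jp _ _ _ He). replace (r - 1 - 1) with (r - 2) in Hde by ring.
  assert (P : forall k, 0 < jp (r - 2) k) by (intros; apply jp_pos).
  apply nle_ext with (fadd (fmul (fadd u (fconst g)) (dx (fsub rho sg))) Ddr); [intros; symmetry; apply Fr_sub|].
  assert (A1 := proj2 (est_neg r c E _ _ _ _ Hug Hde)).
  assert (A2 := proj2 (est_neg r c E _ _ _ _ Hw Hdsg)).
  assert (A3 := proj2 (alg_jp _ _ _ _ Hdu He)).
  assert (A4 := proj2 (alg_jp _ _ _ _ Hdw Hsg)).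
  apply (nle_jp_le (r - 2)) in A3, A4; try lra.
  eapply nle_weak; [exact (nle_add _ _ _ _ _ P A1 (nle_add _ _ _ _ _ P A2 (nle_add _ _ _ _ _ P A3 A4)))|].
  assert (0 <= c * (R0 * d)) by (repeat apply Rmult_le_pos; lra). lra.
Qed.

(** The transported difference is only paired with itself, never measured in norm, and [est_trl1]
    recovers its derivative. *)
Lemma low_Fu l d e : herm u -> nle (jp (1/2)) (fsub u v) d -> nle (jp (-(1/2))) (fsub rho sg) d ->
  Rabs mu <= R0 -> Rabs (mu - mu') <= e -> NoDup l ->
  (forall k, ~ In k l -> fsub u v k = RtoC 0) ->
  Rabs (pairing (jp (1/2)) l (fsub u v) (fsub (Fu g mu u rho) (Fu g mu' v sg))) <= 12 * c * R0 * (d ^ 2 + e * d).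
Proof.
  intros Hh Hw He Hmu Hme Hl Hs.
  assert (Hc := est_c r c E). assert (d0 := proj1 Hw).
  assert (e0 : 0 <= e) by (eapply Rle_trans; [apply Rabs_pos|apply Hme]).
  assert (Hdw := nle_dx_jp _ _ _ Hw). replace (1/2 - 1) with (-(1/2)) in Hdw by lra.
  assert (Hwm := nle_jp_le (-(1/2)) (1/2) _ _ ltac:(lra) Hw).
  assert (Hvm := nle_jp_le (-(1/2)) r _ _ ltac:(lra) Hv).
  assert (P : forall k, 0 < jp (1/2) k) by (intros; apply jp_pos).
  assert (P' : forall k, 0 < jp (-(1/2)) k) by (intros; apply jp_pos).
  rewrite (pairing_ext _ _ _ _ _ Fu_sub), pairing_plus.
  assert (T := est_trl1 r c E _ _ _ _ l (herm_fadd _ _ Hh (herm_fconst g)) Hug Hw Hl Hs).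
  assert (A2 := proj2 (est_low1 r c E _ _ _ _ Hw Hdv)).
  assert (A3 := proj2 (est_low2' r c E _ _ _ _ Hdu Hdw)).
  assert (A4 := proj2 (est_low2 r c E _ _ _ _ Hdw Hdv)).
  assert (A5 := proj2 (est_low2' r c E _ _ _ _ Hrho He)).
  assert (A6 := proj2 (est_low2 r c E _ _ _ _ He Hsg)).
  assert (B1 := nle_add _ _ _ _ _ P' A3 A4). assert (B2 := nle_add _ _ _ _ _ P' A5 A6).
  assert (B3 := nle_add _ _ _ _ _ P' (nle_scal _ _ (1/2) _ P' B1) (nle_scal _ _ (1/2) _ P' B2)).
  assert (B4 := nle_add _ _ _ _ _ P' (nle_scal _ _ (2 * mu) _ P' Hwm) (nle_scal _ _ (2 * (mu - mu')) _ P' Hvm)).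
  assert (B5 := nle_add _ _ _ _ _ P' B4 B3).
  assert (B6 : nle (jp (1/2)) (PD Dpd)
    (2 * ((Rabs (2 * mu) * d + Rabs (2 * (mu - mu')) * R0) +
    (Rabs (1 / 2) * (c * R0 * d + c * d * R0) + Rabs (1 / 2) * (c * R0 * d + c * d * R0))))).
  { apply nle_PD with (jp (-(1/2))); auto. intros k. rewrite <- (jp_1 k), <- jp_plus.
    apply Req_le. f_equal. lra. }
  assert (Q := pairing_le _ l _ _ _ _ P Hw (nle_add _ _ _ _ _ P A2 B6) Hl). fold Ddu in Q.
  eapply Rle_trans; [apply Rabs_triang|]. eapply Rle_trans; [apply Rplus_le_compat; [exact T|exact Q]|].
  rewrite !Rabs_mult, (Rabs_pos_eq 2), (Rabs_pos_eq (1/2)) by lra.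
  assert (Rabs mu * (d * d) <= R0 * (d * d)) by (apply Rmult_le_compat_r; nra).
  assert (Rabs (mu - mu') * (R0 * d) <= e * (R0 * d)) by (apply Rmult_le_compat_r; nra).
  assert (0 <= R0 * (d * d)) by (apply Rmult_le_pos; nra). assert (0 <= R0 * (d * e)) by (apply Rmult_le_pos; nra).
  assert (1 * (R0 * (d * d)) <= c * (R0 * (d * d))) by (apply Rmult_le_compat_r; lra).
  assert (1 * (R0 * (d * e)) <= c * (R0 * (d * e))) by (apply Rmult_le_compat_r; lra).
  lra.
Qed.

Lemma low_Fr l d : herm u -> nle (jp (1/2)) (fsub u v) d -> nle (jp (-(1/2))) (fsub rho sg) d ->
  NoDup l -> (forall k, ~ In k l -> fsub rho sg k = RtoC 0) ->
  Rabs (pairing (jp (-(1/2))) l (fsub rho sg) (fsub (Fr g u rho) (Fr g v sg))) <= 12 * c * R0 * d ^ 2.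
Proof.
  intros Hh Hw He Hl Hs.
  assert (Hc := est_c r c E). assert (d0 := proj1 Hw).
  assert (Hdw := nle_dx_jp _ _ _ Hw). replace (1/2 - 1) with (-(1/2)) in Hdw by lra.
  assert (P' : forall k, 0 < jp (-(1/2)) k) by (intros; apply jp_pos).
  rewrite (pairing_ext _ _ _ _ _ Fr_sub), pairing_plus.
  assert (T := est_trl2 r c E _ _ _ _ l (herm_fadd _ _ Hh (herm_fconst g)) Hug He Hl Hs).
  assert (A2 := proj2 (est_low3 r c E _ _ _ _ Hw Hdsg)).
  assert (A3 := proj2 (est_low2' r c E _ _ _ _ Hdu He)).
  assert (A4 := proj2 (est_low2 r c E _ _ _ _ Hdw Hsg)).
  assert (Q := pairing_le _ l _ _ _ _ P' He (nle_add _ _ _ _ _ P' A2 (nle_add _ _ _ _ _ P' A3 A4)) Hl).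
  eapply Rle_trans; [apply Rabs_triang|]. eapply Rle_trans; [apply Rplus_le_compat; [exact T|exact Q]|].
  assert (0 <= R0 * (d * d)) by (apply Rmult_le_pos; nra).
  assert (1 * (R0 * (d * d)) <= c * (R0 * (d * d))) by (apply Rmult_le_compat_r; lra).
  lra.
Qed.

End Lipschitz.

Lemma vw_at0 q L N : 0 < N -> vw q L N 0 = 1.
Proof.
  intros HN. unfold vw, mw. rewrite jp_at0, Rabs_R0. unfold Rdiv. rewrite Rmult_0_l, Rmin_right; lra.
Qed.

(** * Energy bounds for one state in the weighted high norm *)

Section HighEnergy.
Variables (r c L N g g' mu B : R) (u rho : fseq) (l : list Z).
Hypothesis Hr : 3 / 2 < r.
Hypothesis E : estimates r c.
Hypothesis HL : 0 <= L.
Hypothesis HN : 0 < N.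
Hypothesis HB : 1 <= B.
Hypothesis Hg : Rabs g <= B.
Hypothesis Hg' : Rabs g' <= B.
Hypothesis Hmu : Rabs mu <= B.
Hypothesis Hu : nle (vw r L N) u B.
Hypothesis Hrho : nle (vw (r - 1) L N) rho B.
Hypothesis hu : herm u.
Hypothesis Hl : NoDup l.
Hypothesis su : forall k, ~ In k l -> u k = RtoC 0.
Hypothesis srho : forall k, ~ In k l -> rho k = RtoC 0.

Let P1 : forall k, 0 < vw r L N k. Proof. intros; now apply vw_pos. Qed.
Let P2 : forall k, 0 < vw (r - 1) L N k. Proof. intros; now apply vw_pos. Qed.
Let WV k : vw r L N k = jb k * vw (r - 1) L N k.
Proof. rewrite <- vw_S; auto. f_equal; ring. Qed.

Lemma high_Fu : Rabs (pairing (vw r L N) l u (Fu g mu u rho)) <= 12 * c * B ^ 3.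
Proof.
  assert (Hc := est_c r c E).
  unfold Fu. rewrite pairing_plus.
  assert (Hug : nle (vw r L N) (fadd u (fconst g)) (2 * B)).
  { replace (2 * B) with (B + B) by ring. apply nle_add; auto.
    eapply nle_weak; [now apply nle_const|]. rewrite vw_at0; auto. lra. }
  assert (T := est_tr1 r c E L N HL HN _ _ _ _ l (herm_fadd _ _ hu (herm_fconst g)) Hug Hu Hl su).
  assert (Hdu : nle (vw (r - 1) L N) (dx u) B) by (apply nle_dx with (vw r L N); auto).
  assert (Hu' : nle (vw (r - 1) L N) u B).
  { apply nle_wle with (vw r L N); auto. intros k. rewrite WV. generalize (jb_ge1 k) (P2 k). nra. }
  assert (A1 := proj2 (est_alg r c E L N HL HN _ _ _ _ Hdu Hdu)).
  assert (A2 := proj2 (est_alg r c E L N HL HN _ _ _ _ Hrho Hrho)).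
  assert (B3 := nle_add _ _ _ _ _ P2 (nle_scal _ _ (1/2) _ P2 A1) (nle_scal _ _ (1/2) _ P2 A2)).
  assert (B4 := nle_add _ _ _ _ _ P2 (nle_scal _ _ (2 * mu) _ P2 Hu') B3).
  assert (B5 := nle_PD _ (vw r L N) _ _ P1 (fun k => Req_le _ _ (WV k)) P2 B4).
  assert (Q := pairing_le _ l _ _ _ _ P1 Hu B5 Hl).
  eapply Rle_trans; [apply Rabs_triang|]. eapply Rle_trans; [apply Rplus_le_compat; [exact T|exact Q]|].
  rewrite !Rabs_mult, (Rabs_pos_eq 2), (Rabs_pos_eq (1/2)) by lra.
  assert (0 <= B * B) by nra. assert (0 <= B * (B * B)) by nra.
  assert (Rabs mu * (B * B) <= B * (B * B)) by (apply Rmult_le_compat_r; lra).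
  assert (1 * (B * (B * B)) <= c * (B * (B * B))) by (apply Rmult_le_compat_r; lra).
  lra.
Qed.

Lemma high_Fr : Rabs (pairing (vw (r - 1) L N) l rho (Fr g' u rho)) <= 12 * c * B ^ 3.
Proof.
  assert (Hc := est_c r c E).
  unfold Fr. rewrite pairing_plus.
  assert (Hug : nle (vw r L N) (fadd u (fconst g')) (2 * B)).
  { replace (2 * B) with (B + B) by ring. apply nle_add; auto.
    eapply nle_weak; [now apply nle_const|]. rewrite vw_at0; auto. lra. }
  assert (T := est_tr2 r c E L N HL HN _ _ _ _ l (herm_fadd _ _ hu (herm_fconst g')) Hug Hrho Hl srho).
  assert (Hdu : nle (vw (r - 1) L N) (dx u) B) by (apply nle_dx with (vw r L N); auto).
  assert (A1 := proj2 (est_alg r c E L N HL HN _ _ _ _ Hdu Hrho)).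
  assert (Q := pairing_le _ l _ _ _ _ P2 Hrho A1 Hl).
  eapply Rle_trans; [apply Rabs_triang|]. eapply Rle_trans; [apply Rplus_le_compat; [exact T|exact Q]|].
  assert (0 <= B * (B * B)) by (repeat apply Rmult_le_pos; lra).
  assert (1 * (B * (B * B)) <= c * (B * (B * B))) by (apply Rmult_le_compat_r; lra).
  lra.
Qed.

End HighEnergy.

(** * Gronwall, bootstrap and Picard iteration *)

Lemma cont_eps (f : R -> R) t : continuous f t <->
  forall eps, 0 < eps -> exists d, 0 < d /\ forall t', Rabs (t' - t) < d -> Rabs (f t' - f t) < eps.
Proof.
  split.
  - intros H eps Heps.
    destruct (proj1 (filterlim_locally _ _) H (mkposreal eps Heps)) as [d Hd].
    exists d. split; [apply cond_pos|]. intros t' Ht. apply (Hd t'). exact Ht.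
  - intros H. apply filterlim_locally. intros eps.
    destruct (H eps (cond_pos eps)) as (d & Hd & HH).
    exists (mkposreal d Hd). intros t' Ht. apply HH. exact Ht.
Qed.

Lemma mvt (f f' : R -> R) a b : a < b ->
  (forall t, a <= t <= b -> continuous f t) -> (forall t, a < t < b -> is_derive f t (f' t)) ->
  exists x, a < x < b /\ f b - f a = f' x * (b - a).
Proof.
  intros Hlt Hc Hd.
  assert (pr : forall c, a < c < b -> derivable_pt f c).
  { intros c Hx. exists (f' c). apply is_derive_Reals. auto. }
  destruct (MVT f id a b pr (fun c _ => derivable_pt_id c) Hlt) as (x & Px & Hx).
  - intros c Hx. apply continuity_pt_filterlim. now apply Hc.
  - intros c Hx. apply derivable_continuous_pt, derivable_pt_id.
  - exists x. split; auto. 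
    assert (E : derive_pt f x (pr x Px) = f' x).
    { apply derive_pt_eq_0. apply is_derive_Reals. auto. }
    rewrite E, derive_pt_id in Hx. unfold id in Hx. lra.
Qed.

(** exp(-K t) (D + kap) is nonincreasing, by the mean value theorem. *)
Lemma gronwall (D D' : R -> R) K kap T : 0 <= kap ->
  (forall t, continuous D t) -> (forall t, 0 < t < T -> is_derive D t (D' t)) ->
  (forall t, 0 < t < T -> D' t <= K * (D t + kap)) ->
  forall t, 0 <= t <= T -> D t <= exp (K * t) * (D 0 + kap).
Proof.
  intros Hk Hc Hd HD t Ht.
  destruct (Req_dec t 0) as [->|Ht0].
  - rewrite Rmult_0_r, exp_0. lra.
  - set (f := fun t => exp (- K * t) * (D t + kap)).
    set (f' := fun t => - K * exp (- K * t) * (D t + kap) + exp (- K * t) * D' t).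
    destruct (mvt f f' 0 t) as (x & Hx & E); [lra| | |].
    + intros x Hx. unfold f. apply (continuous_mult (fun t => exp (- K * t)) (fun t => D t + kap)).
      * apply continuous_exp_comp, (continuous_mult (fun _ => - K) (fun t => t)); [apply continuous_const|apply continuous_id].
      * apply (continuous_plus D (fun _ => kap)); [apply Hc|apply continuous_const].
    + intros x Hx. specialize (Hd x ltac:(lra)). unfold f, f'. auto_derive.
      * exists (D' x). exact Hd.
      * replace (Derive (fun x0 : R => D x0) x) with (D' x) by (symmetry; apply is_derive_unique; exact Hd). ring.
    + assert (Hf : f' x <= 0).
      { unfold f'. specialize (HD x ltac:(lra)). generalize (exp_pos (- K * x)). nra. }
      assert (Hft : f t <= f 0) by nra.
      unfold f in Hft. rewrite Rmult_0_r, exp_0 in Hft.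
      assert (exp (K * t) * (exp (- K * t) * (D t + kap)) <= exp (K * t) * (1 * (D 0 + kap))).
      { apply Rmult_le_compat_l; auto. left; apply exp_pos. }
      rewrite <- Rmult_assoc, <- exp_plus in H. replace (K * t + - K * t) with 0 in H by ring.
      rewrite exp_0 in H. lra.
Qed.

(** Induction along [0, T]: the supremum of the initial segments on which P holds belongs to them,
    by the first hypothesis, and cannot lie below T, by the second. *)
Lemma cont_induction (T : R) (P : R -> Prop) :
  (forall t, 0 <= t <= T -> (forall s, 0 <= s < t -> P s) -> P t) ->
  (forall t, 0 <= t < T -> (forall s, 0 <= s <= t -> P s) ->
     exists d, 0 < d /\ forall s, t < s < t + d -> s <= T -> P s) ->
  forall t, 0 <= t <= T -> P t.
Proof.
  intros H1 H2 t Ht.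
  destruct (classic (P t)) as [|Hn]; auto. exfalso.
  set (S := fun x => 0 <= x <= T /\ forall s, 0 <= s <= x -> P s).
  assert (H0 : S 0).
  { split; [lra|]. intros s Hs. apply H1; [lra|]. intros s' Hs'. lra. }
  destruct (completeness S) as [x [Hub Hlub]].
  - exists T. intros x [Hx _]. lra.
  - now exists 0.
  - assert (Hx0 : 0 <= x) by now apply Hub.
    assert (HxT : x <= T) by (apply Hlub; intros y [Hy _]; lra).
    assert (Hlt : forall s, 0 <= s < x -> P s).
    { intros s Hs. destruct (classic (exists y, S y /\ s < y)) as [(y & [Hy Hy'] & Hsy)|HN].
      - apply Hy'; lra.
      - assert (x <= s); [|lra]. apply Hlub. intros y Hy. apply Rnot_lt_le. intros Hsy. apply HN. now exists y. }
    assert (Hx : S x).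
    { split; [lra|]. intros s Hs. destruct (Req_dec s x) as [->|]; [|apply Hlt; lra].
      apply H1; auto. }
    destruct (Rle_lt_dec T x) as [HTx|HTx].
    + apply Hn. apply (proj2 Hx). lra.
    + destruct (H2 x ltac:(lra) (proj2 Hx)) as (d & Hd & HP).
      set (y := Rmin T (x + d / 2)).
      assert (Hy : x < y) by (unfold y; apply Rmin_glb_lt; lra).
      assert (Hy2 : y <= x + d / 2) by apply Rmin_r.
      assert (Hy3 : y <= T) by apply Rmin_l.
      assert (S y); [|specialize (Hub y H); lra].
      split; [lra|]. intros s Hs. destruct (Rle_lt_dec s x).
      * apply (proj2 Hx). lra.
      * apply HP; lra.
Qed.

(** As long as D stays below the threshold, its increase is at most M T < eta; the strict gap lets
    continuity carry the bound further. *)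
Lemma bootstrap (D D' : R -> R) A eta M T : 0 < eta -> 0 <= M ->
  (forall t, continuous D t) -> (forall t, 0 < t < T -> is_derive D t (D' t)) ->
  D 0 <= A -> (forall t, 0 < t < T -> D t <= A + eta -> D' t <= M) -> M * T < eta ->
  forall t, 0 <= t <= T -> D t <= A + eta.
Proof.
  intros Heta HM Hc Hd H0 HD HMT.
  assert (Step : forall t, 0 <= t <= T -> (forall s, 0 <= s < t -> D s <= A + eta) -> D t < A + eta).
  { intros t Ht Hs. destruct (Req_dec t 0) as [->|Ht0]; [lra|].
    destruct (mvt D D' 0 t) as (x & Hx & E); [lra|auto| |].
    - intros x Hx. apply Hd. lra.
    - assert (D' x <= M) by (apply HD; [lra|apply Hs; lra]).
      assert (D' x * (t - 0) <= M * T) by nra. lra. }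
  apply cont_induction.
  - intros t Ht Hs. left. now apply Step.
  - intros t Ht Hs. assert (H : D t < A + eta) by (apply Step; [lra|intros; apply Hs; lra]).
    destruct (proj1 (cont_eps D t) (Hc t) (A + eta - D t) ltac:(lra)) as (d & Hd0 & HH).
    exists d. split; auto. intros s Hst _.
    specialize (HH s). rewrite Rabs_pos_eq in HH by lra. specialize (HH ltac:(lra)).
    generalize (Rle_abs (D s - D t)). lra.
Qed.

Definition integral (g : R -> R) (a b : R) : R := RInt g a b.

(** * Picard iteration for systems over an arbitrary index set *)

Section Picard.
Variable I : Type.
Variable G : (I -> R) -> I -> R.
Variables (L A : R) (x0 : I -> R).
Hypothesis HL : 1 <= L.
Hypothesis HA : 0 <= A.
Hypothesis Glip : forall x y d, 0 <= d -> (forall i, Rabs (x i - y i) <= d) ->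
  forall i, Rabs (G x i - G y i) <= L * d.
Hypothesis G0 : forall i, Rabs (G x0 i) <= A.

(** [Rmax 0 t] freezes the iterates at negative times, so that they are continuous on the whole
    line. *)
Fixpoint pic (n : nat) (t : R) (i : I) : R :=
  match n with
  | O => x0 i
  | S m => x0 i + integral (fun s => G (pic m s) i) 0 (Rmax 0 t)
  end.

(** Bielecki weight: relative to it, integrating a function of size L contributes at most 1/2, so
    the iteration contracts for all times at once. *)
Let ee (t : R) := exp (2 * L * t).

(** Uniform over the index, as [Glip] measures the argument in the sup norm. *)
Definition equicont (x : R -> I -> R) : Prop := forall t eps, 0 < eps ->
  exists d, 0 < d /\ forall t', Rabs (t' - t) < d -> forall i, Rabs (x t' i - x t i) <= eps.

Lemma equicont_G x i t : equicont x -> continuous (fun s => G (x s) i) t.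
Proof.
  intros H. apply cont_eps. intros eps Heps.
  assert (Hp : 0 < eps / (2 * L)) by (apply Rdiv_lt_0_compat; lra).
  destruct (H t (eps / (2 * L)) Hp) as (d & Hd & HH).
  exists d. split; auto. intros t' Ht.
  eapply Rle_lt_trans; [apply (Glip _ _ (eps / (2 * L))); [lra|auto]|].
  replace (L * (eps / (2 * L))) with (eps / 2) by (field; lra). lra.
Qed.

Lemma RInt_exp_bound (g : R -> R) a b t : 0 <= t -> 0 <= a -> 0 <= b ->
  (forall s, continuous g s) -> (forall s, 0 <= s <= t -> Rabs (g s) <= a + b * ee s) ->
  Rabs (integral g 0 t) <= a * t + b / (2 * L) * (ee t - 1).
Proof.
  intros Ht Ha Hb Hc Hg.
  assert (H : norm (integral g 0 t) <= (a * t + b / (2 * L) * ee t) - (a * 0 + b / (2 * L) * ee 0)).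
  { apply (norm_RInt_le g (fun s => a + b * ee s) 0 t); auto.
    - apply (RInt_correct g). apply (ex_RInt_continuous g). auto.
    - apply (is_RInt_derive (fun t => a * t + b / (2 * L) * ee t) (fun s => a + b * ee s)).
      + intros x _. unfold ee. auto_derive; auto. field. lra.
      + intros x _. apply (continuous_plus (fun _ => a) (fun s => b * ee s)); [apply continuous_const|].
        apply (continuous_mult (fun _ => b) ee); [apply continuous_const|].
        unfold ee. apply continuous_exp_comp, (continuous_mult (fun _ => 2 * L) (fun t => t)); [apply continuous_const|apply continuous_id]. }
  assert (E0 : ee 0 = 1) by (unfold ee; rewrite Rmult_0_r, exp_0; auto). rewrite E0 in H.
  change (norm (integral g 0 t)) with (Rabs (integral g 0 t)) in H. lra.
Qed.

Lemma ee_ge t : 0 <= t -> 1 <= ee t /\ t <= ee t.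
Proof. intros Ht. generalize (exp_ineq1_le (2 * L * t)). unfold ee. intros. split; nra. Qed.

Lemma Rmax0_lip t t' : Rabs (Rmax 0 t' - Rmax 0 t) <= Rabs (t' - t).
Proof. unfold Rmax. destruct (Rle_dec 0 t), (Rle_dec 0 t'); unfold Rabs; repeat destruct Rcase_abs; lra. Qed.

Lemma G_bound (x : R -> I -> R) t B : 0 <= B -> (forall i, Rabs (x t i - x0 i) <= B) -> forall i, Rabs (G (x t) i) <= A + L * B.
Proof.
  intros HB Hx i. replace (G (x t) i) with (G x0 i + (G (x t) i - G x0 i)) by ring.
  eapply Rle_trans; [apply Rabs_triang|]. apply Rplus_le_compat; auto.
Qed.

Lemma equicont_int (x y : R -> I -> R) : equicont x ->
  (forall t i, Rabs (x t i - x0 i) <= 2 * A * ee (Rmax 0 t)) ->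
  (forall t i, y t i = x0 i + integral (fun s => G (x s) i) 0 (Rmax 0 t)) -> equicont y.
Proof.
  intros Hx Hb Hy t eps Heps.
  (* Bound for the field along x up to time t + 1, hence a Lipschitz constant in time for y near
     t. *)
  set (B := A + L * (2 * A * ee (Rmax 0 (t + 1)))).
  assert (He : forall s, 0 < ee s) by (intros; apply exp_pos).
  assert (HB : 0 <= B).
  { unfold B. assert (0 <= A * ee (Rmax 0 (t + 1))) by (apply Rmult_le_pos; auto; left; auto). nra. }
  exists (Rmin 1 (eps / (B + 1))). split.
  { apply Rmin_glb_lt; [lra|]. apply Rdiv_lt_0_compat; lra. }
  intros t' Ht i.
  assert (H1 : Rabs (t' - t) < 1) by (eapply Rlt_le_trans; [apply Ht|apply Rmin_l]).
  assert (H2 : Rabs (t' - t) < eps / (B + 1)) by (eapply Rlt_le_trans; [apply Ht|apply Rmin_r]).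
  set (g := fun s => G (x s) i).
  assert (Hg : forall s, continuous g s) by (intros; now apply equicont_G).
  assert (Hex : forall a b, ex_RInt g a b) by (intros; apply (ex_RInt_continuous g); auto).
  rewrite !Hy. fold g.
  assert (Hgb : forall s, 0 <= s -> s <= Rmax 0 (t + 1) -> Rabs (g s) <= B).
  { intros s Hs0 Hs. unfold g, B.
    apply Rle_trans with (A + L * (2 * A * ee (Rmax 0 s))).
    - apply G_bound; auto. apply Rmult_le_pos; [lra|left; auto].
    - rewrite (Rmax_right 0 s) by auto. apply Rplus_le_compat_l. apply Rmult_le_compat_l; [lra|].
      apply Rmult_le_compat_l; [lra|]. unfold ee. destruct (Req_dec s (Rmax 0 (t + 1))) as [->|]; [lra|].
      left. apply exp_increasing. nra. }
  assert (Hdiff : Rabs (integral g 0 (Rmax 0 t') - integral g 0 (Rmax 0 t)) <= B * Rabs (t' - t)).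
  { assert (Hle : forall p q, 0 <= p <= q -> q <= Rmax 0 (t + 1) -> Rabs (integral g 0 q - integral g 0 p) <= B * (q - p)).
    { intros p q Hpq Hq.
      assert (E : integral g 0 q = integral g 0 p + integral g p q) by (symmetry; apply (RInt_Chasles g 0 p q); auto).
      rewrite E. replace (integral g 0 p + integral g p q - integral g 0 p) with (integral g p q) by ring.
      rewrite Rmult_comm. apply abs_RInt_le_const; [lra|auto|]. intros s Hs. apply Hgb; lra. }
    assert (M1 : Rmax 0 t <= Rmax 0 (t + 1)) by (apply Rle_max_compat_l; lra).
    assert (M2 : Rmax 0 t' <= Rmax 0 (t + 1)) by (apply Rle_max_compat_l; generalize (Rle_abs (t' - t)); lra).
    assert (M3 := Rmax0_lip t t'). assert (M4 := Rmax_l 0 t). assert (M5 := Rmax_l 0 t').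
    eapply Rle_trans; [|apply Rmult_le_compat_l; [exact HB|exact M3]].
    destruct (Rle_dec (Rmax 0 t) (Rmax 0 t')).
    - rewrite (Rabs_pos_eq (Rmax 0 t' - Rmax 0 t)) by lra. apply Hle; lra.
    - rewrite Rabs_minus_sym, (Rabs_minus_sym (Rmax 0 t')), (Rabs_pos_eq (Rmax 0 t - Rmax 0 t')) by lra.
      apply Hle; lra. }
  replace (x0 i + integral g 0 (Rmax 0 t') - (x0 i + integral g 0 (Rmax 0 t))) with
    (integral g 0 (Rmax 0 t') - integral g 0 (Rmax 0 t)) by ring.
  eapply Rle_trans; [apply Hdiff|].
  assert (B * Rabs (t' - t) <= (B + 1) * (eps / (B + 1))).
  { apply Rmult_le_compat; try lra; auto. apply Rabs_pos. }
  replace ((B + 1) * (eps / (B + 1))) with eps in H by (field; lra). auto.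
Qed.

Lemma pic_props n : equicont (pic n) /\ forall t i, Rabs (pic n t i - x0 i) <= 2 * A * ee (Rmax 0 t).
Proof.
  induction n as [|n [IH1 IH2]].
  - split.
    + intros t eps Heps. exists 1. split; [lra|]. intros. simpl. rewrite Rminus_diag, Rabs_R0; lra.
    + intros t i. simpl. rewrite Rminus_diag, Rabs_R0.
      apply Rmult_le_pos; [lra|left; apply exp_pos].
  - split; [now apply (equicont_int (pic n))|]. intros t i. simpl.
    replace (x0 i + integral (fun s => G (pic n s) i) 0 (Rmax 0 t) - x0 i) with
      (integral (fun s => G (pic n s) i) 0 (Rmax 0 t)) by ring.
    assert (H0 := Rmax_l 0 t).
    eapply Rle_trans; [apply (RInt_exp_bound _ A (2 * A * L)); auto|].
    + apply Rmult_le_pos; lra.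
    + intros; now apply equicont_G.
    + intros s Hs. eapply Rle_trans; [apply (G_bound (pic n) s (2 * A * ee (Rmax 0 s)))|].
      * apply Rmult_le_pos; [lra|left; apply exp_pos].
      * auto.
      * rewrite Rmax_right by lra. apply Req_le. ring.
    + replace (2 * A * L / (2 * L)) with A by (field; lra).
      generalize (ee_ge (Rmax 0 t) H0). nra.
Qed.

Lemma half_pos n : 0 < (/ 2) ^ n.
Proof. apply pow_lt. lra. Qed.

(** The contraction by 1/2 in the norm weighted by [ee]. *)
Lemma integral_diff_bound (x y : R -> I -> R) (b : R) t i : 0 <= b -> equicont x -> equicont y ->
  (forall s j, 0 <= s -> Rabs (x s j - y s j) <= b * ee s) ->
  Rabs (integral (fun s => G (x s) i) 0 (Rmax 0 t) - integral (fun s => G (y s) i) 0 (Rmax 0 t))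
    <= b / 2 * ee (Rmax 0 t).
Proof.
  intros Hb Hx Hy Hd. assert (H0 := Rmax_l 0 t).
  assert (C1 : forall s, continuous (fun s => G (x s) i) s) by (intros; now apply equicont_G).
  assert (C2 : forall s, continuous (fun s => G (y s) i) s) by (intros; now apply equicont_G).
  assert (E : integral (fun s => minus (G (x s) i) (G (y s) i)) 0 (Rmax 0 t) =
     minus (integral (fun s => G (x s) i) 0 (Rmax 0 t)) (integral (fun s => G (y s) i) 0 (Rmax 0 t))).
  { apply (RInt_minus (V := R_CompleteNormedModule)); apply (ex_RInt_continuous (V := R_CompleteNormedModule)); auto. }
  change (Rabs (minus (integral (fun s => G (x s) i) 0 (Rmax 0 t)) (integral (fun s => G (y s) i) 0 (Rmax 0 t)))
    <= b / 2 * ee (Rmax 0 t)).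
  rewrite <- E. eapply Rle_trans; [apply (RInt_exp_bound _ 0 (L * b)); auto; try lra|].
  - apply Rmult_le_pos; lra.
  - intros s. apply (continuous_minus (V := R_NormedModule)); auto.
  - intros s Hs. rewrite Rplus_0_l, Rmult_assoc. apply (Glip (x s) (y s)).
    + apply Rmult_le_pos; [lra|left; apply exp_pos].
    + intros j. apply Hd. lra.
  - replace (L * b / (2 * L)) with (b / 2) by (field; lra). generalize (ee_ge (Rmax 0 t) H0). nra.
Qed.

Lemma pic_step n t i : Rabs (pic (S n) t i - pic n t i) <= 2 * A * (/ 2) ^ n * ee (Rmax 0 t).
Proof.
  revert t i. induction n as [|n IH]; intros t i.
  - rewrite pow_O, Rmult_1_r. apply (pic_props 1).
  - change (pic (S (S n)) t i) with (x0 i + integral (fun s => G (pic (S n) s) i) 0 (Rmax 0 t)).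
    change (pic (S n) t i) with (x0 i + integral (fun s => G (pic n s) i) 0 (Rmax 0 t)).
    assert (Hp := half_pos n).
    match goal with |- Rabs (?p + ?q - (?p + ?r)) <= _ => replace (p + q - (p + r)) with (q - r) by ring end.
    eapply Rle_trans; [apply (integral_diff_bound (pic (S n)) (pic n) (2 * A * (/ 2) ^ n)); try apply pic_props|].
    + repeat apply Rmult_le_pos; lra.
    + intros s j Hs. eapply Rle_trans; [apply IH|]. rewrite Rmax_right; lra.
    + simpl pow. apply Req_le. field.
Qed.

Lemma pic_cauchy n p t i : Rabs (pic (n + p) t i - pic n t i) <= 4 * A * (/ 2) ^ n * (1 - (/ 2) ^ p) * ee (Rmax 0 t).
Proof.
  induction p as [|p IH].
  - rewrite Nat.add_0_r, Rminus_diag, Rabs_R0. simpl. lra.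
  - rewrite Nat.add_succ_r.
    replace (pic (S (n + p)) t i - pic n t i) with
      ((pic (S (n + p)) t i - pic (n + p) t i) + (pic (n + p) t i - pic n t i)) by ring.
    eapply Rle_trans; [apply Rabs_triang|].
    eapply Rle_trans; [apply Rplus_le_compat; [apply pic_step|apply IH]|].
    rewrite pow_add. simpl pow. apply Req_le. field.
Qed.

Lemma pic_cauchy' n p t i : Rabs (pic (n + p) t i - pic n t i) <= 4 * A * (/ 2) ^ n * ee (Rmax 0 t).
Proof.
  eapply Rle_trans; [apply pic_cauchy|].
  assert (H1 := half_pos n). assert (H2 := half_pos p). assert (H3 : 0 < ee (Rmax 0 t)) by apply exp_pos.
  assert (0 <= A * (/ 2) ^ n * ee (Rmax 0 t)) by (repeat apply Rmult_le_pos; lra). nra.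
Qed.

Lemma half_lim c : 0 <= c -> forall eps, 0 < eps -> exists n, forall m, (n <= m)%nat -> c * (/ 2) ^ m < eps.
Proof.
  intros Hc eps Heps.
  assert (H : is_lim_seq (fun n => c * (/ 2) ^ n) (c * 0)).
  { apply (is_lim_seq_scal_l _ c 0). apply is_lim_seq_geom. rewrite Rabs_pos_eq; lra. }
  apply is_lim_seq_spec in H. destruct (H (mkposreal eps Heps)) as [n Hn].
  exists n. intros m Hm. specialize (Hn m Hm). simpl in Hn. rewrite Rmult_0_r, Rminus_0_r in Hn.
  generalize (Rle_abs (c * (/ 2) ^ m)). lra.
Qed.

Definition pic_lim (t : R) (i : I) : R := real (Lim_seq (fun n => pic n t i)).

Lemma pic_lim_correct t i : is_lim_seq (fun n => pic n t i) (pic_lim t i).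
Proof.
  apply Lim_seq_correct', ex_lim_seq_cauchy_corr. intros eps.
  assert (Hc : 0 <= 4 * A * ee (Rmax 0 t)) by (apply Rmult_le_pos; [lra|left; apply exp_pos]).
  destruct (half_lim _ Hc (eps / 2)) as [N HN]; [generalize (cond_pos eps); lra|].
  exists N. intros n m Hn Hm.
  assert (H : forall n, (N <= n)%nat -> Rabs (pic n t i - pic N t i) < eps / 2).
  { intros k Hk. replace k with (N + (k - N))%nat by lia. eapply Rle_lt_trans; [apply pic_cauchy'|].
    specialize (HN N (Nat.le_refl N)). lra. }
  replace (pic n t i - pic m t i) with ((pic n t i - pic N t i) + - (pic m t i - pic N t i)) by ring.
  eapply Rle_lt_trans; [apply Rabs_triang|]. rewrite Rabs_Ropp.
  generalize (H n Hn) (H m Hm). lra.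
Qed.

Lemma pic_lim_dist n t i : Rabs (pic_lim t i - pic n t i) <= 4 * A * (/ 2) ^ n * ee (Rmax 0 t).
Proof.
  apply (is_lim_seq_le_loc (fun m => Rabs (pic m t i - pic n t i)) (fun _ => 4 * A * (/ 2) ^ n * ee (Rmax 0 t))
    (Rabs (pic_lim t i - pic n t i)) (4 * A * (/ 2) ^ n * ee (Rmax 0 t))).
  - exists n. intros m Hm. replace m with (n + (m - n))%nat by lia. apply pic_cauchy'.
  - apply (is_lim_seq_abs _ (pic_lim t i - pic n t i)).
    apply is_lim_seq_minus'; [apply pic_lim_correct|apply is_lim_seq_const].
  - apply is_lim_seq_const.
Qed.

Lemma pic_lim_equicont : equicont pic_lim.
Proof.
  intros t eps Heps.
  set (e1 := ee (Rmax 0 (t + 1))). assert (He1 : 0 < e1) by apply exp_pos.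
  destruct (half_lim (4 * A * e1)) with (eps := eps / 3) as [n Hn]; [apply Rmult_le_pos; lra|lra|].
  specialize (Hn n (Nat.le_refl n)).
  destruct (proj1 (pic_props n) t (eps / 3)) as (d & Hd & HH); [lra|].
  exists (Rmin 1 d). split; [apply Rmin_glb_lt; lra|]. intros t' Ht i.
  assert (H1 : Rabs (t' - t) < 1) by (eapply Rlt_le_trans; [apply Ht|apply Rmin_l]).
  assert (H2 : Rabs (t' - t) < d) by (eapply Rlt_le_trans; [apply Ht|apply Rmin_r]).
  assert (Hs : forall s, s <= t + 1 -> Rabs (pic_lim s i - pic n s i) <= eps / 3).
  { intros s Hs. eapply Rle_trans; [apply pic_lim_dist|].
    apply Rle_trans with (4 * A * (/ 2) ^ n * e1); [|lra].
    apply Rmult_le_compat_l; [apply Rmult_le_pos; [lra|left; apply half_pos]|].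
    unfold e1, ee. assert (Rmax 0 s <= Rmax 0 (t + 1)) by (apply Rle_max_compat_l; lra).
    destruct (Req_dec (Rmax 0 s) (Rmax 0 (t + 1))) as [->|]; [lra|]. left; apply exp_increasing. nra. }
  replace (pic_lim t' i - pic_lim t i) with
    ((pic_lim t' i - pic n t' i) + (pic n t' i - pic n t i) + - (pic_lim t i - pic n t i)) by ring.
  eapply Rle_trans; [apply Rabs_triang|]. rewrite Rabs_Ropp.
  eapply Rle_trans; [apply Rplus_le_compat_r, Rabs_triang|].
  generalize (Hs t' ltac:(generalize (Rle_abs (t' - t)); lra)) (Hs t ltac:(lra)) (HH t' H2 i). lra.
Qed.

(** Both sides are within a multiple of 2^(-n) of the iterate of order S n. *)
Lemma pic_lim_int t i : pic_lim t i = x0 i + integral (fun s => G (pic_lim s) i) 0 (Rmax 0 t).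
Proof.
  set (J := x0 i + integral (fun s => G (pic_lim s) i) 0 (Rmax 0 t)).
  assert (H0 := Rmax_l 0 t). assert (He : 0 < ee (Rmax 0 t)) by apply exp_pos.
  assert (Hb : forall n, Rabs (pic (S n) t i - J) <= 2 * A * ee (Rmax 0 t) * (/ 2) ^ n).
  { intros n. unfold J. simpl pic. assert (Hp := half_pos n).
    match goal with |- Rabs (?p + ?q - (?p + ?r)) <= _ => replace (p + q - (p + r)) with (q - r) by ring end.
    eapply Rle_trans; [apply (integral_diff_bound (pic n) pic_lim (4 * A * (/ 2) ^ n)); try apply pic_props|].
    + repeat apply Rmult_le_pos; lra.
    + apply pic_lim_equicont.
    + intros s j Hs. rewrite Rabs_minus_sym. eapply Rle_trans; [apply pic_lim_dist|]. rewrite Rmax_right; lra.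
    + apply Req_le. field. }
  apply Rminus_diag_uniq.
  destruct (Req_dec (pic_lim t i - J) 0) as [|Hne]; auto. exfalso.
  apply Rabs_pos_lt in Hne.
  destruct (half_lim (10 * A * ee (Rmax 0 t))) with (eps := Rabs (pic_lim t i - J)) as [n Hn]; auto.
  { apply Rmult_le_pos; lra. }
  specialize (Hn n (Nat.le_refl n)). specialize (Hb n). assert (Hd := pic_lim_dist (S n) t i).
  simpl pow in Hd.
  replace (pic_lim t i - J) with ((pic_lim t i - pic (S n) t i) + (pic (S n) t i - J)) in Hn by ring.
  generalize (Rabs_triang (pic_lim t i - pic (S n) t i) (pic (S n) t i - J)).
  assert (0 <= A * ee (Rmax 0 t) * (/ 2) ^ n) by (repeat apply Rmult_le_pos; try lra; left; apply half_pos).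
  lra.
Qed.

Theorem picard : exists x : R -> I -> R, (forall i, x 0 i = x0 i) /\
  (forall t i, continuous (fun t => x t i) t) /\
  (forall t i, 0 < t -> is_derive (fun t => x t i) t (G (x t) i)).
Proof.
  exists pic_lim. split; [|split].
  - intros i. rewrite pic_lim_int, Rmax_left by lra. unfold integral. rewrite RInt_point. apply Rplus_0_r.
  - intros t i. apply cont_eps. intros eps Heps.
    destruct (pic_lim_equicont t (eps / 2)) as (d & Hd & HH); [lra|].
    exists d. split; auto. intros t' Ht. generalize (HH t' Ht i). lra.
  - intros t i Ht.
    apply is_derive_ext_loc with (fun t => x0 i + integral (fun s => G (pic_lim s) i) 0 t).
    (* Within distance t of t > 0 time stays nonnegative and [Rmax 0] disappears. *)
    + exists (mkposreal t Ht). intros t' Ht'. rewrite pic_lim_int.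
      rewrite Rmax_right; auto. unfold ball in Ht'; simpl in Ht'. unfold AbsRing_ball, abs, minus, plus, opp in Ht'; simpl in Ht'.
      revert Ht'. unfold Rabs. destruct Rcase_abs; lra.
    + replace (G (pic_lim t) i) with (0 + G (pic_lim t) i) by ring.
      apply (is_derive_plus (V := R_NormedModule) (fun _ => x0 i)); [apply (is_derive_const (V := R_NormedModule))|].
      assert (C : forall s, continuous (fun s => G (pic_lim s) i) s) by (intros; apply equicont_G, pic_lim_equicont).
      apply (is_derive_RInt (fun s => G (pic_lim s) i) _ 0 t); [|apply C].
      exists (mkposreal 1 Rlt_0_1). intros y _.
      apply (RInt_correct (fun s => G (pic_lim s) i)). apply (ex_RInt_continuous (fun s => G (pic_lim s) i)). auto.
Qed.

End Picard.

(** * Comparison of trajectories in H^(1/2) x H^(-1/2) *)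

Definition cder (f : R -> C) (t : R) (d : C) : Prop :=
  is_derive (fun t => Re (f t)) t (Re d) /\ is_derive (fun t => Im (f t)) t (Im d).
Definition ccont (f : R -> C) (t : R) : Prop :=
  continuous (fun t => Re (f t)) t /\ continuous (fun t => Im (f t)) t.

Definition en (w : Z -> R) (l : list Z) (a : fseq) : R := lsum l (fun k => (w k * Cmod (a k)) ^ 2).

Lemma Cmod_sq z : Cmod z ^ 2 = Re z ^ 2 + Im z ^ 2.
Proof.
  unfold Cmod, Re, Im. rewrite pow2_sqrt; auto.
  generalize (pow2_ge_0 (fst z)) (pow2_ge_0 (snd z)); lra.
Qed.

Lemma en_term (w : R) z : w ^ 2 * (Re z * Re z + Im z * Im z) = (w * Cmod z) ^ 2.
Proof. rewrite Rpow_mult_distr, Cmod_sq. ring. Qed.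

Lemma en_pos w l a : 0 <= en w l a.
Proof. apply lsum_pos. intros. apply pow2_ge_0. Qed.

Lemma en_derive w l (z : R -> fseq) (d : fseq) t :
  (forall k, In k l -> cder (fun t => z t k) t (d k)) ->
  is_derive (fun t => en w l (z t)) t (2 * pairing w l (z t) d).
Proof.
  intros H. unfold en, pairing. rewrite <- lsum_scal. apply lsum_derive.
  intros k Hk. destruct (H k Hk) as [H1 H2].
  apply is_derive_ext with (fun t => w k ^ 2 * (Re (z t k) * Re (z t k) + Im (z t k) * Im (z t k))).
  { intros x. apply en_term. }
  replace (2 * (w k ^ 2 * Re (Cmult (Cconj (z t k)) (d k)))) with
    (w k ^ 2 * ((Re (d k) * Re (z t k) + Re (z t k) * Re (d k)) + (Im (d k) * Im (z t k) + Im (z t k) * Im (d k)))).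
  2:{ destruct (z t k), (d k). unfold Cmult, Cconj, Re, Im; simpl. ring. }
  apply (is_derive_scal (fun t => Re (z t k) * Re (z t k) + Im (z t k) * Im (z t k))).
  apply (is_derive_plus (V := R_NormedModule) (fun t => Re (z t k) * Re (z t k)) (fun t => Im (z t k) * Im (z t k)));
    [apply (is_derive_mult (fun t => Re (z t k)) (fun t => Re (z t k)))
    |apply (is_derive_mult (fun t => Im (z t k)) (fun t => Im (z t k)))]; auto; intros; apply Rmult_comm.
Qed.

Lemma en_cont w l (z : R -> fseq) t :
  (forall k, In k l -> ccont (fun t => z t k) t) -> continuous (fun t => en w l (z t)) t.
Proof.
  intros H. unfold en. apply (lsum_continuous l (fun k t => (w k * Cmod (z t k)) ^ 2)).
  intros k Hk. destruct (H k Hk) as [H1 H2].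
  apply continuous_ext with (fun t => w k ^ 2 * (Re (z t k) * Re (z t k) + Im (z t k) * Im (z t k))).
  { intros x. apply en_term. }
  apply (continuous_mult (fun _ => w k ^ 2)); [apply continuous_const|].
  apply (continuous_plus (fun t => Re (z t k) * Re (z t k)) (fun t => Im (z t k) * Im (z t k)));
    [apply (continuous_mult (fun t => Re (z t k)) (fun t => Re (z t k)))
    |apply (continuous_mult (fun t => Im (z t k)) (fun t => Im (z t k)))]; auto.
Qed.

Definition supp (l : list Z) (a : fseq) : Prop := forall k, ~ In k l -> a k = RtoC 0.

Lemma nle_of_en w l a B : NoDup l -> supp l a -> 0 <= B -> en w l a <= B ^ 2 -> nle w a B.
Proof.
  intros Hl Hs HB H. split; auto. intros l' Hl'. eapply Rle_trans; [|exact H]. unfold en.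
  assert (Hz : forall k, ~ In k l -> (w k * Cmod (a k)) ^ 2 = 0).
  { intros k Hk. rewrite (Hs k Hk), Cmod_0. ring. }
  rewrite <- (lsum_supp l (nodup Z.eq_dec (l ++ l')) _ Hl (NoDup_nodup _ _) Hz).
  - apply lsum_incl; auto; [|intros; apply pow2_ge_0].
    intros x Hx. apply nodup_In, in_or_app; auto.
  - intros x Hx. apply nodup_In, in_or_app; auto.
Qed.

Lemma en_of_nle w l a B : NoDup l -> nle w a B -> en w l a <= B ^ 2.
Proof. intros Hl [_ H]. now apply H. Qed.

Definition pn (n : nat) (a : fseq) : fseq := fun k => if Z.leb (Z.abs k) (Z.of_nat n) then a k else RtoC 0.

Lemma pn_in n a k : In k (range n) -> pn n a k = a k.
Proof. rewrite in_range. intros H. unfold pn. destruct (Z.leb_spec (Z.abs k) (Z.of_nat n)); auto; lia. Qed.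

Lemma pn_supp n a : supp (range n) (pn n a).
Proof. intros k. rewrite in_range. intros H. unfold pn. destruct (Z.leb_spec (Z.abs k) (Z.of_nat n)); auto; lia. Qed.

Lemma pn_id n a k : supp (range n) a -> pn n a k = a k.
Proof.
  intros H. destruct (in_dec Z.eq_dec k (range n)) as [Hi|Hi]; [now apply pn_in|].
  now rewrite (pn_supp n a k Hi), (H k Hi).
Qed.

Lemma herm_pn n a : herm a -> herm (pn n a).
Proof.
  intros H k. unfold pn. rewrite Z.abs_opp. destruct (Z.leb _ _); auto.
  unfold Cconj, RtoC; simpl. f_equal; ring.
Qed.

Lemma nle_pn w n a B : (forall k, 0 < w k) -> nle w a B -> nle w (pn n a) B.
Proof.
  intros Hw H. replace B with (1 * B) by ring. revert H. apply nle_le; auto; [lra|].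
  intros k. rewrite Rmult_1_l. apply Rmult_le_compat_l; [now left|].
  unfold pn. destruct (Z.leb _ _); [lra|]. rewrite Cmod_0. apply Cmod_ge_0.
Qed.

(** Beyond n the factor <k>^(q'-q) is at most (n+1)^(q'-q), which gives the rate of the truncation
    error. *)
Lemma nle_tail q q' n a B : q' <= q -> nle (jp q) a B ->
  nle (jp q') (fsub a (pn n a)) (Rpower (INR (S n)) (q' - q) * B).
Proof.
  intros Hq. apply nle_le; [left; apply exp_pos|intros; apply jp_pos|].
  intros k. unfold fsub, pn. destruct (Z.leb_spec (Z.abs k) (Z.of_nat n)).
  - replace (Cminus (a k) (a k)) with (RtoC 0) by ring. rewrite Cmod_0, Rmult_0_r.
    apply Rmult_le_pos; [left; apply exp_pos|]. apply Rmult_le_pos; [left; apply jp_pos|apply Cmod_ge_0].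
  - replace (Cminus (a k) (RtoC 0)) with (a k) by ring. rewrite <- Rmult_assoc.
    apply Rmult_le_compat_r; [apply Cmod_ge_0|].
    replace (jp q' k) with (jp (q' - q) k * jp q k) by (rewrite <- jp_plus; f_equal; ring).
    apply Rmult_le_compat_r; [left; apply jp_pos|].
    assert (HS : 0 < INR (S n)) by (apply lt_0_INR; lia).
    assert (Hj : INR (S n) <= jb k).
    { eapply Rle_trans; [|apply jb_ge_abs]. rewrite INR_IZR_INZ, <- abs_IZR. apply IZR_le. lia. }
    unfold jp. replace (q' - q) with (- (q - q')) by ring. rewrite !Rpower_Ropp.
    apply Rinv_le_contravar; [apply exp_pos|]. apply Rle_Rpower_l; [lra|split; lra].
Qed.

(** Common interface for Galerkin solutions and exact ones: the equation is imposed only on modes up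
    to n, whatever the higher modes do. *)
Record approx_traj (s g g' mu R0 T : R) (n : nat) (u rho : R -> fseq) : Prop := {
  tr_herm_u : forall t, 0 <= t <= T -> herm (u t);
  tr_herm_rho : forall t, 0 <= t <= T -> herm (rho t);
  tr_bd_u : forall t, 0 <= t <= T -> nle (jp s) (u t) R0;
  tr_bd_rho : forall t, 0 <= t <= T -> nle (jp (s - 1)) (rho t) R0;
  tr_cont_u : forall t k, ccont (fun t => u t k) t;
  tr_cont_rho : forall t k, ccont (fun t => rho t k) t;
  tr_der_u : forall t k, 0 < t < T -> In k (range n) ->
    cder (fun t => u t k) t (Fu g mu (u t) (rho t) k);
  tr_der_rho : forall t k, 0 < t < T -> In k (range n) ->
    cder (fun t => rho t k) t (Fr g' (u t) (rho t) k) }.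

Lemma cder_minus f f' d d' t : cder f t d -> cder f' t d' -> cder (fun t => Cminus (f t) (f' t)) t (Cminus d d').
Proof.
  intros [H1 H2] [H3 H4]. split.
  - apply (is_derive_minus (V := R_NormedModule) (fun t => Re (f t)) (fun t => Re (f' t))); auto.
  - apply (is_derive_minus (V := R_NormedModule) (fun t => Im (f t)) (fun t => Im (f' t))); auto.
Qed.
Lemma ccont_minus f f' t : ccont f t -> ccont f' t -> ccont (fun t => Cminus (f t) (f' t)) t.
Proof.
  intros [H1 H2] [H3 H4]. split.
  - apply (continuous_minus (V := R_NormedModule) (fun t => Re (f t)) (fun t => Re (f' t))); auto.
  - apply (continuous_minus (V := R_NormedModule) (fun t => Im (f t)) (fun t => Im (f' t))); auto.
Qed.

Lemma pairing_ext_l w l a a' b : (forall k, In k l -> a k = a' k) -> pairing w l a b = pairing w l a' b.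
Proof. intros H. apply lsum_ext. intros k Hk. now rewrite (H k Hk). Qed.

(* H^(1/2) x H^(-1/2) is low enough to absorb the derivative lost on the transported difference, and high enough for the products, for every s > 3/2. *)
Definition low_en (n : nat) (u rho v sg : fseq) : R :=
  en (jp (1/2)) (range n) (fsub u v) + en (jp (-(1/2))) (range n) (fsub rho sg).

Lemma nle_refl_diff w a : (forall k, 0 < w k) -> nle w (fsub a a) 0.
Proof.
  intros Hw. apply nle_ext with (fun _ => RtoC 0); [|now apply nle_zero].
  intros k. unfold fsub. ring.
Qed.

Section Comparison.
Variables (s s' c g g' mu mu' R0 T : R) (n : nat).
Hypothesis Hs' : 3 / 2 < s'.
Hypothesis Hss : s' <= s.
Hypothesis E : estimates s' c.
Hypothesis HR : 1 <= R0.
Hypothesis Hg : Rabs g <= R0.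
Hypothesis Hg' : Rabs g' <= R0.
Hypothesis Hmu : Rabs mu <= R0.
Hypothesis Hmu' : Rabs mu' <= R0.

(** Size, at level s', of the modes beyond n of a function bounded by R0 at level s. *)
Definition tail_err : R := Rpower (INR (S n)) (s' - s) * R0.

Lemma tail_err_pos : 0 <= tail_err.
Proof. apply Rmult_le_pos; [left; apply exp_pos|lra]. Qed.

(** The Lipschitz bound at level s' lands in H^(s'-1) x H^(s'-2), which lies in H^(1/2) x H^(-1/2)
    because s' > 3/2. *)
Lemma F_tail m u rho : Rabs m <= R0 -> nle (jp s) u R0 -> nle (jp (s - 1)) rho R0 ->
  nle (jp (1/2)) (fsub (Fu g m u rho) (Fu g m (pn n u) (pn n rho))) (12 * c * R0 * tail_err) /\
  nle (jp (-(1/2))) (fsub (Fr g' u rho) (Fr g' (pn n u) (pn n rho))) (12 * c * R0 * tail_err).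
Proof.
  intros Hm Hu Hrho.
  assert (Hu' := nle_jp_le s' s _ _ Hss Hu).
  assert (Hr' := nle_jp_le (s' - 1) (s - 1) _ _ ltac:(lra) Hrho).
  assert (Pu := nle_pn _ n _ _ (jp_pos s') Hu'). assert (Pr := nle_pn _ n _ _ (jp_pos (s' - 1)) Hr').
  assert (T1 := nle_tail s s' n u R0 Hss Hu).
  assert (T2 := nle_tail (s - 1) (s' - 1) n rho R0 ltac:(lra) Hrho).
  replace (s' - 1 - (s - 1)) with (s' - s) in T2 by ring. fold tail_err in T1, T2.
  split.
  - apply nle_jp_le with (s' - 1); [lra|].
    replace tail_err with (tail_err + 0) by ring.
    apply Lip_Fu; auto. rewrite Rminus_diag, Rabs_R0. lra.
  - apply nle_jp_le with (s' - 2); [lra|]. now apply Lip_Fr.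
Qed.

Variables (u rho v sg : R -> fseq).
Hypothesis Hz : approx_traj s g g' mu R0 T n u rho.
Hypothesis Hz' : approx_traj s g g' mu' R0 T n v sg.

Let D t := low_en n (u t) (rho t) (v t) (sg t).
Let D' t := 2 * pairing (jp (1/2)) (range n) (fsub (u t) (v t)) (fsub (Fu g mu (u t) (rho t)) (Fu g mu' (v t) (sg t))) +
  2 * pairing (jp (-(1/2))) (range n) (fsub (rho t) (sg t)) (fsub (Fr g' (u t) (rho t)) (Fr g' (v t) (sg t))).

Lemma low_en_cont t : continuous D t.
Proof.
  assert (C1 : continuous (fun t => en (jp (1/2)) (range n) (fsub (u t) (v t))) t).
  { apply (en_cont _ _ (fun t => fsub (u t) (v t))). intros k _. unfold fsub. apply ccont_minus.
    - exact (tr_cont_u _ _ _ _ _ _ _ _ _ Hz t k).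
    - exact (tr_cont_u _ _ _ _ _ _ _ _ _ Hz' t k). }
  assert (C2 : continuous (fun t => en (jp (-(1/2))) (range n) (fsub (rho t) (sg t))) t).
  { apply (en_cont _ _ (fun t => fsub (rho t) (sg t))). intros k _. unfold fsub. apply ccont_minus.
    - exact (tr_cont_rho _ _ _ _ _ _ _ _ _ Hz t k).
    - exact (tr_cont_rho _ _ _ _ _ _ _ _ _ Hz' t k). }
  exact (continuous_plus (V := R_NormedModule) _ _ t C1 C2).
Qed.

Lemma low_en_derive t : 0 < t < T -> is_derive D t (D' t).
Proof.
  intros Ht.
  assert (C1 := en_derive (jp (1/2)) (range n) (fun t => fsub (u t) (v t))
    (fsub (Fu g mu (u t) (rho t)) (Fu g mu' (v t) (sg t))) t
    (fun k Hk => cder_minus _ _ _ _ t (tr_der_u _ _ _ _ _ _ _ _ _ Hz t k Ht Hk) (tr_der_u _ _ _ _ _ _ _ _ _ Hz' t k Ht Hk))).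
  assert (C2 := en_derive (jp (-(1/2))) (range n) (fun t => fsub (rho t) (sg t))
    (fsub (Fr g' (u t) (rho t)) (Fr g' (v t) (sg t))) t
    (fun k Hk => cder_minus _ _ _ _ t (tr_der_rho _ _ _ _ _ _ _ _ _ Hz t k Ht Hk) (tr_der_rho _ _ _ _ _ _ _ _ _ Hz' t k Ht Hk))).
  exact (is_derive_plus (V := R_NormedModule) _ _ t _ _ C1 C2).
Qed.

Lemma fsub_pn (a b : fseq) k : In k (range n) -> fsub a b k = fsub (pn n a) (pn n b) k.
Proof. intros H. unfold fsub. now rewrite !pn_in. Qed.

Lemma fsub_supp (a b : fseq) : supp (range n) (fsub (pn n a) (pn n b)).
Proof. intros k Hk. unfold fsub. rewrite !pn_supp by auto. ring. Qed.

(** The transport cancellation needs a difference supported in [range n], so the nonlinearity is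
    first evaluated at the projections; [F_tail] bounds the two errors. *)
Lemma low_en_diff_ineq t : 0 < t < T -> D' t <= 96 * c * R0 * (D t + (Rabs (mu - mu') + tail_err) ^ 2).
Proof.
  intros Ht. assert (Ht' : 0 <= t <= T) by lra.
  assert (Hc := est_c s' c E).
  set (e := Rabs (mu - mu')). assert (He : 0 <= e) by apply Rabs_pos.
  assert (Hd := tail_err_pos). set (d := tail_err) in *.
  assert (BU := tr_bd_u _ _ _ _ _ _ _ _ _ Hz t Ht'). assert (BR := tr_bd_rho _ _ _ _ _ _ _ _ _ Hz t Ht').
  assert (BV := tr_bd_u _ _ _ _ _ _ _ _ _ Hz' t Ht'). assert (BS := tr_bd_rho _ _ _ _ _ _ _ _ _ Hz' t Ht').
  assert (HU := tr_herm_u _ _ _ _ _ _ _ _ _ Hz t Ht').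
  assert (Pu := nle_pn _ n _ _ (jp_pos s') (nle_jp_le s' s _ _ Hss BU)).
  assert (Pv := nle_pn _ n _ _ (jp_pos s') (nle_jp_le s' s _ _ Hss BV)).
  assert (Pr := nle_pn _ n _ _ (jp_pos (s' - 1)) (nle_jp_le (s' - 1) (s - 1) _ _ ltac:(lra) BR)).
  assert (Ps := nle_pn _ n _ _ (jp_pos (s' - 1)) (nle_jp_le (s' - 1) (s - 1) _ _ ltac:(lra) BS)).
  destruct (F_tail mu (u t) (rho t) Hmu BU BR) as [F1 F2].
  destruct (F_tail mu' (v t) (sg t) Hmu' BV BS) as [F3 F4].
  apply nle_sub_sym in F3, F4. fold d in F1, F2, F3, F4.
  set (p := pn n (u t)) in *. set (q := pn n (v t)) in *.
  set (r1 := pn n (rho t)) in *. set (r2 := pn n (sg t)) in *.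
  assert (D0 : 0 <= D t) by (apply Rplus_le_le_0_compat; apply en_pos).
  set (X := sqrt (D t)). assert (HX : 0 <= X) by apply sqrt_pos.
  assert (HX2 : X ^ 2 = D t) by now apply pow2_sqrt.
  assert (NW : nle (jp (1/2)) (fsub p q) X).
  { apply nle_of_en with (range n); [apply range_NoDup|apply fsub_supp|exact HX|].
    rewrite HX2. unfold D, low_en. generalize (en_pos (jp (-(1/2))) (range n) (fsub (rho t) (sg t))).
    unfold en at 2. rewrite (lsum_ext (range n) _ (fun k => (jp (1/2) k * Cmod (fsub (u t) (v t) k)) ^ 2)).
    - fold (en (jp (1/2)) (range n) (fsub (u t) (v t))). lra.
    - intros k Hk. unfold p, q. now rewrite <- fsub_pn. }
  assert (NE : nle (jp (-(1/2))) (fsub r1 r2) X).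
  { apply nle_of_en with (range n); [apply range_NoDup|apply fsub_supp|exact HX|].
    rewrite HX2. unfold D, low_en. generalize (en_pos (jp (1/2)) (range n) (fsub (u t) (v t))).
    unfold en at 2. rewrite (lsum_ext (range n) _ (fun k => (jp (-(1/2)) k * Cmod (fsub (rho t) (sg t) k)) ^ 2)).
    - fold (en (jp (-(1/2))) (range n) (fsub (rho t) (sg t))). lra.
    - intros k Hk. unfold r1, r2. now rewrite <- fsub_pn. }
  unfold D'.
  rewrite (pairing_ext_l (jp (1/2)) (range n) (fsub (u t) (v t)) (fsub p q)) by (intros; now apply fsub_pn).
  rewrite (pairing_ext_l (jp (-(1/2))) (range n) (fsub (rho t) (sg t)) (fsub r1 r2)) by (intros; now apply fsub_pn).
  rewrite (pairing_ext _ _ _ (fsub (Fu g mu (u t) (rho t)) (Fu g mu' (v t) (sg t)))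
    (fadd (fsub (Fu g mu p r1) (Fu g mu' q r2)) (fadd (fsub (Fu g mu (u t) (rho t)) (Fu g mu p r1))
      (fsub (Fu g mu' q r2) (Fu g mu' (v t) (sg t)))))) by (intros; unfold fadd, fsub; ring).
  rewrite (pairing_ext _ _ _ (fsub (Fr g' (u t) (rho t)) (Fr g' (v t) (sg t)))
    (fadd (fsub (Fr g' p r1) (Fr g' q r2)) (fadd (fsub (Fr g' (u t) (rho t)) (Fr g' p r1))
      (fsub (Fr g' q r2) (Fr g' (v t) (sg t)))))) by (intros; unfold fadd, fsub; ring).
  rewrite !pairing_plus.
  assert (A1 := low_Fu s' c Hs' E g mu mu' R0 p r1 q r2 HR Hg Pu Pv Pr Ps (range n) X e
    (herm_pn n _ HU) NW NE Hmu (Rle_refl _) (range_NoDup n) (fsub_supp _ _)).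
  assert (A2 := low_Fr s' c E g' R0 p r1 q r2 HR Hg' Pu Pv Pr Ps (range n) X
    (herm_pn n _ HU) NW NE (range_NoDup n) (fsub_supp _ _)).
  assert (A3 := pairing_le _ _ _ _ _ _ (jp_pos (1/2)) NW F1 (range_NoDup n)).
  assert (A4 := pairing_le _ _ _ _ _ _ (jp_pos (1/2)) NW F3 (range_NoDup n)).
  assert (A5 := pairing_le _ _ _ _ _ _ (jp_pos (-(1/2))) NE F2 (range_NoDup n)).
  assert (A6 := pairing_le _ _ _ _ _ _ (jp_pos (-(1/2))) NE F4 (range_NoDup n)).
  generalize (proj1 (Rabs_le_between _ _) A1) (proj1 (Rabs_le_between _ _) A2) (proj1 (Rabs_le_between _ _) A3)
    (proj1 (Rabs_le_between _ _) A4) (proj1 (Rabs_le_between _ _) A5) (proj1 (Rabs_le_between _ _) A6).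
  clear A1 A2 A3 A4 A5 A6. intros A1 A2 A3 A4 A5 A6.
  rewrite <- HX2.
  assert (HcR : 0 <= c * R0) by (apply Rmult_le_pos; lra).
  (* The terms linear in X total at most 4 (e + d) X inside a factor 24 c R0; absorbing them leaves
     96 = 24 * 4. *)
  assert (Q : c * R0 * (2 * (e + d) * X) <= c * R0 * (X ^ 2 + (e + d) ^ 2)).
  { apply Rmult_le_compat_l; auto. generalize (pow2_ge_0 (X - (e + d))). nra. }
  assert (0 <= c * R0 * (e * X)) by (apply Rmult_le_pos; auto; nra).
  assert (0 <= c * R0 * (e + d) ^ 2) by (apply Rmult_le_pos; auto; apply pow2_ge_0).
  replace (Rabs (mu - mu')) with e by reflexivity.
  set (Y := (e + d) ^ 2) in *. clearbody Y.
  replace (c * R0 * (2 * (e + d) * X)) with (2 * (c * R0 * (e * X)) + 2 * (c * R0 * (d * X))) in Q by ring.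
  lra.
Qed.

Lemma comparison t : 0 <= t <= T ->
  low_en n (u t) (rho t) (v t) (sg t) <=
  exp (96 * c * R0 * t) * (low_en n (u 0) (rho 0) (v 0) (sg 0) + (Rabs (mu - mu') + tail_err) ^ 2).
Proof.
  intros Ht. apply (gronwall D D' (96 * c * R0) _ T); auto.
  - apply pow2_ge_0.
  - apply low_en_cont.
  - apply low_en_derive.
  - apply low_en_diff_ineq.
Qed.

End Comparison.

(** * Galerkin approximation *)

Definition clip (B x : R) : R := Rmax (- B) (Rmin B x).

Lemma clip_lip B x y : Rabs (clip B x - clip B y) <= Rabs (x - y).
Proof.
  unfold clip, Rmax, Rmin. repeat destruct Rle_dec; unfold Rabs; repeat destruct Rcase_abs; lra.
Qed.
Lemma clip_id B x : Rabs x <= B -> clip B x = x.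
Proof.
  intros H. apply Rabs_le_between in H. unfold clip. rewrite Rmin_right, Rmax_right; lra.
Qed.
Lemma clip_bd B x : 0 <= B -> Rabs (clip B x) <= B.
Proof.
  intros H. apply Rabs_le_between. unfold clip, Rmax, Rmin. repeat destruct Rle_dec; lra.
Qed.
Lemma clip_opp B x : 0 <= B -> clip B (- x) = - clip B x.
Proof. intros HB. unfold clip, Rmax, Rmin. repeat destruct Rle_dec; lra. Qed.

Definition cclip (B : R) (z : C) : C := (clip B (Re z), clip B (Im z)).

Lemma Cmod_le_parts z e : Rabs (Re z) <= e -> Rabs (Im z) <= e -> Cmod z <= 2 * e.
Proof.
  intros H1 H2. assert (0 <= e) by (eapply Rle_trans; [apply Rabs_pos|exact H1]).
  apply le_of_sq; [lra|]. rewrite Cmod_sq, <- (pow2_abs (Re z)), <- (pow2_abs (Im z)).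
  generalize (Rabs_pos (Re z)) (Rabs_pos (Im z)). nra.
Qed.

Definition hsym (a : fseq) : fseq := fun k => Cmult (RtoC (1/2)) (Cplus (a k) (Cconj (a (- k)%Z))).

Lemma herm_hsym a : herm (hsym a).
Proof.
  intros k. unfold hsym. rewrite Z.opp_involutive.
  destruct (a k), (a (- k)%Z). unfold Cmult, Cplus, Cconj, RtoC; simpl. f_equal; ring.
Qed.

Lemma hsym_id a k : herm a -> hsym a k = a k.
Proof.
  intros H. unfold hsym. rewrite (H k). destruct (a k). unfold Cmult, Cplus, Cconj, RtoC; simpl. f_equal; field.
Qed.

Lemma hsym_Re a k : Re (hsym a k) = 1/2 * (Re (a k) + Re (a (- k)%Z)).
Proof. unfold hsym, Cmult, Cplus, Cconj, RtoC, Re; simpl. ring. Qed.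
Lemma hsym_Im a k : Im (hsym a k) = 1/2 * (Im (a k) - Im (a (- k)%Z)).
Proof. unfold hsym, Cmult, Cplus, Cconj, RtoC, Im; simpl. ring. Qed.

Lemma ccont_hsym (y : R -> fseq) k t : ccont (fun t => y t k) t -> ccont (fun t => y t (- k)%Z) t ->
  ccont (fun t => hsym (y t) k) t.
Proof.
  intros [H1 H2] [H3 H4]. split.
  - apply continuous_ext with (fun t => 1/2 * (Re (y t k) + Re (y t (- k)%Z))); [intros; now rewrite hsym_Re|].
    apply (continuous_mult (fun _ => 1/2)); [apply continuous_const|].
    exact (continuous_plus (V := R_NormedModule) _ _ t H1 H3).
  - apply continuous_ext with (fun t => 1/2 * (Im (y t k) - Im (y t (- k)%Z))); [intros; now rewrite hsym_Im|].
    apply (continuous_mult (fun _ => 1/2)); [apply continuous_const|].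
    exact (continuous_minus (V := R_NormedModule) _ _ t H2 H4).
Qed.

Lemma cder_ext f h t d : (forall t, f t = h t) -> cder f t d -> cder h t d.
Proof.
  intros H [H1 H2].
  split; [apply is_derive_ext with (2 := H1)|apply is_derive_ext with (2 := H2)]; intros; now rewrite H.
Qed.

Lemma cder_hsym (y : R -> fseq) k t d : herm d -> cder (fun t => y t k) t (d k) ->
  cder (fun t => y t (- k)%Z) t (d (- k)%Z) -> cder (fun t => hsym (y t) k) t (d k).
Proof.
  intros Hd [H1 H2] [H3 H4]. assert (Hk := Hd k). split.
  - apply is_derive_ext with (fun t => 1/2 * (Re (y t k) + Re (y t (- k)%Z))); [intros; now rewrite hsym_Re|].
    replace (Re (d k)) with (1/2 * (Re (d k) + Re (d (- k)%Z))) by (rewrite Hk; unfold Cconj, Re; simpl; field).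
    apply (is_derive_scal (fun t => Re (y t k) + Re (y t (- k)%Z))).
    exact (is_derive_plus (V := R_NormedModule) _ _ t _ _ H1 H3).
  - apply is_derive_ext with (fun t => 1/2 * (Im (y t k) - Im (y t (- k)%Z))); [intros; now rewrite hsym_Im|].
    replace (Im (d k)) with (1/2 * (Im (d k) - Im (d (- k)%Z))) by (rewrite Hk; unfold Cconj, Im; simpl; field).
    apply (is_derive_scal (fun t => Im (y t k) - Im (y t (- k)%Z))).
    exact (is_derive_minus (V := R_NormedModule) _ _ t _ _ H2 H4).
Qed.

Definition cproj (B : R) (n : nat) (a : fseq) : fseq := pn n (fun k => cclip B (a k)).

Lemma herm_cproj B n a : 0 <= B -> herm a -> herm (cproj B n a).
Proof.
  intros HB H. apply herm_pn. intros k. rewrite H. unfold cclip, Cconj; simpl.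
  now rewrite clip_opp.
Qed.

(** With weights at least 1 the norm bounds every coefficient, so the clipping level is not
    reached. *)
Lemma cproj_inactive B n w a : (forall k, 1 <= w k) -> nle w a B -> supp (range n) a -> cproj B n a = a.
Proof.
  intros Hw Hn Hs. apply functional_extensionality. intros k. unfold cproj.
  transitivity (pn n a k); [|now apply pn_id]. unfold pn. destruct (Z.leb _ _); auto.
  assert (Cmod (a k) <= B).
  { generalize (nle_coef _ _ _ k Hn ltac:(generalize (Hw k); lra)) (Hw k) (Cmod_ge_0 (a k)). nra. }
  unfold cclip. rewrite !clip_id; [now destruct (a k)| |]; eapply Rle_trans; try exact H;
    [apply Im_le_Cmod|apply Re_le_Cmod].
Qed.

(** Compares the weighted norm with the sup norm on modes up to n. Its dependence on n is harmless,
    since it never enters the energy bounds. *)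
Definition wsum (w : Z -> R) (n : nat) : R := sqrt (lsum (range n) (fun k => w k ^ 2)).

Lemma nle_bounded w n a e : (forall k, 0 < w k) -> 0 <= e -> supp (range n) a -> (forall k, Cmod (a k) <= e) -> nle w a (wsum w n * e).
Proof.
  intros Hw He Hs Ha. assert (H0 : 0 <= lsum (range n) (fun k => w k ^ 2)) by (apply lsum_pos; intros; apply pow2_ge_0).
  apply nle_of_en with (range n); auto using range_NoDup.
  - apply Rmult_le_pos; auto. apply sqrt_pos.
  - rewrite Rpow_mult_distr. unfold wsum. rewrite pow2_sqrt by auto.
    rewrite Rmult_comm, <- lsum_scal. apply lsum_le. intros k _.
    rewrite Rpow_mult_distr, Rmult_comm. apply Rmult_le_compat_r; [apply pow2_ge_0|].
    apply pow_incr. split; [apply Cmod_ge_0|auto].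
Qed.

(** Real coordinates of (u, rho): the first flag is true for u, the second for the real part. *)
Definition idx : Type := (bool * bool * Z)%type.
Definition decode (w : bool) (x : idx -> R) : fseq := fun k => (x (w, true, k), x (w, false, k)).
Definition part (b : bool) (z : C) : R := if b then Re z else Im z.

Lemma part_le b z : Rabs (part b z) <= Cmod z.
Proof. destruct b; [apply Re_le_Cmod|apply Im_le_Cmod]. Qed.

Lemma part_minus b z z' : part b z - part b z' = part b (Cminus z z').
Proof. destruct b; reflexivity. Qed.

Lemma cproj_diff B n w x y d : 0 <= d -> (forall i, Rabs (x i - y i) <= d) -> forall k,
  Cmod (fsub (cproj B n (hsym (decode w x))) (cproj B n (hsym (decode w y))) k) <= 4 * d.
Proof.
  intros Hd H k. unfold fsub, cproj, pn. destruct (Z.leb _ _).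
  2:{ replace (Cminus (RtoC 0) (RtoC 0)) with (RtoC 0) by ring. rewrite Cmod_0. lra. }
  set (a := hsym (decode w x) k). set (b := hsym (decode w y) k).
  assert (Hab : Cmod (Cminus a b) <= 2 * d).
  { unfold a, b, hsym.
    replace (Cminus (Cmult (RtoC (1/2)) (Cplus (decode w x k) (Cconj (decode w x (- k)%Z))))
                    (Cmult (RtoC (1/2)) (Cplus (decode w y k) (Cconj (decode w y (- k)%Z)))))
      with (Cmult (RtoC (1/2)) (Cplus (Cminus (decode w x k) (decode w y k)) (Cconj (Cminus (decode w x (- k)%Z) (decode w y (- k)%Z))))).
    2:{ destruct (decode w x k), (decode w y k), (decode w x (- k)%Z), (decode w y (- k)%Z).
        unfold Cminus, Cmult, Cplus, Copp, Cconj, RtoC; simpl. f_equal; ring. }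
    rewrite Cmod_mult, Cmod_R, Rabs_pos_eq by lra.
    assert (Hk : forall k, Cmod (Cminus (decode w x k) (decode w y k)) <= 2 * d).
    { intros j. apply Cmod_le_parts; simpl; apply H. }
    generalize (Cmod_triangle (Cminus (decode w x k) (decode w y k)) (Cconj (Cminus (decode w x (- k)%Z) (decode w y (- k)%Z)))).
    rewrite Cmod_conj. generalize (Hk k) (Hk (- k)%Z). lra. }
  replace (4 * d) with (2 * (2 * d)) by ring.
  apply Cmod_le_parts; simpl.
  - eapply Rle_trans; [apply clip_lip|]. eapply Rle_trans; [|exact Hab]. apply (Re_le_Cmod (Cminus a b)).
  - eapply Rle_trans; [apply clip_lip|]. eapply Rle_trans; [|exact Hab]. apply (Im_le_Cmod (Cminus a b)).
Qed.

Lemma cproj_bd B n a k : 0 <= B -> Cmod (cproj B n a k) <= 2 * B.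
Proof.
  intros HB. unfold cproj, pn. destruct (Z.leb _ _); [|rewrite Cmod_0; lra].
  apply Cmod_le_parts; simpl; now apply clip_bd.
Qed.

Lemma cproj_supp B n a : supp (range n) (cproj B n a).
Proof. apply pn_supp. Qed.

Lemma fmul_zero_r b k : fmul b (fun _ => RtoC 0) k = RtoC 0.
Proof.
  unfold fmul. rewrite (csumZ_fin []); [reflexivity|constructor|]. intros; ring.
Qed.
Lemma dx_zero : dx (fun _ => RtoC 0) = fun _ => RtoC 0.
Proof. apply functional_extensionality. intros k. unfold dx. ring. Qed.

Lemma Fu_zero g mu k : Fu g mu (fun _ => RtoC 0) (fun _ => RtoC 0) k = RtoC 0.
Proof.
  unfold Fu, PD, fadd at 1 3, fscal. rewrite dx_zero, fmul_zero_r. unfold fadd.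
  rewrite !fmul_zero_r. ring.
Qed.
Lemma Fr_zero g k : Fr g (fun _ => RtoC 0) (fun _ => RtoC 0) k = RtoC 0.
Proof. unfold Fr, fadd at 1. rewrite dx_zero, !fmul_zero_r. ring. Qed.

Section Galerkin.
Variables (s c g g' mu R0 : R) (n : nat).
Hypothesis Hs : 3 / 2 < s.
Hypothesis E : estimates s c.
Hypothesis HR : 1 <= R0.
Hypothesis Hg : Rabs g <= R0.
Hypothesis Hg' : Rabs g' <= R0.
Hypothesis Hmu : Rabs mu <= R0.

(** The clipping level is the bound that the bootstrap in [galerkin] preserves. *)
Let B := 2 * R0.

(* Clipping makes the field globally Lipschitz for the sup norm, and [hsym] keeps the unknown Hermitian. *)
Definition Gfield (x : idx -> R) (i : idx) : R :=
  match i with (w, b, k) =>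
    let U := cproj B n (hsym (decode true x)) in
    let P := cproj B n (hsym (decode false x)) in
    part b (pn n (if w then Fu g mu U P else Fr g' U P) k) end.

Lemma Gfield_lip : exists L, 1 <= L /\ forall x y d, 0 <= d -> (forall i, Rabs (x i - y i) <= d) ->
  forall i, Rabs (Gfield x i - Gfield y i) <= L * d.
Proof.
  assert (Hc := est_c s c E).
  set (K := wsum (jp s) n + wsum (jp (s - 1)) n).
  assert (K1 : 0 <= wsum (jp s) n) by apply sqrt_pos. assert (K2 : 0 <= wsum (jp (s - 1)) n) by apply sqrt_pos.
  set (R1 := R0 + K * (2 * B)).
  assert (HB : 0 < B) by (unfold B; lra).
  assert (HKB : 0 <= K * (2 * B)) by (apply Rmult_le_pos; unfold K; lra).
  assert (HR1 : 1 <= R1) by (unfold R1; lra).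
  set (M := 12 * c * R1 * (K * 4)).
  assert (HM : 0 <= M).
  { unfold M, K. apply Rmult_le_pos; [apply Rmult_le_pos; lra|lra]. }
  (* The rho-equation is estimated in H^(s-2), whose exponent may be negative but exceeds -1; J
     converts that bound into one on coefficients. *)
  set (J := jb (Z.of_nat n)). assert (HJ : 1 <= J) by apply jb_ge1.
  exists (1 + M * J). split; [nra|].
  intros x y d Hd Hxy [[w b] k].
  unfold Gfield. rewrite part_minus. eapply Rle_trans; [apply part_le|].
  set (U := cproj B n (hsym (decode true x))). set (P := cproj B n (hsym (decode false x))).
  set (V := cproj B n (hsym (decode true y))). set (Q := cproj B n (hsym (decode false y))).
  assert (Hgoal : 0 <= (1 + M * J) * d) by (apply Rmult_le_pos; nra).
  unfold pn. destruct (Z.leb_spec (Z.abs k) (Z.of_nat n)) as [Hk|Hk].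
  2:{ replace (Cminus (RtoC 0) (RtoC 0)) with (RtoC 0) by ring. rewrite Cmod_0. auto. }
  assert (Bd : forall q a, 0 <= wsum (jp q) n <= K -> nle (jp q) (cproj B n a) R1).
  { intros q a Hq. eapply nle_weak; [apply (nle_bounded (jp q) n _ (2 * B)); auto using jp_pos, cproj_supp|].
    - lra.
    - intros; apply cproj_bd; lra.
    - unfold R1. assert (wsum (jp q) n * (2 * B) <= K * (2 * B)) by (apply Rmult_le_compat_r; lra). lra. }
  assert (Df : forall q v, 0 <= wsum (jp q) n <= K ->
    nle (jp q) (fsub (cproj B n (hsym (decode v x))) (cproj B n (hsym (decode v y)))) (K * 4 * d)).
  { intros q v Hq. eapply nle_weak; [apply (nle_bounded (jp q) n _ (4 * d)); auto using jp_pos|].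
    - lra.
    - intros j Hj. unfold fsub. rewrite !cproj_supp by auto. ring.
    - intros; now apply cproj_diff.
    - assert (wsum (jp q) n * (4 * d) <= K * (4 * d)) by (apply Rmult_le_compat_r; lra). lra. }
  assert (W1 : 0 <= wsum (jp s) n <= K) by (unfold K; lra).
  assert (W2 : 0 <= wsum (jp (s - 1)) n <= K) by (unfold K; lra).
  assert (HJk : jb k <= J).
  { unfold J. apply jb_mono. rewrite <- !abs_IZR. apply IZR_le. lia. }
  assert (HMd : 0 <= M * d) by (apply Rmult_le_pos; auto).
  destruct w.
  - assert (L := Lip_Fu s c E g mu mu R1 U P V Q HR1 ltac:(unfold R1; lra) (Bd _ _ W1) (Bd _ _ W1) (Bd _ _ W2) (Bd _ _ W2)
      (K * 4 * d) 0 (Df s true W1) (Df (s - 1) false W2) ltac:(unfold R1; lra) ltac:(rewrite Rminus_diag, Rabs_R0; lra)).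
    assert (N := nle_coef _ _ _ k L (jp_pos (s - 1) k)). unfold fsub in N.
    replace (12 * c * R1 * (K * 4 * d + 0)) with (M * d) in N by (unfold M; ring).
    generalize (jp_ge1 (s - 1) k ltac:(lra)) (Cmod_ge_0 (Cminus (Fu g mu U P k) (Fu g mu V Q k))). nra.
  - assert (L := Lip_Fr s c E g' R1 U P V Q HR1 ltac:(unfold R1; lra) (Bd _ _ W1) (Bd _ _ W1) (Bd _ _ W2) (Bd _ _ W2)
      (K * 4 * d) (Df s true W1) (Df (s - 1) false W2)).
    assert (N := nle_coef _ _ _ k L (jp_pos (s - 2) k)). unfold fsub in N.
    replace (12 * c * R1 * (K * 4 * d)) with (M * d) in N by (unfold M; ring).
    assert (Hj1 : jp (-1) k <= jp (s - 2) k) by (apply jp_le_exp; lra).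
    replace (-1) with (- (1)) in Hj1 by ring. rewrite jp_inv, jp_1 in Hj1.
    set (z := Cmod (Cminus (Fr g' U P k) (Fr g' V Q k))) in *.
    assert (Hz : 0 <= z) by apply Cmod_ge_0.
    assert (/ jb k * z <= M * d) by nra.
    assert (z = jb k * (/ jb k * z)) by (field; generalize (jb_pos k); lra).
    generalize (jb_pos k); intros. nra.
Qed.

Variables (u0 rho0 : fseq).
Hypothesis hu0 : herm u0.
Hypothesis hrho0 : herm rho0.
Hypothesis bu0 : nle (jp s) u0 R0.
Hypothesis brho0 : nle (jp (s - 1)) rho0 R0.

(* The energy starts below [2 R0^2] and grows at rate at most [384 c R0^3] while it is below [4 R0^2], so it stays there up to this time. *)
Definition life : R := / (200 * c * R0).

Lemma galerkin_clipped : exists u rho : R -> fseq,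
  (forall t, herm (u t) /\ herm (rho t)) /\
  (forall t, supp (range n) (u t) /\ supp (range n) (rho t)) /\
  (forall t k, ccont (fun t => u t k) t /\ ccont (fun t => rho t k) t) /\
  (u 0 = pn n u0 /\ rho 0 = pn n rho0) /\
  (forall t k, 0 < t -> In k (range n) ->
    cder (fun t => u t k) t (Fu g mu (cproj B n (u t)) (cproj B n (rho t)) k) /\
    cder (fun t => rho t k) t (Fr g' (cproj B n (u t)) (cproj B n (rho t)) k)).
Proof.
  destruct Gfield_lip as (L & HL & Lip).
  set (x0 := fun i : idx => match i with (w, b, k) => part b ((if w then u0 else rho0) k) end).
  assert (Hx0 : forall i, Rabs (x0 i) <= R0).
  { intros [[w b] k]. unfold x0. eapply Rle_trans; [apply part_le|]. destruct w.
    - generalize (nle_coef _ _ _ k bu0 (jp_pos s k)) (jp_ge1 s k ltac:(lra)) (Cmod_ge_0 (u0 k)). nra.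
    - generalize (nle_coef _ _ _ k brho0 (jp_pos (s - 1) k)) (jp_ge1 (s - 1) k ltac:(lra)) (Cmod_ge_0 (rho0 k)). nra. }
  assert (HB : 0 <= B) by (unfold B; lra).
  (* Vanishing at 0 turns the Lipschitz bound into the bound on the field at the initial value that
     [picard] asks for. *)
  assert (G00 : forall i, Gfield (fun _ => 0) i = 0).
  { intros [[w b] k]. unfold Gfield.
    assert (Z0 : forall v, cproj B n (hsym (decode v (fun _ => 0))) = fun _ => RtoC 0).
    { intros v. apply functional_extensionality. intros j. unfold cproj, pn. destruct (Z.leb _ _); auto.
      unfold cclip, hsym, decode, Cmult, Cplus, Cconj, RtoC; simpl.
      unfold RtoC. f_equal; rewrite clip_id; try ring;
      match goal with |- Rabs ?e <= _ => replace e with 0 by ring end; rewrite Rabs_R0; auto. }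
    rewrite !Z0. replace (pn n _ k) with (RtoC 0); [destruct b; reflexivity|].
    unfold pn. destruct (Z.leb _ _); auto. destruct w; [now rewrite Fu_zero|now rewrite Fr_zero]. }
  destruct (picard idx Gfield L (L * R0) x0) as (x & X0 & Xc & Xd); auto.
  - apply Rmult_le_pos; lra.
  - intros i. replace (Gfield x0 i) with (Gfield x0 i - Gfield (fun _ => 0) i) by (rewrite G00; ring).
    apply Lip; [lra|]. intros j. rewrite Rminus_0_r. auto.
  (* The Picard solution keeps its data beyond n and need not be Hermitian; the field reads only
     this projected and symmetrised part. *)
  - set (a := fun v t => pn n (hsym (decode v (x t)))).
    assert (Ha : forall v t k, cproj B n (a v t) k = cproj B n (hsym (decode v (x t))) k).
    { intros v t k. unfold cproj, a, pn. destruct (Z.leb _ _) eqn:Ek; auto. }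
    assert (Ha' : forall v t, cproj B n (a v t) = cproj B n (hsym (decode v (x t)))).
    { intros. apply functional_extensionality. apply Ha. }
    assert (Hc : forall v k t, ccont (fun t => a v t k) t).
    { intros v k t. unfold a, pn. destruct (Z.leb _ _).
      - apply (ccont_hsym (fun t => decode v (x t))); split; simpl; apply Xc.
      - split; apply continuous_const. }
    assert (HK1 : 0 <= wsum (jp s) n) by apply sqrt_pos. assert (HK2 : 0 <= wsum (jp (s - 1)) n) by apply sqrt_pos.
    assert (Herm : forall t v, herm (a v t)) by (intros; apply herm_pn, herm_hsym).
    assert (HF : forall t, herm (Fu g mu (cproj B n (a true t)) (cproj B n (a false t))) /\
                           herm (Fr g' (cproj B n (a true t)) (cproj B n (a false t)))).
    { intros t. set (K := wsum (jp s) n * (2 * B) + wsum (jp (s - 1)) n * (2 * B)).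
      assert (0 <= wsum (jp s) n * (2 * B)) by (apply Rmult_le_pos; lra).
      assert (0 <= wsum (jp (s - 1)) n * (2 * B)) by (apply Rmult_le_pos; lra).
      assert (N1 : nle (jp s) (cproj B n (a true t)) (R0 + K)).
      { eapply nle_weak; [apply (nle_bounded (jp s) n _ (2 * B)); auto using jp_pos, cproj_supp, cproj_bd; lra|].
        unfold K; lra. }
      assert (N2 : nle (jp (s - 1)) (cproj B n (a false t)) (R0 + K)).
      { eapply nle_weak; [apply (nle_bounded (jp (s - 1)) n _ (2 * B)); auto using jp_pos, cproj_supp, cproj_bd; lra|].
        unfold K; lra. }
      split.
      - apply (herm_Fu s c E g mu (R0 + K)); auto using herm_cproj; unfold K; lra.
      - apply (herm_Fr s c E g' (R0 + K)); auto using herm_cproj; unfold K; lra. }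
    (* The field is itself Hermitian, so symmetrising the unknown does not change its derivative. *)
    assert (Hd : forall v t k, 0 < t -> In k (range n) -> forall F, herm F ->
      (forall b j, In j (range n) -> Gfield (x t) (v, b, j) = part b (F j)) ->
      cder (fun t => a v t k) t (F k)).
    { intros v t k Ht Hk F hF HG.
      assert (Hk' : In (- k)%Z (range n)) by (rewrite in_range in *; lia).
      assert (D : forall b j, In j (range n) -> is_derive (fun t => x t (v, b, j)) t (part b (F j))).
      { intros b j Hj. rewrite <- HG; auto. }
      assert (Hpn : forall t, a v t k = hsym (decode v (x t)) k) by (intros; unfold a; now apply pn_in).
      apply cder_ext with (fun t => hsym (decode v (x t)) k); [intros; now rewrite Hpn|].
      apply (cder_hsym (fun t => decode v (x t)) k t F hF); split; simpl.
      - exact (D true k Hk).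
      - exact (D false k Hk).
      - exact (D true _ Hk').
      - exact (D false _ Hk'). }
    exists (a true), (a false). split; [|split; [|split; [|split]]].
    + intros t. split; apply Herm.
    + intros t. split; apply pn_supp.
    + intros t k. split; apply Hc.
    + assert (E0 : forall v, decode v (x 0) = if v then u0 else rho0).
      { intros v. apply functional_extensionality. intros k. unfold decode. rewrite !X0. unfold x0, part.
        destruct v; [destruct (u0 k)|destruct (rho0 k)]; reflexivity. }
      split; apply functional_extensionality; intros k; unfold a, pn; rewrite E0;
        destruct (Z.leb _ _); auto; now apply hsym_id.
    + intros t k Ht Hk. destruct (HF t) as [H1 H2]. split.
      * apply (Hd true t k Ht Hk (Fu g mu (cproj B n (a true t)) (cproj B n (a false t))) H1).
        intros b j Hj. unfold Gfield. rewrite pn_in by auto. now rewrite !Ha'.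
      * apply (Hd false t k Ht Hk (Fr g' (cproj B n (a true t)) (cproj B n (a false t))) H2).
        intros b j Hj. unfold Gfield. rewrite pn_in by auto. now rewrite !Ha'.
Qed.

(** The lifespan serves all L and N at once; the case L = 0 shows that clipping never acts, so the
    true equation holds. *)
Lemma galerkin : exists u rho : R -> fseq,
  (forall t, supp (range n) (u t) /\ supp (range n) (rho t)) /\
  (u 0 = pn n u0 /\ rho 0 = pn n rho0) /\
  approx_traj s g g' mu (2 * R0) life n u rho /\
  (forall L N, 0 <= L -> 0 < N -> nle (vw s L N) u0 R0 -> nle (vw (s - 1) L N) rho0 R0 ->
   forall t, 0 <= t <= life -> nle (vw s L N) (u t) (2 * R0) /\ nle (vw (s - 1) L N) (rho t) (2 * R0)).
Proof.
  destruct galerkin_clipped as (u & rho & Hh & Hsp & Hc & [I1 I2] & Hd).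
  assert (Hc1 := est_c s c E).
  assert (HB : forall L N, 0 <= L -> 0 < N -> nle (vw s L N) u0 R0 -> nle (vw (s - 1) L N) rho0 R0 ->
   forall t, 0 <= t <= life -> nle (vw s L N) (u t) (2 * R0) /\ nle (vw (s - 1) L N) (rho t) (2 * R0)).
  { intros L N HL HN N1 N2.
    set (D := fun t => en (vw s L N) (range n) (u t) + en (vw (s - 1) L N) (range n) (rho t)).
    set (D' := fun t => 2 * pairing (vw s L N) (range n) (u t) (Fu g mu (cproj B n (u t)) (cproj B n (rho t))) +
      2 * pairing (vw (s - 1) L N) (range n) (rho t) (Fr g' (cproj B n (u t)) (cproj B n (rho t)))).
    assert (NB : forall t, D t <= 2 * R0 ^ 2 + 2 * R0 ^ 2 -> nle (vw s L N) (u t) (2 * R0) /\ nle (vw (s - 1) L N) (rho t) (2 * R0)).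
    { intros t Ht. unfold D in Ht.
      generalize (en_pos (vw s L N) (range n) (u t)) (en_pos (vw (s - 1) L N) (range n) (rho t)); intros.
      split; apply nle_of_en with (range n); try apply range_NoDup; try apply Hsp; try lra;
        rewrite Rpow_mult_distr; lra. }
    intros t Ht. apply NB. revert t Ht.
    (* Below 4 R0^2 each norm is at most 2 R0, so the rate is 4 * 12 c (2 R0)^3 = 384 c R0^3; over
       [life] it yields 1.92 R0^2 < 2 R0^2. *)
    apply (bootstrap D D' (2 * R0 ^ 2) (2 * R0 ^ 2) (384 * c * R0 ^ 3) life).
    - nra.
    - apply Rmult_le_pos; [lra|]. apply pow_le; lra.
    - intros t. assert (C1 := en_cont (vw s L N) (range n) u t (fun k _ => proj1 (Hc t k))).
      assert (C2 := en_cont (vw (s - 1) L N) (range n) rho t (fun k _ => proj2 (Hc t k))).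
      exact (continuous_plus (V := R_NormedModule) _ _ t C1 C2).
    - intros t Ht.
      assert (C1 := en_derive (vw s L N) (range n) u _ t (fun k Hk => proj1 (Hd t k (proj1 Ht) Hk))).
      assert (C2 := en_derive (vw (s - 1) L N) (range n) rho _ t (fun k Hk => proj2 (Hd t k (proj1 Ht) Hk))).
      exact (is_derive_plus (V := R_NormedModule) _ _ t _ _ C1 C2).
    - unfold D. rewrite I1, I2.
      assert (M1 := en_of_nle _ (range n) _ _ (range_NoDup n) (nle_pn _ n _ _ (vw_pos L N HL HN s) N1)).
      assert (M2 := en_of_nle _ (range n) _ _ (range_NoDup n) (nle_pn _ n _ _ (vw_pos L N HL HN (s - 1)) N2)).
      lra.
    - intros t Ht HD. destruct (NB t HD) as [B1 B2].
      unfold D'. rewrite (cproj_inactive B n _ (u t) (fun k => Rle_trans _ _ _ (jp_ge1 s k ltac:(lra)) (vw_ge L N HL HN s k)) B1 (proj1 (Hsp t))).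
      rewrite (cproj_inactive B n _ (rho t) (fun k => Rle_trans _ _ _ (jp_ge1 (s - 1) k ltac:(lra)) (vw_ge L N HL HN (s - 1) k)) B2 (proj2 (Hsp t))).
      assert (G1 := high_Fu s c L N g mu (2 * R0) (u t) (rho t) (range n) E HL HN ltac:(lra) ltac:(lra) ltac:(lra)
        B1 B2 (proj1 (Hh t)) (range_NoDup n) (proj1 (Hsp t))).
      assert (G2 := high_Fr s c L N g' (2 * R0) (u t) (rho t) (range n) E HL HN ltac:(lra) ltac:(lra)
        B1 B2 (proj1 (Hh t)) (range_NoDup n) (proj2 (Hsp t))).
      apply Rabs_le_between in G1, G2. lra.
    - unfold life. assert (0 < c * R0) by (apply Rmult_lt_0_compat; lra).
      replace (384 * c * R0 ^ 3 * / (200 * c * R0)) with (384 / 200 * R0 ^ 2) by (field; lra).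
      assert (0 < R0 ^ 2) by nra. lra. }
  assert (Bs : forall t, 0 <= t <= life -> nle (jp s) (u t) (2 * R0) /\ nle (jp (s - 1)) (rho t) (2 * R0)).
  { intros t Ht. specialize (HB 0 1 (Rle_refl 0) Rlt_0_1). rewrite !vw0 in HB. auto. }
  exists u, rho. split; auto. split; auto. split; auto.
  split; try (intros; now apply Hh); try (intros; now apply Bs); try (intros; apply Hc).
  - intros t k Ht Hk. destruct (Bs t ltac:(lra)) as [B1 B2].
    generalize (proj1 (Hd t k (proj1 Ht) Hk)).
    rewrite (cproj_inactive B n _ (u t) (fun k => jp_ge1 s k ltac:(lra)) B1 (proj1 (Hsp t))).
    rewrite (cproj_inactive B n _ (rho t) (fun k => jp_ge1 (s - 1) k ltac:(lra)) B2 (proj2 (Hsp t))). auto.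
  - intros t k Ht Hk. destruct (Bs t ltac:(lra)) as [B1 B2].
    generalize (proj2 (Hd t k (proj1 Ht) Hk)).
    rewrite (cproj_inactive B n _ (u t) (fun k => jp_ge1 s k ltac:(lra)) B1 (proj1 (Hsp t))).
    rewrite (cproj_inactive B n _ (rho t) (fun k => jp_ge1 (s - 1) k ltac:(lra)) B2 (proj2 (Hsp t))). auto.
Qed.

End Galerkin.

(** * Tails and passage to the limit *)

Lemma lsum_filter (b : Z -> bool) l f : lsum l (fun k => if b k then f k else 0) = lsum (filter b l) f.
Proof. induction l as [|k l IH]; simpl; [reflexivity|]. destruct (b k); simpl; lra. Qed.

(** Once a sum over [range n] is within eps of the supremum of such sums, any list disjoint from
    that range adds at most eps. *)
Lemma nle_tail_small w a B eps : nle w a B -> 0 < eps ->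
  exists n, forall l, NoDup l -> (forall k, In k l -> ~ In k (range n)) ->
  lsum l (fun k => (w k * Cmod (a k)) ^ 2) <= eps.
Proof.
  intros [HB H] Heps. set (f := fun k => (w k * Cmod (a k)) ^ 2) in *.
  assert (Hf : forall k, 0 <= f k) by (intros; apply pow2_ge_0).
  set (S := fun x => exists n, x = lsum (range n) f).
  destruct (completeness S) as [M [Hub Hlub]].
  - exists (B ^ 2). intros x [n ->]. apply H, range_NoDup.
  - exists (lsum (range 0) f). now exists O.
  - assert (Hn : exists n, M - eps < lsum (range n) f).
    { destruct (classic (exists n, M - eps < lsum (range n) f)) as [|Hn]; auto. exfalso.
      assert (M <= M - eps); [|lra]. apply Hlub. intros x [n ->]. apply Rnot_lt_le. intros Hx. apply Hn. now exists n. }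
    destruct Hn as [n Hn]. exists n. intros l Hl Hd.
    destruct (incl_range (l ++ range n)) as [m Hm].
    assert (lsum (l ++ range n) f <= M).
    { eapply Rle_trans; [|apply Hub; now exists m]. apply lsum_incl; auto.
      apply NoDup_app; auto using range_NoDup. }
    rewrite lsum_app in H0. lra.
Qed.

Lemma nle_weight_add w w' a A B : (forall k, 0 <= w k) -> (forall k, 0 <= w' k) ->
  nle w a A -> nle w' a B -> nle (fun k => w k + w' k) a (A + B).
Proof.
  intros Hw Hw' [HA HA2] [HB HB2]. split; [lra|]. intros l Hl.
  rewrite (lsum_ext l _ (fun k => (w k * Cmod (a k)) ^ 2 + 2 * ((w k * Cmod (a k)) * (w' k * Cmod (a k))) + (w' k * Cmod (a k)) ^ 2))
    by (intros; ring).
  rewrite !lsum_plus, lsum_scal.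
  generalize (HA2 l Hl) (HB2 l Hl) (lsum_CS_bound l _ _ A B HA HB (HA2 l Hl) (HB2 l Hl)). nra.
Qed.

Lemma nle_w_ext w w' a B : (forall k, w k = w' k) -> nle w a B -> nle w' a B.
Proof. intros H. replace w' with w; auto. now apply functional_extensionality. Qed.

(** The extra weight L min(1, |k|/N) is split at a frequency n: above it the tail of a is small,
    below it the factor is at most n / N. *)
Lemma vw_choose q a A L eta : nle (jp q) a A -> 0 <= L -> 0 < eta ->
  exists m0, forall m, (m0 <= m)%nat -> nle (vw q L (INR (S m))) a (A + eta).
Proof.
  intros HA HL Heta. assert (A0 := proj1 HA).
  assert (Hq : 0 < (eta / (2 * (L + 1))) ^ 2) by (apply pow_lt, Rdiv_lt_0_compat; lra).
  destruct (nle_tail_small _ _ _ _ HA Hq) as [n Hn].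
  (* Makes (n / N) A at most eta / (2 (L + 1)), the same share as the tail beyond n. *)
  destruct (INR_unbounded (INR n * (2 * (L + 1)) * (A + 1) / eta)) as [m0 Hm0].
  exists m0. intros m Hm.
  set (N := INR (S m)). assert (HN : 0 < N) by (apply lt_0_INR; lia).
  assert (HmN : INR m0 <= N) by (apply le_INR; lia).
  apply nle_w_ext with (fun k => jp q k + jp q k * (L * Rmin 1 (Rabs (IZR k) / N))).
  { intros k. unfold vw, mw. ring. }
  assert (Hmin := mw_min_bounds N HN).
  apply nle_weight_add; auto.
  - intros; left; apply jp_pos.
  - intros k. apply Rmult_le_pos; [left; apply jp_pos|]. apply Rmult_le_pos; auto. apply Hmin.
  - split; [lra|]. intros l Hl.
    set (e := eta / (2 * (L + 1))). assert (He : 0 < e) by (apply Rdiv_lt_0_compat; lra).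
    set (del := INR n / N). assert (Hdel : 0 <= del) by (apply Rmult_le_pos; [apply pos_INR|left; now apply Rinv_0_lt_compat]).
    assert (HdA : del * A <= e).
    { apply Rle_trans with (del * (A + 1)); [nra|]. unfold del, e.
      assert (INR n * (2 * (L + 1)) * (A + 1) / eta < N) by lra.
      apply Rmult_le_reg_r with (N * (2 * (L + 1))); [apply Rmult_lt_0_compat; lra|].
      replace (INR n / N * (A + 1) * (N * (2 * (L + 1)))) with (INR n * (2 * (L + 1)) * (A + 1)) by (field; lra).
      replace (eta / (2 * (L + 1)) * (N * (2 * (L + 1)))) with (eta * N) by (field; lra).
      apply (Rmult_lt_compat_l eta) in H; [|lra].
      replace (eta * (INR n * (2 * (L + 1)) * (A + 1) / eta)) with (INR n * (2 * (L + 1)) * (A + 1)) in H by (field; lra).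
      lra. }
    set (inr := fun k => if in_dec Z.eq_dec k (range n) then true else false).
    apply Rle_trans with (lsum l (fun k => L ^ 2 * (del ^ 2 * (jp q k * Cmod (a k)) ^ 2)
       + L ^ 2 * (if negb (inr k) then (jp q k * Cmod (a k)) ^ 2 else 0))).
    + apply lsum_le. intros k _. generalize (Hmin k); intros Hk. unfold inr.
      replace ((jp q k * (L * Rmin 1 (Rabs (IZR k) / N)) * Cmod (a k)) ^ 2) with
        (L ^ 2 * ((Rmin 1 (Rabs (IZR k) / N)) ^ 2 * (jp q k * Cmod (a k)) ^ 2)) by ring.
      rewrite <- Rmult_plus_distr_l. apply Rmult_le_compat_l; [apply pow2_ge_0|].
      assert (P := pow2_ge_0 (jp q k * Cmod (a k))).
      destruct (in_dec _ _ _) as [Hi|Hi]; cbn [negb].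
      * rewrite Rplus_0_r. apply Rmult_le_compat_r; auto. apply pow_incr. split; [lra|].
        eapply Rle_trans; [apply Rmin_r|]. unfold del. apply Rmult_le_compat_r; [left; now apply Rinv_0_lt_compat|].
        rewrite <- abs_IZR, INR_IZR_INZ. apply IZR_le. now apply in_range.
      * assert (Rmin 1 (Rabs (IZR k) / N) ^ 2 <= 1) by nra.
        assert (0 <= del ^ 2 * (jp q k * Cmod (a k)) ^ 2) by (apply Rmult_le_pos; auto; apply pow2_ge_0). nra.
    + rewrite lsum_plus, !lsum_scal.
      assert (T1 : del ^ 2 * lsum l (fun k => (jp q k * Cmod (a k)) ^ 2) <= e ^ 2).
      { apply Rle_trans with (del ^ 2 * A ^ 2).
        - apply Rmult_le_compat_l; [apply pow2_ge_0|now apply HA].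
        - rewrite <- Rpow_mult_distr. apply pow_incr. split; auto. nra. }
      assert (T2 : lsum l (fun k => if negb (inr k) then (jp q k * Cmod (a k)) ^ 2 else 0) <= e ^ 2).
      { rewrite lsum_filter. apply Hn.
        - now apply NoDup_filter.
        - intros k Hk. apply filter_In in Hk as [_ Hk]. unfold inr in Hk. destruct (in_dec _ _ _); auto; discriminate. }
      assert (0 <= L ^ 2) by apply pow2_ge_0.
      assert (HLe : L * e <= eta / 2).
      { unfold e. apply Rmult_le_reg_r with (2 * (L + 1)); [lra|]. 
        replace (L * (eta / (2 * (L + 1))) * (2 * (L + 1))) with (L * eta) by (field; lra). nra. }
      assert (0 <= L * e) by nra.
      assert ((L * e) ^ 2 <= (eta / 2) ^ 2) by (apply pow_incr; lra). nra.
Qed.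

(* High frequencies are controlled by the weight [mw L m >= 1 + L], low ones by the weaker norm. *)
Lemma strong_of_low q q' L m d A e : q' <= q -> 0 <= L -> nle (vw q L (INR (S m))) d A ->
  0 <= e -> en (jp q') (range (S m)) d <= e ^ 2 ->
  nle (jp q) d (A / (1 + L) + jp (q - q') (Z.of_nat (S m)) * e).
Proof.
  intros Hq HL [HA HA2] He Hen. set (K := jp (q - q') (Z.of_nat (S m))).
  assert (HK : 0 < K) by apply jp_pos.
  assert (HAL : 0 <= A / (1 + L)) by (apply Rmult_le_pos; [auto|left; apply Rinv_0_lt_compat; lra]).
  assert (HKe : 0 <= K * e) by (apply Rmult_le_pos; lra).
  split; [lra|]. intros l Hl.
  set (inr := fun k => if in_dec Z.eq_dec k (range (S m)) then true else false).
  apply Rle_trans with (lsum l (fun k => (/ (1 + L)) ^ 2 * (vw q L (INR (S m)) k * Cmod (d k)) ^ 2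
     + K ^ 2 * (if inr k then (jp q' k * Cmod (d k)) ^ 2 else 0))).
  - apply lsum_le. intros k _. unfold inr.
    assert (P1 := pow2_ge_0 (vw q L (INR (S m)) k * Cmod (d k))).
    assert (P2 : 0 < (/ (1 + L)) ^ 2) by (apply pow_lt, Rinv_0_lt_compat; lra).
    destruct (in_dec _ _ _) as [Hi|Hi].
    + rewrite <- !Rpow_mult_distr.
      assert ((jp q k * Cmod (d k)) ^ 2 <= (K * (jp q' k * Cmod (d k))) ^ 2).
      { apply pow_incr. split; [apply Rmult_le_pos; [left; apply jp_pos|apply Cmod_ge_0]|].
        rewrite <- Rmult_assoc. apply Rmult_le_compat_r; [apply Cmod_ge_0|].
        replace q with ((q - q') + q') at 1 by ring. rewrite jp_plus.
        apply Rmult_le_compat_r; [left; apply jp_pos|]. apply jp_mono; [lra|]. apply jb_mono.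
        rewrite <- !abs_IZR. apply IZR_le. apply in_range in Hi. lia. }
      generalize (pow2_ge_0 (/ (1 + L) * (vw q L (INR (S m)) k * Cmod (d k)))). lra.
    + rewrite Rmult_0_r, Rplus_0_r, <- Rpow_mult_distr. apply pow_incr.
      split; [apply Rmult_le_pos; [left; apply jp_pos|apply Cmod_ge_0]|].
      rewrite <- Rmult_assoc. apply Rmult_le_compat_r; [apply Cmod_ge_0|].
      assert (E : mw L (INR (S m)) k = 1 + L).
      { unfold mw. rewrite Rmin_left; [ring|]. rewrite in_range in Hi.
        assert (HS : 0 < INR (S m)) by (apply lt_0_INR; lia).
        apply Rmult_le_reg_r with (INR (S m)); auto. unfold Rdiv. rewrite Rmult_assoc, Rinv_l by lra.
        rewrite Rmult_1_l, Rmult_1_r, INR_IZR_INZ, <- abs_IZR. apply IZR_le. lia. }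
      unfold vw. rewrite E. apply Req_le. field. lra.
  - rewrite lsum_plus, !lsum_scal.
    assert (T2 : lsum l (fun k => if inr k then (jp q' k * Cmod (d k)) ^ 2 else 0) <= e ^ 2).
    { eapply Rle_trans; [|exact Hen]. unfold en.
      rewrite lsum_filter. apply lsum_incl; [now apply NoDup_filter| |intros; apply pow2_ge_0].
      intros k Hk. apply filter_In in Hk as [_ Hk]. unfold inr in Hk. destruct (in_dec _ _ _); auto; discriminate. }
    assert (T1 := HA2 l Hl).
    assert ((/ (1 + L)) ^ 2 * lsum l (fun k => (vw q L (INR (S m)) k * Cmod (d k)) ^ 2) <= (/ (1 + L)) ^ 2 * A ^ 2)
      by (apply Rmult_le_compat_l; auto; apply pow2_ge_0).
    assert (K ^ 2 * lsum l (fun k => if inr k then (jp q' k * Cmod (d k)) ^ 2 else 0) <= K ^ 2 * e ^ 2)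
      by (apply Rmult_le_compat_l; auto; apply pow2_ge_0).
    replace ((A / (1 + L) + K * e) ^ 2) with ((/ (1 + L)) ^ 2 * A ^ 2 + K ^ 2 * e ^ 2 + 2 * ((A / (1 + L)) * (K * e)))
      by (field; lra).
    assert (0 <= (A / (1 + L)) * (K * e)) by (apply Rmult_le_pos; auto). lra.
Qed.

(** L = 2 A / eps makes the high-frequency share at most eps / 2, and the threshold on the low
    energy does the same for the other share. *)
Lemma strong_of_low_pair s A eps m du dr : 1 / 2 <= s -> 0 < A -> 0 < eps ->
  nle (vw s (2 * A / eps) (INR (S m))) du A -> nle (vw (s - 1) (2 * A / eps) (INR (S m))) dr A ->
  en (jp (1/2)) (range (S m)) du + en (jp (-(1/2))) (range (S m)) dr <=
    (eps / (2 * jp (s - 1/2) (Z.of_nat (S m)))) ^ 2 ->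
  nle (jp s) du eps /\ nle (jp (s - 1)) dr eps.
Proof.
  intros Hs HA0 Heps D1 D2 Low. set (L := 2 * A / eps) in *.
  assert (HL : 0 < L) by (apply Rdiv_lt_0_compat; lra).
  set (K := jp (s - 1/2) (Z.of_nat (S m))) in *. assert (HK : 0 < K) by apply jp_pos.
  set (e := eps / (2 * K)) in *. assert (He : 0 < e) by (apply Rdiv_lt_0_compat; lra).
  generalize (en_pos (jp (1/2)) (range (S m)) du) (en_pos (jp (-(1/2))) (range (S m)) dr). intros P1 P2.
  assert (HA : A / (1 + L) <= eps / 2).
  { apply Rmult_le_reg_r with (1 + L); [lra|]. unfold Rdiv at 1. rewrite Rmult_assoc, Rinv_l, Rmult_1_r by lra.
    assert (eps / 2 * L = A) by (unfold L; field; lra). lra. }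
  assert (HKe : K * e = eps / 2) by (unfold e; field; lra).
  split.
  - eapply nle_weak; [apply (strong_of_low s (1/2) L m _ _ e ltac:(lra) ltac:(lra) D1); lra|]. fold K. lra.
  - eapply nle_weak; [apply (strong_of_low (s - 1) (-(1/2)) L m _ _ e ltac:(lra) ltac:(lra) D2); lra|].
    replace (s - 1 - -(1/2)) with (s - 1/2) by lra. fold K. lra.
Qed.

Lemma Rpower_neg_lim p eps : p < 0 -> 0 < eps -> exists n0, forall n, (n0 <= n)%nat -> Rpower (INR (S n)) p < eps.
Proof.
  intros Hp Heps. destruct (INR_unbounded (Rpower eps (/ p))) as [n0 Hn]. exists n0. intros n Hnn.
  assert (H1 : 0 < Rpower eps (/ p)) by apply exp_pos.
  assert (H2 : Rpower eps (/ p) < INR (S n)).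
  { eapply Rlt_le_trans; [apply Hn|]. apply le_INR. lia. }
  assert (E : eps = Rpower (Rpower eps (/ p)) p).
  { rewrite Rpower_mult, Rinv_l, Rpower_1; lra. }
  rewrite E. replace p with (- - p) at 1 3 by ring. rewrite !(Rpower_Ropp _ (- p)).
  apply Rinv_lt_contravar; [apply Rmult_lt_0_compat; apply exp_pos|].
  apply Rlt_Rpower_l; lra.
Qed.

(** The scalar mean value theorem is applied to the pairing of f(t) - t G with the very vector to be
    bounded; its norm S then satisfies S <= sqrt S * eps. *)
Lemma vector_mvt w l (f F : R -> fseq) (G : fseq) a b eps : a < b -> 0 <= eps -> NoDup l ->
  (forall t k, ccont (fun t => f t k) t) ->
  (forall t k, a < t < b -> In k l -> cder (fun t => f t k) t (F t k)) ->
  (forall t, a < t < b -> lsum l (fun k => (w k * Cmod (fsub (F t) G k)) ^ 2) <= eps ^ 2) ->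
  lsum l (fun k => (w k * Cmod (fsub (fscal (/ (b - a)) (fsub (f b) (f a))) G k)) ^ 2) <= eps ^ 2.
Proof.
  intros Hab He Hl Hc Hd HF.
  set (c := fsub (fscal (/ (b - a)) (fsub (f b) (f a))) G). set (S := lsum l (fun k => (w k * Cmod (c k)) ^ 2)).
  fold S.
  set (phi := fun t => lsum l (fun k => w k ^ 2 * (Re (c k) * (Re (f t k) - t * Re (G k)) + Im (c k) * (Im (f t k) - t * Im (G k))))).
  set (phi' := fun t => lsum l (fun k => w k ^ 2 * (Re (c k) * (Re (F t k) - Re (G k)) + Im (c k) * (Im (F t k) - Im (G k))))).
  destruct (mvt phi phi' a b Hab) as (x & Hx & Emvt).
  - intros t _. unfold phi. apply (lsum_continuous l (fun k t => w k ^ 2 * (Re (c k) * (Re (f t k) - t * Re (G k)) + Im (c k) * (Im (f t k) - t * Im (G k))))).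
    intros k _. destruct (Hc t k) as [C1 C2].
    apply (continuous_mult (fun _ => w k ^ 2)); [apply continuous_const|].
    apply (continuous_plus (V := R_NormedModule) (fun t => Re (c k) * (Re (f t k) - t * Re (G k))) (fun t => Im (c k) * (Im (f t k) - t * Im (G k)))).
    + apply (continuous_mult (fun _ => Re (c k))); [apply continuous_const|].
      apply (continuous_minus (V := R_NormedModule) (fun t => Re (f t k)) (fun t => t * Re (G k))); auto.
      apply (continuous_mult (fun t => t) (fun _ => Re (G k))); [apply continuous_id|apply continuous_const].
    + apply (continuous_mult (fun _ => Im (c k))); [apply continuous_const|].
      apply (continuous_minus (V := R_NormedModule) (fun t => Im (f t k)) (fun t => t * Im (G k))); auto.
      apply (continuous_mult (fun t => t) (fun _ => Im (G k))); [apply continuous_id|apply continuous_const].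
  - intros t Ht. unfold phi, phi'. apply (lsum_derive l (fun k t => w k ^ 2 * (Re (c k) * (Re (f t k) - t * Re (G k)) + Im (c k) * (Im (f t k) - t * Im (G k))))).
    intros k Hk. destruct (Hd t k Ht Hk) as [D1 D2].
    assert (Dg : forall r : R, is_derive (fun t => t * r) t r) by (intros; auto_derive; auto; ring).
    apply (is_derive_scal (fun t => Re (c k) * (Re (f t k) - t * Re (G k)) + Im (c k) * (Im (f t k) - t * Im (G k)))).
    apply (is_derive_plus (V := R_NormedModule) (fun t => Re (c k) * (Re (f t k) - t * Re (G k))) (fun t => Im (c k) * (Im (f t k) - t * Im (G k)))).
    + apply (is_derive_scal (fun t => Re (f t k) - t * Re (G k))).
      apply (is_derive_minus (V := R_NormedModule) (fun t => Re (f t k)) (fun t => t * Re (G k))); auto.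
    + apply (is_derive_scal (fun t => Im (f t k) - t * Im (G k))).
      apply (is_derive_minus (V := R_NormedModule) (fun t => Im (f t k)) (fun t => t * Im (G k))); auto.
  - assert (E1 : phi b - phi a = (b - a) * S).
    { unfold phi, S. rewrite <- lsum_minus, <- lsum_scal. apply lsum_ext. intros k _.
      rewrite <- en_term.
      assert (Er : Re (c k) = / (b - a) * (Re (f b k) - Re (f a k)) - Re (G k)).
      { unfold c, fsub, fscal, Cminus, Cmult, Cplus, Copp, RtoC, Re; simpl. ring. }
      assert (Ei : Im (c k) = / (b - a) * (Im (f b k) - Im (f a k)) - Im (G k)).
      { unfold c, fsub, fscal, Cminus, Cmult, Cplus, Copp, RtoC, Im; simpl. ring. }
      replace (Re (f b k)) with (Re (f a k) + (b - a) * (Re (c k) + Re (G k))) by (rewrite Er; field; lra).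
      replace (Im (f b k)) with (Im (f a k) + (b - a) * (Im (c k) + Im (G k))) by (rewrite Ei; field; lra).
      ring. }
    assert (HS0 : 0 <= S) by (apply lsum_pos; intros; apply pow2_ge_0).
    assert (HS : S = phi' x).
    { rewrite E1 in Emvt. apply Rmult_eq_reg_l with (b - a); lra. }
    assert (HB : phi' x <= sqrt S * eps).
    { apply Rle_trans with (lsum l (fun k => (w k * Cmod (c k)) * (w k * Cmod (fsub (F x) G k)))).
      - unfold phi'. apply lsum_le. intros k _.
        replace (w k * Cmod (c k) * (w k * Cmod (fsub (F x) G k))) with (w k ^ 2 * (Cmod (c k) * Cmod (fsub (F x) G k))) by ring.
        apply Rmult_le_compat_l; [apply pow2_ge_0|].
        rewrite <- Cmod_conj, <- Cmod_mult. eapply Rle_trans; [|apply Re_le_Cmod]. eapply Rle_trans; [|apply Rle_abs].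
        apply Req_le. unfold fsub. destruct (c k), (F x k), (G k). unfold Cminus, Cplus, Copp, Cmult, Cconj, Re, Im; simpl. ring.
      - apply lsum_CS_bound; auto using sqrt_pos.
        rewrite pow2_sqrt by auto. apply Rle_refl. }
    rewrite <- HS in HB. assert (Hq := sqrt_pos S). assert (Hq2 := pow2_sqrt S HS0).
    rewrite <- Hq2. apply pow_incr. split; auto.
    rewrite <- Hq2 in HB at 1. nra.
Qed.

(** * Local existence *)

(** Closed-interval version of [contH]. [nle] includes the summability of the difference, which a
    bound on [normH] alone would not give. *)
Definition contN (r T : R) (f : R -> fseq) : Prop :=
  forall t, 0 <= t <= T -> forall eps, 0 < eps -> exists d, 0 < d /\
  forall t', 0 <= t' <= T -> Rabs (t' - t) < d -> nle (jp r) (fsub (f t') (f t)) eps.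

Definition derN (r T : R) (f f' : R -> fseq) : Prop :=
  forall t, 0 <= t <= T -> forall eps, 0 < eps -> exists d, 0 < d /\
  forall h, h <> 0 -> 0 <= t + h <= T -> Rabs h < d ->
  nle (jp r) (fsub (fscal (/ h) (fsub (f (t + h)) (f t))) (f' t)) eps.

(** [mu] is not tied to the mean of [u 0], so restarting at a later time needs no conservation of
    the mean. *)
Record Sol (s g g' mu T : R) (u rho : R -> fseq) : Prop := {
  sol_herm_u : forall t, 0 <= t <= T -> herm (u t);
  sol_herm_rho : forall t, 0 <= t <= T -> herm (rho t);
  sol_u : forall t, 0 <= t <= T -> exists B, nle (jp s) (u t) B;
  sol_rho : forall t, 0 <= t <= T -> exists B, nle (jp (s - 1)) (rho t) B;
  sol_cont_u : contN s T u;
  sol_cont_rho : contN (s - 1) T rho;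
  sol_der_u : derN (s - 1) T u (fun t => Fu g mu (u t) (rho t));
  sol_der_rho : derN (s - 2) T rho (fun t => Fr g' (u t) (rho t)) }.

Definition coef_lim (a : nat -> fseq) (b : fseq) : Prop := forall k,
  is_lim_seq (fun n => Re (a n k)) (Re (b k)) /\ is_lim_seq (fun n => Im (a n k)) (Im (b k)).

Lemma coef_lim_lsum w a b l : coef_lim a b ->
  is_lim_seq (fun n => lsum l (fun k => (w k * Cmod (a n k)) ^ 2)) (lsum l (fun k => (w k * Cmod (b k)) ^ 2)).
Proof.
  intros H. apply lsum_lim. intros k _. destruct (H k) as [H1 H2].
  simpl. assert (HC := Cmod_lim (fun n => a n k) (b k) H1 H2).
  assert (HW : is_lim_seq (fun n => w k * Cmod (a n k)) (w k * Cmod (b k))).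
  { apply (is_lim_seq_scal_l _ (w k) (Cmod (b k))). exact HC. }
  apply is_lim_seq_mult'; auto. apply is_lim_seq_mult'; auto. apply is_lim_seq_const.
Qed.

Lemma nle_lim w a b B n0 : coef_lim a b -> (forall n, (n0 <= n)%nat -> nle w (a n) B) -> nle w b B.
Proof.
  intros H HB. split; [apply (HB n0 (Nat.le_refl _))|]. intros l Hl.
  apply (is_lim_seq_le_loc (fun n => lsum l (fun k => (w k * Cmod (a n k)) ^ 2)) (fun _ => B ^ 2)
    (lsum l (fun k => (w k * Cmod (b k)) ^ 2)) (B ^ 2)); [|now apply coef_lim_lsum|apply is_lim_seq_const].
  exists n0. intros n Hn. now apply (HB n Hn).
Qed.

Lemma coef_lim_sub a b a' b' : coef_lim a b -> coef_lim a' b' ->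
  coef_lim (fun n => fsub (a n) (a' n)) (fsub b b').
Proof.
  intros H H' k. destruct (H k), (H' k). split; unfold fsub.
  - apply (is_lim_seq_minus' (fun n => Re (a n k)) (fun n => Re (a' n k))); auto.
  - apply (is_lim_seq_minus' (fun n => Im (a n k)) (fun n => Im (a' n k))); auto.
Qed.

Lemma coef_lim_const a : coef_lim (fun _ => a) a.
Proof. intros k. split; apply is_lim_seq_const. Qed.

Lemma coef_lim_scal r a b : coef_lim a b -> coef_lim (fun n => fscal r (a n)) (fscal r b).
Proof.
  intros H k. destruct (H k) as [H1 H2]. unfold fscal.
  assert (E1 : forall z, Re (Cmult (RtoC r) z) = r * Re z) by (intros [x y]; unfold Cmult, RtoC, Re; simpl; ring).
  assert (E2 : forall z, Im (Cmult (RtoC r) z) = r * Im z) by (intros [x y]; unfold Cmult, RtoC, Im; simpl; ring).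
  split.
  - rewrite E1. apply is_lim_seq_ext with (fun n => r * Re (a n k)); [intros; now rewrite E1|].
    apply (is_lim_seq_scal_l _ r (Re (b k)) H1).
  - rewrite E2. apply is_lim_seq_ext with (fun n => r * Im (a n k)); [intros; now rewrite E2|].
    apply (is_lim_seq_scal_l _ r (Im (b k)) H2).
Qed.

Lemma coef_lim_eventually a b d : coef_lim a b ->
  (forall k, exists n, forall m, (n <= m)%nat -> a m k = d k) -> b = d.
Proof.
  intros H He. apply functional_extensionality. intros k. destruct (H k) as [H1 H2], (He k) as [n Hn].
  assert (Re (b k) = Re (d k)) by (apply lim_eq with (1 := H1); exists n; intros m Hm; now rewrite Hn).
  assert (Im (b k) = Im (d k)) by (apply lim_eq with (1 := H2); exists n; intros m Hm; now rewrite Hn).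
  destruct (b k), (d k). unfold Re, Im in *; simpl in *. now subst.
Qed.

(** Completeness of weighted l2: the limit is taken coefficient by coefficient, and [nle_lim] plays
    the role of Fatou's lemma. *)
Lemma uniform_limit w (a : nat -> R -> fseq) T : (forall k, 0 < w k) ->
  (forall eps, 0 < eps -> exists n0, forall n n', (n0 <= n)%nat -> (n <= n')%nat ->
    forall t, 0 <= t <= T -> nle w (fsub (a n t) (a n' t)) eps) ->
  exists b : R -> fseq, (forall t, 0 <= t <= T -> coef_lim (fun n => a n t) (b t)) /\
  forall eps, 0 < eps -> exists n0, forall n, (n0 <= n)%nat -> forall t, 0 <= t <= T ->
    nle w (fsub (a n t) (b t)) eps.
Proof.
  intros Hw H.
  set (b := fun t k => (real (Lim_seq (fun n => Re (a n t k))), real (Lim_seq (fun n => Im (a n t k)))) : C).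
  assert (Hb : forall t, 0 <= t <= T -> coef_lim (fun n => a n t) (b t)).
  { intros t Ht k.
    assert (HC : forall eps : posreal, exists n0, forall n m, (n0 <= n)%nat -> (n0 <= m)%nat -> Cmod (Cminus (a n t k) (a m t k)) < eps).
    { intros eps. assert (He : 0 < eps * w k / 2) by (generalize (cond_pos eps) (Hw k); intros; apply Rdiv_lt_0_compat; [apply Rmult_lt_0_compat; auto|lra]).
      destruct (H _ He) as [n0 Hn]. exists n0.
      assert (G : forall n m, (n0 <= n)%nat -> (n <= m)%nat -> Cmod (Cminus (a n t k) (a m t k)) < eps).
      { intros n m H1 H2. generalize (nle_coef _ _ _ k (Hn n m H1 H2 t Ht) (Hw k)). unfold fsub. intros H3.
        apply Rmult_lt_reg_l with (w k); auto. lra. }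
      intros n m H1 H2. destruct (Nat.le_ge_cases n m); [now apply G|].
      rewrite <- Cmod_opp. replace (Copp (Cminus (a n t k) (a m t k))) with (Cminus (a m t k) (a n t k)) by ring. now apply G. }
    split; apply Lim_seq_correct', ex_lim_seq_cauchy_corr; intros eps; destruct (HC eps) as [n0 Hn]; exists n0;
      intros n m H1 H2; eapply Rle_lt_trans; try apply (Hn n m H1 H2).
    - apply (Re_le_Cmod (Cminus (a n t k) (a m t k))).
    - apply (Im_le_Cmod (Cminus (a n t k) (a m t k))). }
  exists b. split; auto. intros eps Heps. destruct (H eps Heps) as [n0 Hn]. exists n0. intros n Hnn t Ht.
  apply (nle_lim w (fun m => fsub (a n t) (a m t)) _ _ n).
  - apply coef_lim_sub; auto using coef_lim_const.
  - intros m Hm. now apply Hn.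
Qed.

Lemma herm_lim a b : coef_lim a b -> (forall n, herm (a n)) -> herm b.
Proof.
  intros H Ha k. destruct (H k) as [H1 H2], (H (- k)%Z) as [H3 H4].
  assert (ER : Re (b (- k)%Z) = Re (b k)).
  { apply is_lim_seq_unique in H1. apply is_lim_seq_unique in H3.
    rewrite (Lim_seq_ext _ (fun n => Re (a n k))) in H3.
    - rewrite H1 in H3. now inversion H3.
    - intros n. now rewrite (Ha n k). }
  assert (EI : Im (b (- k)%Z) = - Im (b k)).
  { apply is_lim_seq_opp in H2. apply is_lim_seq_unique in H2. apply is_lim_seq_unique in H4.
    rewrite (Lim_seq_ext _ (fun n => - Im (a n k))) in H4.
    - rewrite H2 in H4. now inversion H4.
    - intros n. now rewrite (Ha n k). }
  destruct (b k), (b (- k)%Z). unfold Re, Im, Cconj in *; simpl in *. now subst.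
Qed.

Lemma low_en_mono m n u rho v sg : (m <= n)%nat -> low_en m u rho v sg <= low_en n u rho v sg.
Proof.
  intros H. assert (Hi : incl (range m) (range n)).
  { intros k. rewrite !in_range. lia. }
  apply Rplus_le_compat; apply lsum_incl; auto using range_NoDup; intros; apply pow2_ge_0.
Qed.

Lemma approx_traj_weaken s g g' mu R0 T m n u rho : (m <= n)%nat ->
  approx_traj s g g' mu R0 T n u rho -> approx_traj s g g' mu R0 T m u rho.
Proof.
  intros H Hz. assert (Hi : incl (range m) (range n)) by (intros k; rewrite !in_range; lia).
  destruct Hz. split; auto.
Qed.

Lemma contN_F s c g g' mu R0 T u rho : estimates s c -> 1 <= R0 -> Rabs g <= R0 -> Rabs g' <= R0 -> Rabs mu <= R0 ->
  (forall t, 0 <= t <= T -> nle (jp s) (u t) R0 /\ nle (jp (s - 1)) (rho t) R0) ->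
  contN s T u -> contN (s - 1) T rho ->
  contN (s - 1) T (fun t => Fu g mu (u t) (rho t)) /\ contN (s - 2) T (fun t => Fr g' (u t) (rho t)).
Proof.
  intros E HR Hg Hg' Hmu HB Cu Cr. assert (Hc := est_c s c E).
  set (M := 12 * c * R0). assert (HM : 0 < M) by (apply Rmult_lt_0_compat; lra).
  assert (G : forall t, 0 <= t <= T -> forall eps, 0 < eps -> exists d, 0 < d /\ forall t', 0 <= t' <= T -> Rabs (t' - t) < d ->
    nle (jp s) (fsub (u t') (u t)) (eps / M) /\ nle (jp (s - 1)) (fsub (rho t') (rho t)) (eps / M)).
  { intros t Ht eps Heps. assert (Hq : 0 < eps / M) by (apply Rdiv_lt_0_compat; auto).
    destruct (Cu t Ht (eps / M) Hq) as (d1 & Hd1 & H1). destruct (Cr t Ht (eps / M) Hq) as (d2 & Hd2 & H2).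
    exists (Rmin d1 d2). split; [now apply Rmin_glb_lt|]. intros t' Ht' Hd.
    assert (B1 := Rmin_l d1 d2). assert (B2 := Rmin_r d1 d2).
    split; [apply H1|apply H2]; auto; lra. }
  split; intros t Ht eps Heps; destruct (G t Ht eps Heps) as (d & Hd & HH); exists d; (split; [auto|]);
    intros t' Ht' Hdt; destruct (HH t' Ht' Hdt) as [N1 N2]; destruct (HB t Ht) as [N3 N4]; destruct (HB t' Ht') as [N5 N6].
  - replace eps with (M * (eps / M + 0)) by (field; lra).
    apply (Lip_Fu s c E); auto. rewrite Rminus_diag, Rabs_R0; lra.
  - replace eps with (M * (eps / M)) by (field; lra). now apply (Lip_Fr s c E).
Qed.

Section LocalExistence.
Variables (s s' c c' g g' mu R0 : R).
Hypothesis Hs' : 3 / 2 < s'.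
Hypothesis Hss : s' < s.
Hypothesis E : estimates s c.
Hypothesis E' : estimates s' c'.
Hypothesis HR : 1 <= R0.
Hypothesis Hg : Rabs g <= R0.
Hypothesis Hg' : Rabs g' <= R0.
Hypothesis Hmu : Rabs mu <= R0.

(** The extra unit is the eta of [vw_choose]: data of norm R0 have weighted norm at most R1 for N
    large. *)
Let R1 := R0 + 1.
Let T := life c R1.

Lemma life_pos : 0 < T.
Proof.
  unfold T, life. assert (1 <= c) by apply (est_c s c E). apply Rinv_0_lt_compat.
  unfold R1. apply Rmult_lt_0_compat; lra.
Qed.

Variables (u0 rho0 : fseq).
Hypothesis hu0 : herm u0.
Hypothesis hrho0 : herm rho0.
Hypothesis bu0 : nle (jp s) u0 R0.
Hypothesis brho0 : nle (jp (s - 1)) rho0 R0.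

Let good (n : nat) (z : (R -> fseq) * (R -> fseq)) : Prop :=
  (forall t, supp (range n) (fst z t) /\ supp (range n) (snd z t)) /\
  (fst z 0 = pn n u0 /\ snd z 0 = pn n rho0) /\
  approx_traj s g g' mu (2 * R1) T n (fst z) (snd z) /\
  (forall L N, 0 <= L -> 0 < N -> nle (vw s L N) u0 R1 -> nle (vw (s - 1) L N) rho0 R1 ->
   forall t, 0 <= t <= T -> nle (vw s L N) (fst z t) (2 * R1) /\ nle (vw (s - 1) L N) (snd z t) (2 * R1)).

Lemma galerkin_seq : exists z : nat -> (R -> fseq) * (R -> fseq), forall n, good n (z n).
Proof.
  assert (H : forall n, exists z, good n z).
  { intros n.
    destruct (galerkin s c g g' mu R1 n ltac:(lra) E ltac:(unfold R1; lra) ltac:(unfold R1; lra) ltac:(unfold R1; lra)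
      ltac:(unfold R1; lra) u0 rho0 hu0 hrho0) as (u & rho & H).
    - eapply nle_weak; [exact bu0|unfold R1; lra].
    - eapply nle_weak; [exact brho0|unfold R1; lra].
    - exists (u, rho). exact H. }
  exists (fun n => proj1_sig (constructive_indefinite_description _ (H n))).
  intros n. apply (proj2_sig (constructive_indefinite_description _ (H n))).
Qed.

Lemma galerkin_cauchy z : (forall n, good n (z n)) -> forall eps, 0 < eps ->
  exists n0, forall n n', (n0 <= n)%nat -> (n <= n')%nat -> forall t, 0 <= t <= T ->
    nle (jp s) (fsub (fst (z n) t) (fst (z n') t)) eps /\ nle (jp (s - 1)) (fsub (snd (z n) t) (snd (z n') t)) eps.
Proof.
  intros Hz eps Heps.
  assert (HR1 : 2 <= R1) by (unfold R1; lra).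
  set (L := 2 * (2 * R1 + 2 * R1) / eps). assert (HL : 0 < L) by (apply Rdiv_lt_0_compat; lra).
  destruct (vw_choose s u0 R0 L 1 bu0 ltac:(lra) ltac:(lra)) as [m1 Hm1].
  destruct (vw_choose (s - 1) rho0 R0 L 1 brho0 ltac:(lra) ltac:(lra)) as [m2 Hm2].
  set (m := Nat.max m1 m2). specialize (Hm1 m ltac:(lia)). specialize (Hm2 m ltac:(lia)). fold R1 in Hm1, Hm2.
  assert (HN : 0 < INR (S m)) by (apply lt_0_INR; lia).
  set (K := jp (s - 1/2) (Z.of_nat (S m))). assert (HK : 0 < K) by apply jp_pos.
  set (e := eps / (2 * K)). assert (He : 0 < e) by (apply Rdiv_lt_0_compat; lra).
  set (C := exp (96 * c' * (2 * R1) * T)).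
  assert (Hc' : 1 <= c') by apply (est_c s' c' E'). assert (HT := life_pos).
  assert (HC : 1 <= C).
  { unfold C. rewrite <- exp_0. assert (0 < 96 * c' * (2 * R1) * T).
    { apply Rmult_lt_0_compat; auto. apply Rmult_lt_0_compat; lra. }
    left. now apply exp_increasing. }
  destruct (Rpower_neg_lim (s' - s) (e / (2 * R1 * C))) as [n0 Hn0]; [lra|apply Rdiv_lt_0_compat; auto; apply Rmult_lt_0_compat; lra|].
  exists (Nat.max (S m) n0). intros n n' Hn Hn' t Ht.
  specialize (Hn0 n ltac:(lia)).
  destruct (Hz n) as (_ & [I1 I2] & A1 & W1). destruct (Hz n') as (_ & [J1 J2] & A2 & W2).
  (* Both are compared at the smaller order n, where the finer one also solves the equation. *)
  apply (approx_traj_weaken _ _ _ _ _ _ n n') in A2; auto.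
  assert (Cmp := comparison s s' c' g g' mu mu (2 * R1) T n Hs' (Rlt_le _ _ Hss) E' ltac:(lra)
    ltac:(unfold R1; lra) ltac:(unfold R1; lra) ltac:(unfold R1; lra) ltac:(unfold R1; lra) _ _ _ _ A1 A2 t Ht).
  (* On modes up to n the two truncations of the data coincide, so only the truncation error
     remains. *)
  assert (Z0 : low_en n (fst (z n) 0) (snd (z n) 0) (fst (z n') 0) (snd (z n') 0) = 0).
  { rewrite I1, I2, J1, J2. unfold low_en, en.
    assert (Hp : forall w a, lsum (range n) (fun k => (w k * Cmod (fsub (pn n a) (pn n' a) k)) ^ 2) = 0).
    { intros w a. rewrite <- (lsum_zero (range n)). apply lsum_ext. intros k Hk. unfold fsub.
      rewrite (pn_in n), (pn_in n'); auto; [|rewrite in_range in *; lia].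
      replace (Cminus (a k) (a k)) with (RtoC 0) by ring. rewrite Cmod_0. ring. }
    rewrite !Hp. ring. }
  rewrite Z0, Rminus_diag, Rabs_R0, !Rplus_0_l in Cmp. fold C in Cmp.
  assert (Hx : 0 < Rpower (INR (S n)) (s' - s)) by apply exp_pos.
  assert (Low : low_en (S m) (fst (z n) t) (snd (z n) t) (fst (z n') t) (snd (z n') t) <= e ^ 2).
  { eapply Rle_trans; [apply (low_en_mono (S m) n); lia|]. eapply Rle_trans; [apply Cmp|].
    apply Rle_trans with (C * (tail_err s s' (2 * R1) n) ^ 2).
    - apply Rmult_le_compat_r; [apply pow2_ge_0|]. unfold C.
      destruct (Req_dec t T) as [->|]; [lra|]. left. apply exp_increasing. apply Rmult_lt_compat_l; [|lra].
      apply Rmult_lt_0_compat; lra.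
    - unfold tail_err. set (x := Rpower (INR (S n)) (s' - s)) in *.
      assert (Hy : x * (2 * R1) * C <= e).
      { apply Rle_trans with (e / (2 * R1 * C) * (2 * R1 * C)); [|apply Req_le; field; lra].
        rewrite Rmult_assoc. apply Rmult_le_compat_r; [apply Rmult_le_pos; lra|lra]. }
      assert (0 <= x * (2 * R1)) by (apply Rmult_le_pos; lra).
      assert ((x * (2 * R1) * C) ^ 2 <= e ^ 2) by (apply pow_incr; split; auto; apply Rmult_le_pos; lra).
      assert (C * (x * (2 * R1)) ^ 2 <= C * C * (x * (2 * R1)) ^ 2).
      { apply Rmult_le_compat_r; [apply pow2_ge_0|nra]. }
      nra. }
  destruct (W1 L (INR (S m)) ltac:(lra) HN Hm1 Hm2 t Ht) as [V1 V2].
  destruct (W2 L (INR (S m)) ltac:(lra) HN Hm1 Hm2 t Ht) as [V3 V4].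
  assert (D1 := nle_sub _ _ _ _ _ (vw_pos L (INR (S m)) ltac:(lra) HN s) V1 V3).
  assert (D2 := nle_sub _ _ _ _ _ (vw_pos L (INR (S m)) ltac:(lra) HN (s - 1)) V2 V4).
  apply (strong_of_low_pair s (2 * R1 + 2 * R1) eps m); auto; lra.
Qed.

Lemma finite_contN n r (f : R -> fseq) : (forall t, supp (range n) (f t)) ->
  (forall t k, ccont (fun t => f t k) t) -> contN r T f.
Proof.
  intros Hsp Hc t _ eps Heps.
  assert (C : continuous (fun t' => en (jp r) (range n) (fsub (f t') (f t))) t).
  { apply (en_cont _ _ (fun t' => fsub (f t') (f t))). intros k _. unfold fsub. apply ccont_minus; auto.
    split; apply continuous_const. }
  destruct (proj1 (cont_eps _ _) C (eps ^ 2)) as (d & Hd & HH); [apply pow_lt; auto|].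
  exists d. split; auto. intros t' _ Ht'. specialize (HH t' Ht').
  assert (Z0 : en (jp r) (range n) (fsub (f t) (f t)) = 0).
  { unfold en. rewrite <- (lsum_zero (range n)). apply lsum_ext. intros k _. unfold fsub.
    replace (Cminus (f t k) (f t k)) with (RtoC 0) by ring. rewrite Cmod_0. ring. }
  rewrite Z0, Rminus_0_r in HH.
  apply nle_of_en with (range n); auto using range_NoDup; [|lra|].
  - intros k Hk. unfold fsub. rewrite !Hsp by auto. ring.
  - left. eapply Rle_lt_trans; [apply Rle_abs|apply HH].
Qed.

Lemma contN_lim r (a : nat -> R -> fseq) (b : R -> fseq) :
  (forall n, contN r T (a n)) ->
  (forall eps, 0 < eps -> exists n0, forall n, (n0 <= n)%nat -> forall t, 0 <= t <= T ->
    nle (jp r) (fsub (a n t) (b t)) eps) -> contN r T b.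
Proof.
  intros Ha H t Ht eps Heps. destruct (H (eps / 3)) as [n Hn]; [lra|].
  specialize (Hn n (Nat.le_refl n)).
  destruct (Ha n t Ht (eps / 3)) as (d & Hd & HH); [lra|]. exists d. split; auto.
  intros t' Ht' Hd'. replace eps with (eps / 3 + eps / 3 + eps / 3) by field.
  apply nle_sub_trans with (a n t); auto using jp_pos.
  apply nle_sub_trans with (a n t'); auto using jp_pos. apply nle_sub_sym. auto.
Qed.

(* The difference quotients of the limit are controlled by those of the approximations through [vector_mvt]. *)
Lemma derN_lim r (a Fa : nat -> R -> fseq) (b Fb : R -> fseq) :
  (forall n t k, ccont (fun t => a n t k) t) ->
  (forall t, 0 <= t <= T -> coef_lim (fun n => a n t) (b t)) ->
  (forall n t k, 0 < t < T -> In k (range n) -> cder (fun t => a n t k) t (Fa n t k)) ->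
  (forall eps, 0 < eps -> exists n0, forall n, (n0 <= n)%nat -> forall t, 0 <= t <= T ->
    nle (jp r) (fsub (Fa n t) (Fb t)) eps) -> contN r T Fb -> derN r T b Fb.
Proof.
  intros Hc Hl Hd HF HC t Ht eps Heps.
  destruct (HC t Ht (eps / 2)) as (d & Hd0 & HH); [lra|].
  destruct (HF (eps / 2)) as [n0 Hn0]; [lra|].
  assert (Main : forall x y, 0 <= x -> x < y -> y <= T -> Rabs (x - t) < d -> Rabs (y - t) < d ->
    nle (jp r) (fsub (fscal (/ (y - x)) (fsub (b y) (b x))) (Fb t)) eps).
  { intros x y Hx Hxy Hy Hxd Hyd. split; [lra|]. intros l Hnl.
    destruct (incl_range l) as [n1 Hn1].
    assert (CL : coef_lim (fun n => fsub (fscal (/ (y - x)) (fsub (a n y) (a n x))) (Fb t))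
      (fsub (fscal (/ (y - x)) (fsub (b y) (b x))) (Fb t))).
    { apply coef_lim_sub; [|apply coef_lim_const]. apply coef_lim_scal. apply coef_lim_sub; apply Hl; lra. }
    apply (is_lim_seq_le_loc (fun n => lsum l (fun k => (jp r k * Cmod (fsub (fscal (/ (y - x)) (fsub (a n y) (a n x))) (Fb t) k)) ^ 2))
      (fun _ => eps ^ 2) (lsum l (fun k => (jp r k * Cmod (fsub (fscal (/ (y - x)) (fsub (b y) (b x))) (Fb t) k)) ^ 2)) (eps ^ 2));
      [|now apply coef_lim_lsum|apply is_lim_seq_const].
    exists (Nat.max n0 n1). intros n Hn.
    apply (vector_mvt (jp r) l (a n) (Fa n) (Fb t) x y eps Hxy); auto; [lra| |].
    - intros t1 k Ht1 Hk. apply Hd; [lra|]. apply Hn1 in Hk. rewrite in_range in *. lia.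
    - intros t1 Ht1. assert (N : nle (jp r) (fsub (Fa n t1) (Fb t)) (eps / 2 + eps / 2)).
      { apply nle_sub_trans with (Fb t1); auto using jp_pos.
        - apply Hn0; [lia|lra].
        - apply HH; [lra|]. revert Hxd Hyd. unfold Rabs. repeat destruct Rcase_abs; lra. }
      replace (eps / 2 + eps / 2) with eps in N by field. now apply N. }
  exists d. split; auto. intros h Hh Hth Hhd.
  assert (H1 : Rabs (t - t) < d) by (rewrite Rminus_diag, Rabs_R0; auto).
  assert (H2 : Rabs (t + h - t) < d) by (replace (t + h - t) with h by ring; auto).
  (* The difference quotient is symmetric in its endpoints, so the ordered pair covers both
     signs. *)
  destruct (Rdichotomy h 0 Hh) as [Hneg|Hpos].
  - specialize (Main (t + h) t ltac:(lra) ltac:(lra) ltac:(lra) H2 H1).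
    apply nle_ext with (2 := Main). intros k. unfold fsub, fscal.
    replace (t - (t + h)) with (- h) by ring. rewrite Rinv_opp, RtoC_opp. ring.
  - specialize (Main t (t + h) ltac:(lra) ltac:(lra) ltac:(lra) H1 H2).
    replace (t + h - t) with h in Main by ring. exact Main.
Qed.

(** The weighted bounds are kept in the conclusion because [local_dependence] needs the tails of
    nearby solutions uniformly. *)
Theorem local_existence : exists u rho, Sol s g g' mu T u rho /\ u 0 = u0 /\ rho 0 = rho0 /\
  (forall L N, 0 <= L -> 0 < N -> nle (vw s L N) u0 R1 -> nle (vw (s - 1) L N) rho0 R1 ->
   forall t, 0 <= t <= T -> nle (vw s L N) (u t) (2 * R1) /\ nle (vw (s - 1) L N) (rho t) (2 * R1)).
Proof.
  destruct galerkin_seq as [z Hz]. assert (HT := life_pos).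
  assert (Hc := est_c s c E). assert (HR1 : 2 <= R1) by (unfold R1; lra).
  destruct (uniform_limit (jp s) (fun n => fst (z n)) T (jp_pos s)) as (u & Lu & Uu).
  { intros eps Heps. destruct (galerkin_cauchy z Hz eps Heps) as [n0 Hn]. exists n0. intros. now apply Hn. }
  destruct (uniform_limit (jp (s - 1)) (fun n => snd (z n)) T (jp_pos (s - 1))) as (rho & Lr & Ur).
  { intros eps Heps. destruct (galerkin_cauchy z Hz eps Heps) as [n0 Hn]. exists n0. intros. now apply Hn. }
  assert (WB : forall L N, 0 <= L -> 0 < N -> nle (vw s L N) u0 R1 -> nle (vw (s - 1) L N) rho0 R1 ->
   forall t, 0 <= t <= T -> nle (vw s L N) (u t) (2 * R1) /\ nle (vw (s - 1) L N) (rho t) (2 * R1)).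
  { intros L N HL HN H1 H2 t Ht. split.
    - apply (nle_lim _ (fun n => fst (z n) t) _ _ 0 (Lu t Ht)). intros n _. now apply (proj2 (proj2 (proj2 (Hz n))) L N).
    - apply (nle_lim _ (fun n => snd (z n) t) _ _ 0 (Lr t Ht)). intros n _. now apply (proj2 (proj2 (proj2 (Hz n))) L N). }
  assert (Bz : forall t, 0 <= t <= T -> nle (jp s) (u t) (2 * R1) /\ nle (jp (s - 1)) (rho t) (2 * R1)).
  { intros t Ht. specialize (WB 0 1 (Rle_refl 0) Rlt_0_1). rewrite !vw0 in WB. apply WB; auto.
    - eapply nle_weak; [exact bu0|unfold R1; lra].
    - eapply nle_weak; [exact brho0|unfold R1; lra]. }
  assert (Tr : forall n, approx_traj s g g' mu (2 * R1) T n (fst (z n)) (snd (z n))) by (intros; apply (Hz n)).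
  assert (Cu : contN s T u).
  { apply contN_lim with (fun n => fst (z n)); auto. intros n. apply finite_contN with n.
    - intros; apply (Hz n).
    - apply (Tr n). }
  assert (Cr : contN (s - 1) T rho).
  { apply contN_lim with (fun n => snd (z n)); auto. intros n. apply finite_contN with n.
    - intros; apply (Hz n).
    - apply (Tr n). }
  assert (HM : 0 < 12 * c * (2 * R1)) by (apply Rmult_lt_0_compat; lra).
  set (M := 12 * c * (2 * R1)) in *.
  assert (Pd : forall e, 0 < e -> 0 < e / M) by (intros; apply Rdiv_lt_0_compat; auto).
  assert (CF : contN (s - 1) T (fun t => Fu g mu (u t) (rho t)) /\ contN (s - 2) T (fun t => Fr g' (u t) (rho t))).
  { apply (contN_F s c g g' mu (2 * R1)); auto; unfold R1; lra. }
  assert (UF : forall eps, 0 < eps -> exists n0, forall n, (n0 <= n)%nat -> forall t, 0 <= t <= T ->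
     nle (jp (s - 1)) (fsub (Fu g mu (fst (z n) t) (snd (z n) t)) (Fu g mu (u t) (rho t))) eps /\
     nle (jp (s - 2)) (fsub (Fr g' (fst (z n) t) (snd (z n) t)) (Fr g' (u t) (rho t))) eps).
  { intros eps Heps. destruct (Uu (eps / M) (Pd _ Heps)) as [n1 H1]. destruct (Ur (eps / M) (Pd _ Heps)) as [n2 H2].
    exists (Nat.max n1 n2). intros n Hn t Ht. specialize (H1 n ltac:(lia) t Ht). specialize (H2 n ltac:(lia) t Ht).
    split; [replace eps with (M * (eps / M + 0)) by (field; lra); apply Lip_Fu
           |replace eps with (M * (eps / M)) by (field; lra); apply Lip_Fr]; auto; try (now apply Bz);
      try (now apply (Tr n)); try (unfold R1; lra).
    rewrite Rminus_diag, Rabs_R0; lra. }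
  exists u, rho. split; [split|split; [|split]]; auto.
  - intros t Ht. apply (herm_lim _ _ (Lu t Ht)). intros n. now apply (Tr n).
  - intros t Ht. apply (herm_lim _ _ (Lr t Ht)). intros n. now apply (Tr n).
  - intros t Ht. exists (2 * R1). now apply Bz.
  - intros t Ht. exists (2 * R1). now apply Bz.
  - apply (derN_lim (s - 1) (fun n => fst (z n)) (fun n t => Fu g mu (fst (z n) t) (snd (z n) t))); auto; try apply CF.
    + intros n. exact (tr_cont_u _ _ _ _ _ _ _ _ _ (Tr n)).
    + intros n t k Ht Hk. exact (tr_der_u _ _ _ _ _ _ _ _ _ (Tr n) t k Ht Hk).
    + intros eps Heps. destruct (UF eps Heps) as [n0 Hn]. exists n0. intros; now apply Hn.
  - apply (derN_lim (s - 2) (fun n => snd (z n)) (fun n t => Fr g' (fst (z n) t) (snd (z n) t))); auto; try apply CF.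
    + intros n. exact (tr_cont_rho _ _ _ _ _ _ _ _ _ (Tr n)).
    + intros n t k Ht Hk. exact (tr_der_rho _ _ _ _ _ _ _ _ _ (Tr n) t k Ht Hk).
    + intros eps Heps. destruct (UF eps Heps) as [n0 Hn]. exists n0. intros; now apply Hn.
  (* Mode k of the truncated data is exact as soon as the order reaches |k|. *)
  - apply (coef_lim_eventually _ _ _ (Lu 0 ltac:(lra))). intros k. exists (Z.to_nat (Z.abs k)). intros m Hm.
    rewrite (proj1 (proj1 (proj2 (Hz m)))). apply pn_in, in_range. lia.
  - apply (coef_lim_eventually _ _ _ (Lr 0 ltac:(lra))). intros k. exists (Z.to_nat (Z.abs k)). intros m Hm.
    rewrite (proj2 (proj1 (proj2 (Hz m)))). apply pn_in, in_range. lia.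
Qed.

End LocalExistence.

(** * Uniqueness and local continuous dependence *)

Lemma nle_near w a b A e : (forall k, 0 < w k) -> nle w a A -> nle w (fsub b a) e -> nle w b (A + e).
Proof.
  intros Hw HA He. apply nle_ext with (fadd a (fsub b a)); [|now apply nle_add].
  intros k. unfold fadd, fsub. ring.
Qed.

(** Compactness of [0, T], by continuous induction on the right endpoint. *)
Lemma contN_bounded r T f : contN r T f -> (forall t, 0 <= t <= T -> exists B, nle (jp r) (f t) B) ->
  0 <= T -> exists B, forall t, 0 <= t <= T -> nle (jp r) (f t) B.
Proof.
  intros Hc Hb HT.
  assert (P : forall x, 0 <= x <= T -> exists B, forall t, 0 <= t <= x -> nle (jp r) (f t) B).
  { apply (cont_induction T).
    - intros x Hx IH. destruct (Hb x Hx) as [B HB].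
      destruct (Hc x Hx 1 Rlt_0_1) as (d & Hd & HH).
      destruct (Req_dec x 0) as [->|Hx0].
      { exists B. intros t Ht. replace t with 0 by lra. auto. }
      set (y := Rmax 0 (x - d / 2)). assert (Hy : 0 <= y < x) by (unfold y; split; [apply Rmax_l|apply Rmax_lub_lt; lra]).
      assert (Hy2 : x - d / 2 <= y) by apply Rmax_r.
      destruct (IH y Hy) as [B' HB']. exists (Rmax B' (B + 1)). intros t Ht.
      destruct (Rle_dec t y).
      + eapply nle_weak; [apply HB'; lra|apply Rmax_l].
      + eapply nle_weak; [|apply Rmax_r]. apply nle_near with (f x); auto using jp_pos.
        apply HH; [lra|]. rewrite Rabs_left1; lra.
    - intros x Hx IH. destruct (IH x ltac:(lra)) as [B HB].
      destruct (Hc x ltac:(lra) 1 Rlt_0_1) as (d & Hd & HH).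
      exists d. split; auto. intros y Hy HyT. exists (B + 1). intros t Ht.
      destruct (Rle_dec t x).
      + eapply nle_weak; [apply HB; lra|lra].
      + apply nle_near with (f x); auto using jp_pos; [apply HB; lra|].
        apply HH; [lra|]. rewrite Rabs_pos_eq; lra. }
  apply P. lra.
Qed.

Lemma sol_bounded s g g' mu T u rho : 0 <= T -> Sol s g g' mu T u rho ->
  exists B, forall t, 0 <= t <= T -> nle (jp s) (u t) B /\ nle (jp (s - 1)) (rho t) B.
Proof.
  intros HT H.
  destruct (contN_bounded s T u (sol_cont_u _ _ _ _ _ _ _ H) (sol_u _ _ _ _ _ _ _ H) HT) as [B1 H1].
  destruct (contN_bounded (s - 1) T rho (sol_cont_rho _ _ _ _ _ _ _ H) (sol_rho _ _ _ _ _ _ _ H) HT) as [B2 H2].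
  exists (Rmax B1 B2). intros t Ht. split.
  - eapply nle_weak; [now apply H1|apply Rmax_l].
  - eapply nle_weak; [now apply H2|apply Rmax_r].
Qed.

(* Constant extension outside [0,T], to have two-sided continuity at the endpoints. *)
Definition clamp (T t : R) : R := Rmax 0 (Rmin T t).

Lemma clamp_in T t : 0 <= T -> 0 <= clamp T t <= T.
Proof. intros. unfold clamp. split; [apply Rmax_l|]. apply Rmax_lub; auto. apply Rmin_l. Qed.
Lemma clamp_id T t : 0 <= t <= T -> clamp T t = t.
Proof. intros. unfold clamp. rewrite Rmin_right, Rmax_right; lra. Qed.
Lemma clamp_lip T t t' : Rabs (clamp T t' - clamp T t) <= Rabs (t' - t).
Proof. unfold clamp, Rmax, Rmin. repeat destruct Rle_dec; unfold Rabs; repeat destruct Rcase_abs; lra. Qed.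

Lemma contN_ccont r T f k t : 0 <= T -> contN r T f -> ccont (fun t => f (clamp T t) k) t.
Proof.
  intros HT Hc.
  assert (H : forall eps, 0 < eps -> exists d, 0 < d /\ forall t', Rabs (t' - t) < d ->
    Cmod (Cminus (f (clamp T t') k) (f (clamp T t) k)) < eps).
  { intros eps Heps. assert (Hw := jp_pos r k).
    destruct (Hc (clamp T t) (clamp_in T t HT) (eps * jp r k / 2)) as (d & Hd & HH).
    { apply Rdiv_lt_0_compat; [now apply Rmult_lt_0_compat|lra]. }
    exists d. split; auto. intros t' Ht'.
    specialize (HH (clamp T t') (clamp_in T t' HT) (Rle_lt_trans _ _ _ (clamp_lip T t t') Ht')).
    generalize (nle_coef _ _ _ k HH Hw). unfold fsub. intros.
    apply Rmult_lt_reg_l with (jp r k); auto. assert (0 < eps * jp r k) by now apply Rmult_lt_0_compat. lra. }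
  split; apply cont_eps; intros eps Heps; destruct (H eps Heps) as (d & Hd & HH); exists d; (split; [auto|]);
    intros t' Ht'; eapply Rle_lt_trans; try apply (HH t' Ht').
  - apply (Re_le_Cmod (Cminus (f (clamp T t') k) (f (clamp T t) k))).
  - apply (Im_le_Cmod (Cminus (f (clamp T t') k) (f (clamp T t) k))).
Qed.

Lemma derN_cder r T f f' k t : 0 < t < T -> derN r T f f' -> cder (fun t => f (clamp T t) k) t (f' t k).
Proof.
  intros Ht Hd.
  assert (H : forall eps, 0 < eps -> exists d : posreal, forall h, h <> 0 -> Rabs h < d ->
    Cmod (Cminus (Cmult (RtoC (/ h)) (Cminus (f (clamp T (t + h)) k) (f (clamp T t) k))) (f' t k)) < eps).
  { intros eps Heps. assert (Hw := jp_pos r k).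
    destruct (Hd t ltac:(lra) (eps * jp r k / 2)) as (d & Hd0 & HH).
    { apply Rdiv_lt_0_compat; [now apply Rmult_lt_0_compat|lra]. }
    assert (Hdd : 0 < Rmin d (Rmin t (T - t))) by (repeat apply Rmin_glb_lt; lra).
    exists (mkposreal _ Hdd). intros h Hh Hhd. simpl in Hhd.
    assert (B1 := Rmin_l d (Rmin t (T - t))). assert (B2 := Rmin_r d (Rmin t (T - t))).
    assert (B3 := Rmin_l t (T - t)). assert (B4 := Rmin_r t (T - t)).
    assert (B5 := Rle_abs h). assert (B6 := Rle_abs (- h)). rewrite Rabs_Ropp in B6.
    rewrite !clamp_id by lra.
    specialize (HH h Hh ltac:(lra) ltac:(lra)).
    generalize (nle_coef _ _ _ k HH Hw). unfold fsub, fscal. intros.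
    apply Rmult_lt_reg_l with (jp r k); auto. assert (0 < eps * jp r k) by now apply Rmult_lt_0_compat. lra. }
  split; apply is_derive_Reals; intros eps Heps; destruct (H eps Heps) as [d HH]; exists d; intros h Hh Hhd;
    eapply Rle_lt_trans; try apply (HH h Hh Hhd).
  - eapply Rle_trans; [|apply Re_le_Cmod]. apply Req_le. f_equal.
    unfold Cminus, Cplus, Copp, Cmult, RtoC, Re; simpl. field. auto.
  - eapply Rle_trans; [|apply Im_le_Cmod]. apply Req_le. f_equal.
    unfold Cminus, Cplus, Copp, Cmult, RtoC, Im; simpl. field. auto.
Qed.

Lemma sol_traj s g g' mu R0 T n u rho : 0 <= T -> Sol s g g' mu T u rho ->
  (forall t, 0 <= t <= T -> nle (jp s) (u t) R0 /\ nle (jp (s - 1)) (rho t) R0) ->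
  approx_traj s g g' mu R0 T n (fun t => u (clamp T t)) (fun t => rho (clamp T t)).
Proof.
  intros HT H HB. split.
  - intros t Ht. apply H. now apply clamp_in.
  - intros t Ht. apply H. now apply clamp_in.
  - intros t Ht. apply HB. now apply clamp_in.
  - intros t Ht. apply HB. now apply clamp_in.
  - intros t k. apply (contN_ccont s T u k t HT (sol_cont_u _ _ _ _ _ _ _ H)).
  - intros t k. apply (contN_ccont (s - 1) T rho k t HT (sol_cont_rho _ _ _ _ _ _ _ H)).
  - intros t k Ht _. rewrite (clamp_id T t) by lra.
    exact (derN_cder (s - 1) T u _ k t Ht (sol_der_u _ _ _ _ _ _ _ H)).
  - intros t k Ht _. rewrite (clamp_id T t) by lra.
    exact (derN_cder (s - 2) T rho _ k t Ht (sol_der_rho _ _ _ _ _ _ _ H)).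
Qed.

Section Comparison.
Variables (s s' c' g g' : R).
Hypothesis Hs' : 3 / 2 < s'.
Hypothesis Hss : s' < s.
Hypothesis E' : estimates s' c'.

(** Exact solutions are approximate trajectories of every order: with m fixed, the order n of the
    comparison grows until the truncation error is negligible. *)
Lemma sol_comparison mu mu' R0 T u rho v sg d0 m t :
  1 <= R0 -> Rabs g <= R0 -> Rabs g' <= R0 -> Rabs mu <= R0 -> Rabs mu' <= R0 ->
  Sol s g g' mu T u rho -> Sol s g g' mu' T v sg ->
  (forall t, 0 <= t <= T -> nle (jp s) (u t) R0 /\ nle (jp (s - 1)) (rho t) R0) ->
  (forall t, 0 <= t <= T -> nle (jp s) (v t) R0 /\ nle (jp (s - 1)) (sg t) R0) ->
  nle (jp (1/2)) (fsub (u 0) (v 0)) d0 -> nle (jp (-(1/2))) (fsub (rho 0) (sg 0)) d0 ->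
  0 <= t <= T ->
  low_en m (u t) (rho t) (v t) (sg t) <= exp (96 * c' * R0 * T) * (2 * d0 ^ 2 + 2 * Rabs (mu - mu') ^ 2).
Proof.
  intros HR Hg Hg' Hmu Hmu' H H' HB HB' D1 D2 Ht.
  assert (HT : 0 <= T) by lra. assert (Hc' := est_c s' c' E').
  set (C := exp (96 * c' * R0 * T)). assert (HC : 0 < C) by apply exp_pos.
  apply le_epsilon. intros eps Heps.
  (* The cap at 1 gives eta^2 <= eta <= eps / (2 C). *)
  set (eta := Rmin 1 (eps / (2 * C))).
  assert (Heta : 0 < eta) by (apply Rmin_glb_lt; [lra|apply Rdiv_lt_0_compat; lra]).
  destruct (Rpower_neg_lim (s' - s) (eta / R0)) as [n0 Hn0]; [lra|apply Rdiv_lt_0_compat; lra|].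
  set (n := Nat.max m n0). specialize (Hn0 n ltac:(lia)).
  assert (Cmp := comparison s s' c' g g' mu mu' R0 T n Hs' (Rlt_le _ _ Hss) E' HR Hg Hg' Hmu Hmu' _ _ _ _
    (sol_traj s g g' mu R0 T n u rho HT H HB) (sol_traj s g g' mu' R0 T n v sg HT H' HB') t Ht).
  cbv beta in Cmp. rewrite (clamp_id T t), (clamp_id T 0) in Cmp by lra.
  eapply Rle_trans; [apply (low_en_mono m n); lia|]. eapply Rle_trans; [apply Cmp|].
  assert (L0 : low_en n (u 0) (rho 0) (v 0) (sg 0) <= 2 * d0 ^ 2).
  { unfold low_en. generalize (en_of_nle _ (range n) _ _ (range_NoDup n) D1) (en_of_nle _ (range n) _ _ (range_NoDup n) D2). lra. }
  assert (Te : 0 <= tail_err s s' R0 n <= eta).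
  { split; [apply tail_err_pos; lra|]. unfold tail_err.
    apply Rle_trans with (eta / R0 * R0); [apply Rmult_le_compat_r; lra|apply Req_le; field; lra]. }
  set (a := Rabs (mu - mu')) in *. assert (Ha : 0 <= a) by apply Rabs_pos.
  assert (L00 : 0 <= low_en n (u 0) (rho 0) (v 0) (sg 0)) by (apply Rplus_le_le_0_compat; apply en_pos).
  set (te := tail_err s s' R0 n) in *.
  assert (Q : (a + te) ^ 2 <= 2 * a ^ 2 + 2 * eta ^ 2).
  { generalize (pow2_ge_0 (a - te)). assert (te ^ 2 <= eta ^ 2) by (apply pow_incr; lra). nra. }
  assert (Q2 : eta ^ 2 <= eps / (2 * C)).
  { assert (eta <= 1) by apply Rmin_l. assert (eta <= eps / (2 * C)) by apply Rmin_r. nra. }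
  assert (HCt : exp (96 * c' * R0 * t) <= C).
  { unfold C. destruct (Req_dec t T) as [->|]; [lra|]. left. apply exp_increasing. apply Rmult_lt_compat_l; [|lra].
    apply Rmult_lt_0_compat; lra. }
  apply Rle_trans with (C * (2 * d0 ^ 2 + 2 * a ^ 2 + 2 * (eps / (2 * C)))).
  - apply Rmult_le_compat; auto; try lra; [left; apply exp_pos|].
    generalize (pow2_ge_0 (a + te)). lra.
  - apply Req_le. field. lra.
Qed.

Lemma low_en_zero u rho v sg : (forall m, low_en m u rho v sg <= 0) -> u = v /\ rho = sg.
Proof.
  intros H.
  assert (G : forall w a b, (forall k, 0 < w k) -> (forall m, en w (range m) (fsub a b) <= 0) -> a = b).
  { intros w a b Hw He. apply functional_extensionality. intros k.
    specialize (He (Z.to_nat (Z.abs k))).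
    assert (N : nle w (fsub (pn (Z.to_nat (Z.abs k)) a) (pn (Z.to_nat (Z.abs k)) b)) 0).
    { apply nle_of_en with (range (Z.to_nat (Z.abs k))); auto using range_NoDup; try lra.
      - intros j Hj. unfold fsub. rewrite !pn_supp by auto. ring.
      - rewrite pow_i by lia. eapply Rle_trans; [|exact He]. apply Req_le, lsum_ext. intros j Hj. unfold fsub. now rewrite !pn_in. }
    assert (N2 := nle_coef _ _ _ k N (Hw k)). unfold fsub in N2. rewrite !pn_in in N2 by (apply in_range; lia).
    assert (Z0 : Cmod (Cminus (a k) (b k)) = 0).
    { generalize (Cmod_ge_0 (Cminus (a k) (b k))) (Hw k). nra. }
    apply Cmod_eq_0 in Z0. replace (a k) with (Cplus (Cminus (a k) (b k)) (b k)) by ring. rewrite Z0. ring. }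
  split.
  - apply (G (jp (1/2)) u v (jp_pos _)). intros m. generalize (H m) (en_pos (jp (-(1/2))) (range m) (fsub rho sg)). unfold low_en. lra.
  - apply (G (jp (-(1/2))) rho sg (jp_pos _)). intros m. generalize (H m) (en_pos (jp (1/2)) (range m) (fsub u v)). unfold low_en. lra.
Qed.

Lemma sol_unique mu T u rho v sg : Sol s g g' mu T u rho -> Sol s g g' mu T v sg ->
  u 0 = v 0 -> rho 0 = sg 0 -> forall t, 0 <= t <= T -> u t = v t /\ rho t = sg t.
Proof.
  intros H H' E1 E2 t Ht.
  assert (HT : 0 <= T) by lra.
  destruct (sol_bounded _ _ _ _ _ _ _ HT H) as [B1 HB1].
  destruct (sol_bounded _ _ _ _ _ _ _ HT H') as [B2 HB2].
  set (R0 := 1 + Rabs g + Rabs g' + Rabs mu + Rmax 0 B1 + Rmax 0 B2).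
  assert (P1 := Rabs_pos g). assert (P2 := Rabs_pos g'). assert (P3 := Rabs_pos mu).
  assert (P4 := Rmax_l 0 B1). assert (P5 := Rmax_r 0 B1). assert (P6 := Rmax_l 0 B2). assert (P7 := Rmax_r 0 B2).
  apply low_en_zero. intros m.
  eapply Rle_trans; [apply (sol_comparison mu mu R0 T u rho v sg 0 m t); auto; try (unfold R0; lra)|].
  - intros x Hx. destruct (HB1 x Hx) as [N1 N2]. split; eapply nle_weak; eauto; unfold R0; lra.
  - intros x Hx. destruct (HB2 x Hx) as [N1 N2]. split; eapply nle_weak; eauto; unfold R0; lra.
  - rewrite E1. apply nle_refl_diff, jp_pos.
  - rewrite E2. apply nle_refl_diff, jp_pos.
  - rewrite Rminus_diag, Rabs_R0. apply Req_le. ring.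
Qed.

Variable c : R.
Hypothesis E : estimates s c.

Lemma nle_vw q L N a B : 0 <= L -> 0 < N -> nle (jp q) a B -> nle (vw q L N) a ((1 + L) * B).
Proof.
  intros HL HN. apply nle_le; [lra|now apply vw_pos|].
  intros k. unfold vw. generalize (mw_le L N HL HN k) (jp_pos q k) (Cmod_ge_0 (a k)) (mw_ge1 L N HL HN k). intros.
  assert (0 <= jp q k * Cmod (a k)) by (apply Rmult_le_pos; lra). nra.
Qed.

(** L and N are fixed from the reference solution; nearby data inherit its weighted bound, so both
    tails are small and the low-norm comparison decides the rest. *)
Lemma local_dependence mu R0 u rho : 1 <= R0 -> Rabs g <= R0 -> Rabs g' <= R0 -> Rabs mu <= R0 ->
  let T := life c (R0 + 1) in
  Sol s g g' mu T u rho -> nle (jp s) (u 0) R0 -> nle (jp (s - 1)) (rho 0) R0 ->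
  forall eps, 0 < eps -> exists d, 0 < d /\ forall mu' v sg, Rabs mu' <= R0 -> Sol s g g' mu' T v sg ->
    nle (jp s) (v 0) R0 -> nle (jp (s - 1)) (sg 0) R0 ->
    Rabs (mu' - mu) <= d -> nle (jp s) (fsub (v 0) (u 0)) d -> nle (jp (s - 1)) (fsub (sg 0) (rho 0)) d ->
    forall t, 0 <= t <= T -> nle (jp s) (fsub (v t) (u t)) eps /\ nle (jp (s - 1)) (fsub (sg t) (rho t)) eps.
Proof.
  intros HR Hg Hg' Hmu T H N1 N2 eps Heps. set (R1 := R0 + 1) in *.
  assert (HR1 : 2 <= R1) by (unfold R1; lra).
  assert (HT : 0 < T) by (apply (life_pos s c R0 E HR)).
  set (L := 2 * (2 * R1 + 2 * R1) / eps). assert (HL : 0 < L) by (apply Rdiv_lt_0_compat; lra).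
  (* Only half of the unit between R0 and R1 is used here; the other half is for the
     perturbation. *)
  destruct (vw_choose s _ R0 L (1/2) N1 ltac:(lra) ltac:(lra)) as [m1 Hm1].
  destruct (vw_choose (s - 1) _ R0 L (1/2) N2 ltac:(lra) ltac:(lra)) as [m2 Hm2].
  set (m := Nat.max m1 m2). specialize (Hm1 m ltac:(lia)). specialize (Hm2 m ltac:(lia)).
  assert (HN : 0 < INR (S m)) by (apply lt_0_INR; lia).
  set (K := jp (s - 1/2) (Z.of_nat (S m))). assert (HK : 0 < K) by apply jp_pos.
  set (e := eps / (2 * K)). assert (He : 0 < e) by (apply Rdiv_lt_0_compat; lra).
  set (C := exp (96 * c' * (2 * R1) * T)). assert (HC : 0 < C) by apply exp_pos.
  set (d1 := Rmin 1 (e ^ 2 / (4 * C))).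
  assert (Hd1 : 0 < d1) by (apply Rmin_glb_lt; [lra|apply Rdiv_lt_0_compat; [now apply pow_lt|lra]]).
  (* The factor [mw] is at most 1 + L, so a perturbation of size d2 costs at most 1/2 in the
     weighted norm. *)
  set (d2 := / (2 * (1 + L))). assert (Hd2 : 0 < d2) by (apply Rinv_0_lt_compat; lra).
  exists (Rmin d1 d2). split; [now apply Rmin_glb_lt|].
  intros mu' v sg Hmu' H' N3 N4 Dmu D1 D2.
  (* Uniqueness transfers the weighted bounds of the constructed solution to any solution with the
     same data. *)
  assert (Bd : forall mu' v sg, Rabs mu' <= R0 -> Sol s g g' mu' T v sg ->
    nle (jp s) (v 0) R0 -> nle (jp (s - 1)) (sg 0) R0 ->
    forall L N, 0 <= L -> 0 < N -> nle (vw s L N) (v 0) R1 -> nle (vw (s - 1) L N) (sg 0) R1 ->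
    forall t, 0 <= t <= T -> nle (vw s L N) (v t) (2 * R1) /\ nle (vw (s - 1) L N) (sg t) (2 * R1)).
  { clear - HR Hg Hg' Hs' Hss E E' HT. intros mu v sg Hmu H N1 N2 L N HL HN W1 W2 t Ht.
    destruct (local_existence s s' c c' g g' mu R0 Hs' Hss E E' HR Hg Hg' Hmu (v 0) (sg 0)) as (u & rho & HS & I1 & I2 & HW); auto.
    - apply H. lra.
    - apply H. lra.
    - destruct (sol_unique mu T v sg u rho H HS ltac:(auto) ltac:(auto) t Ht) as [-> ->]. now apply HW. }
  assert (HLm : 0 <= L) by lra.
  assert (W1 : nle (vw s L (INR (S m))) (u 0) R1) by (eapply nle_weak; [apply Hm1|unfold R1; lra]).
  assert (W2 : nle (vw (s - 1) L (INR (S m))) (rho 0) R1) by (eapply nle_weak; [apply Hm2|unfold R1; lra]).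
  assert (Hdd2 : (1 + L) * Rmin d1 d2 <= 1 / 2).
  { apply Rle_trans with ((1 + L) * d2); [apply Rmult_le_compat_l; [lra|apply Rmin_r]|]. unfold d2. apply Req_le. field. lra. }
  assert (W3 : nle (vw s L (INR (S m))) (v 0) R1).
  { eapply nle_weak; [apply (nle_near _ (u 0) (v 0) _ _ (vw_pos L _ HLm HN s) Hm1 (nle_vw _ _ _ _ _ HLm HN D1))|unfold R1; lra]. }
  assert (W4 : nle (vw (s - 1) L (INR (S m))) (sg 0) R1).
  { eapply nle_weak; [apply (nle_near _ (rho 0) (sg 0) _ _ (vw_pos L _ HLm HN (s - 1)) Hm2 (nle_vw _ _ _ _ _ HLm HN D2))|unfold R1; lra]. }
  assert (Bs : forall mu' v sg, Rabs mu' <= R0 -> Sol s g g' mu' T v sg ->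
    nle (jp s) (v 0) R0 -> nle (jp (s - 1)) (sg 0) R0 ->
    forall t, 0 <= t <= T -> nle (jp s) (v t) (2 * R1) /\ nle (jp (s - 1)) (sg t) (2 * R1)).
  { intros mu1 v1 sg1 Q1 Q2 Q3 Q4 t Ht. specialize (Bd mu1 v1 sg1 Q1 Q2 Q3 Q4 0 1 (Rle_refl 0) Rlt_0_1).
    rewrite !vw0 in Bd. apply Bd; auto; eapply nle_weak; eauto; unfold R1; lra. }
  intros t Ht.
  assert (Cmp := sol_comparison mu' mu (2 * R1) T v sg u rho (Rmin d1 d2) (S m) t
    ltac:(lra) ltac:(unfold R1; lra) ltac:(unfold R1; lra) ltac:(unfold R1; lra) ltac:(unfold R1; lra)
    H' H (Bs _ _ _ Hmu' H' N3 N4) (Bs _ _ _ Hmu H N1 N2)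
    (nle_jp_le (1/2) s _ _ ltac:(lra) D1) (nle_jp_le (-(1/2)) (s - 1) _ _ ltac:(lra) D2) Ht).
  fold C in Cmp.
  assert (Low : low_en (S m) (v t) (sg t) (u t) (rho t) <= e ^ 2).
  { eapply Rle_trans; [apply Cmp|].
    assert (Hm0 : 0 < Rmin d1 d2) by now apply Rmin_glb_lt.
    assert (Q1 : Rmin d1 d2 ^ 2 <= e ^ 2 / (4 * C)).
    { assert (Rmin d1 d2 <= d1) by apply Rmin_l. assert (d1 <= 1) by apply Rmin_l. assert (d1 <= e ^ 2 / (4 * C)) by apply Rmin_r. nra. }
    assert (Q2 : Rabs (mu' - mu) ^ 2 <= Rmin d1 d2 ^ 2) by (apply pow_incr; split; [apply Rabs_pos|auto]).
    apply Rle_trans with (C * (4 * (e ^ 2 / (4 * C)))); [apply Rmult_le_compat_l; lra|].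
    apply Req_le. field. lra. }
  destruct (Bd _ _ _ Hmu' H' N3 N4 L (INR (S m)) HLm HN W3 W4 t Ht) as [V1 V2].
  destruct (Bd _ _ _ Hmu H N1 N2 L (INR (S m)) HLm HN W1 W2 t Ht) as [V3 V4].
  assert (Df1 := nle_sub _ _ _ _ _ (vw_pos L (INR (S m)) HLm HN s) V1 V3).
  assert (Df2 := nle_sub _ _ _ _ _ (vw_pos L (INR (S m)) HLm HN (s - 1)) V2 V4).
  apply (strong_of_low_pair s (2 * R1 + 2 * R1) eps m); auto; lra.
Qed.

End Comparison.

(** * Continuation, and translation to the norms of the statement *)

Lemma contN_restrict r T T' f : T' <= T -> contN r T f -> contN r T' f.
Proof.
  intros H Hc t Ht eps Heps. destruct (Hc t ltac:(lra) eps Heps) as (d & Hd & HH).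
  exists d. split; auto. intros; apply HH; auto; lra.
Qed.
Lemma derN_restrict r T T' f f' : T' <= T -> derN r T f f' -> derN r T' f f'.
Proof.
  intros H Hc t Ht eps Heps. destruct (Hc t ltac:(lra) eps Heps) as (d & Hd & HH).
  exists d. split; auto. intros; apply HH; auto; lra.
Qed.

Lemma sol_restrict s g g' mu T T' u rho : T' <= T -> Sol s g g' mu T u rho -> Sol s g g' mu T' u rho.
Proof.
  intros H HS. destruct HS as [a1 a2 a3 a4 a5 a6 a7 a8].
  split; try (intros t Ht; match goal with h : forall t, _ |- _ => apply h; lra end).
  - now apply contN_restrict with T.
  - now apply contN_restrict with T.
  - now apply derN_restrict with T.
  - now apply derN_restrict with T.
Qed.

Lemma contN_shift r T a f : 0 <= a -> contN r T f -> contN r (T - a) (fun t => f (a + t)).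
Proof.
  intros H Hc t Ht eps Heps. destruct (Hc (a + t) ltac:(lra) eps Heps) as (d & Hd & HH).
  exists d. split; auto. intros t' Ht' Hd'. apply HH; [lra|]. now replace (a + t' - (a + t)) with (t' - t) by ring.
Qed.
Lemma derN_shift r T a f f' : 0 <= a -> derN r T f f' -> derN r (T - a) (fun t => f (a + t)) (fun t => f' (a + t)).
Proof.
  intros H Hc t Ht eps Heps. destruct (Hc (a + t) ltac:(lra) eps Heps) as (d & Hd & HH).
  exists d. split; auto. intros h Hh Hth Hhd. rewrite <- Rplus_assoc. apply HH; auto. lra.
Qed.

Lemma sol_shift s g g' mu T a u rho : 0 <= a -> Sol s g g' mu T u rho ->
  Sol s g g' mu (T - a) (fun t => u (a + t)) (fun t => rho (a + t)).
Proof.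
  intros H HS. destruct HS as [a1 a2 a3 a4 a5 a6 a7 a8].
  split; try (intros t Ht; match goal with h : forall t, _ |- _ => apply h; lra end).
  - now apply (contN_shift s T a u).
  - now apply (contN_shift (s - 1) T a rho).
  - now apply (derN_shift (s - 1) T a u (fun t => Fu g mu (u t) (rho t))).
  - now apply (derN_shift (s - 2) T a rho (fun t => Fr g' (u t) (rho t))).
Qed.

Lemma contN_ext r T f h : (forall t, 0 <= t <= T -> f t = h t) -> contN r T f -> contN r T h.
Proof.
  intros H Hc t Ht eps Heps. destruct (Hc t Ht eps Heps) as (d & Hd & HH).
  exists d. split; auto. intros t' Ht' Hd'. rewrite <- !H; auto.
Qed.
Lemma derN_ext r T f f' h h' : (forall t, 0 <= t <= T -> f t = h t) -> (forall t, 0 <= t <= T -> f' t = h' t) ->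
  derN r T f f' -> derN r T h h'.
Proof.
  intros H H' Hc t Ht eps Heps. destruct (Hc t Ht eps Heps) as (d & Hd & HH).
  exists d. split; auto. intros x Hx Htx Hxd. rewrite <- !H, <- H'; auto.
Qed.

Lemma sol_ext s g g' mu T u rho v sg : (forall t, 0 <= t <= T -> u t = v t /\ rho t = sg t) ->
  Sol s g g' mu T u rho -> Sol s g g' mu T v sg.
Proof.
  intros H HS. destruct HS as [a1 a2 a3 a4 a5 a6 a7 a8].
  split.
  - intros t Ht. destruct (H t Ht) as [<- _]. auto.
  - intros t Ht. destruct (H t Ht) as [_ <-]. auto.
  - intros t Ht. destruct (H t Ht) as [<- _]. auto.
  - intros t Ht. destruct (H t Ht) as [_ <-]. auto.
  - apply contN_ext with u; auto. intros; now apply H.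
  - apply contN_ext with rho; auto. intros; now apply H.
  - apply derN_ext with u (fun t => Fu g mu (u t) (rho t)); auto; intros t Ht; cbv beta; destruct (H t Ht) as [E1 E2]; rewrite ?E1, ?E2; auto.
  - apply derN_ext with rho (fun t => Fr g' (u t) (rho t)); auto; intros t Ht; cbv beta; destruct (H t Ht) as [E1 E2]; rewrite ?E1, ?E2; auto.
Qed.

(** * Concatenation in time *)

Definition glue {A : Type} (a : R) (f h : R -> A) (t : R) : A := if Rle_dec t a then f t else h (t - a).

Lemma glue_left {A} a (f h : R -> A) t : t <= a -> glue a f h t = f t.
Proof. intros. unfold glue. destruct (Rle_dec t a); auto; lra. Qed.
Lemma glue_right {A} a (f h : R -> A) t : f a = h 0 -> a <= t -> glue a f h t = h (t - a).
Proof.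
  intros E H. unfold glue. destruct (Rle_dec t a); auto. replace t with a by lra.
  now rewrite Rminus_diag.
Qed.

Lemma contN_glue r a b f h : 0 <= a -> f a = h 0 -> contN r a f -> contN r b h -> contN r (a + b) (glue a f h).
Proof.
  intros Ha E Hf Hh t Ht eps Heps.
  destruct (Rtotal_order t a) as [Hlt|[->|Hgt]].
  - destruct (Hf t ltac:(lra) eps Heps) as (d & Hd & HH). exists (Rmin d (a - t)).
    split; [apply Rmin_glb_lt; lra|]. intros t' Ht' Hdt.
    assert (Rabs (t' - t) < d) by (eapply Rlt_le_trans; [apply Hdt|apply Rmin_l]).
    assert (Rabs (t' - t) < a - t) by (eapply Rlt_le_trans; [apply Hdt|apply Rmin_r]).
    generalize (Rle_abs (t' - t)); intros. rewrite !glue_left by lra. apply HH; auto; lra.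
  - destruct (Hf a ltac:(lra) eps Heps) as (d1 & Hd1 & H1). destruct (Hh 0 ltac:(lra) eps Heps) as (d2 & Hd2 & H2).
    exists (Rmin d1 d2). split; [now apply Rmin_glb_lt|]. intros t' Ht' Hdt.
    assert (Rabs (t' - a) < d1) by (eapply Rlt_le_trans; [apply Hdt|apply Rmin_l]).
    assert (Rabs (t' - a) < d2) by (eapply Rlt_le_trans; [apply Hdt|apply Rmin_r]).
    destruct (Rle_dec t' a).
    + rewrite !glue_left by lra. apply H1; auto; lra.
    + rewrite !glue_right by (auto; lra). rewrite Rminus_diag. apply H2; [lra|]. now rewrite Rminus_0_r.
  - destruct (Hh (t - a) ltac:(lra) eps Heps) as (d & Hd & HH). exists (Rmin d (t - a)).
    split; [apply Rmin_glb_lt; lra|]. intros t' Ht' Hdt.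
    assert (Rabs (t' - t) < d) by (eapply Rlt_le_trans; [apply Hdt|apply Rmin_l]).
    assert (Rabs (t' - t) < t - a) by (eapply Rlt_le_trans; [apply Hdt|apply Rmin_r]).
    generalize (Rle_abs (- (t' - t))); rewrite Rabs_Ropp; intros. rewrite !glue_right by (auto; lra). apply HH; [lra|].
    now replace (t' - a - (t - a)) with (t' - t) by ring.
Qed.

Lemma derN_glue r a b f h f' h' : 0 <= a -> f a = h 0 -> f' a = h' 0 ->
  derN r a f f' -> derN r b h h' -> derN r (a + b) (glue a f h) (glue a f' h').
Proof.
  intros Ha E E' Hf Hh t Ht eps Heps.
  destruct (Rtotal_order t a) as [Hlt|[->|Hgt]].
  - destruct (Hf t ltac:(lra) eps Heps) as (d & Hd & HH). exists (Rmin d (a - t)).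
    split; [apply Rmin_glb_lt; lra|]. intros x Hx Htx Hdt.
    assert (Rabs x < d) by (eapply Rlt_le_trans; [apply Hdt|apply Rmin_l]).
    assert (Rabs x < a - t) by (eapply Rlt_le_trans; [apply Hdt|apply Rmin_r]).
    generalize (Rle_abs x); intros. rewrite !glue_left by lra. apply HH; auto; lra.
  - destruct (Hf a ltac:(lra) eps Heps) as (d1 & Hd1 & H1). destruct (Hh 0 ltac:(lra) eps Heps) as (d2 & Hd2 & H2).
    exists (Rmin d1 d2). split; [now apply Rmin_glb_lt|]. intros x Hx Htx Hdt.
    assert (Rabs x < d1) by (eapply Rlt_le_trans; [apply Hdt|apply Rmin_l]).
    assert (Rabs x < d2) by (eapply Rlt_le_trans; [apply Hdt|apply Rmin_r]).
    destruct (Rle_dec (a + x) a).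
    + rewrite !glue_left by lra. apply H1; auto; lra.
    + rewrite !glue_right by (auto; lra). rewrite Rminus_diag. replace (a + x - a) with (0 + x) by ring.
      apply H2; auto; lra.
  - destruct (Hh (t - a) ltac:(lra) eps Heps) as (d & Hd & HH). exists (Rmin d (t - a)).
    split; [apply Rmin_glb_lt; lra|]. intros x Hx Htx Hdt.
    assert (Rabs x < d) by (eapply Rlt_le_trans; [apply Hdt|apply Rmin_l]).
    assert (Rabs x < t - a) by (eapply Rlt_le_trans; [apply Hdt|apply Rmin_r]).
    generalize (Rle_abs (- x)); rewrite Rabs_Ropp; intros. rewrite !glue_right by (auto; lra).
    replace (t + x - a) with (t - a + x) by ring. apply HH; auto; lra.
Qed.

(** At the junction the one-sided derivatives agree, both being the nonlinearity at the common
    state. *)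
Lemma sol_glue s g g' mu a b u rho v sg : 0 <= a -> 0 <= b -> u a = v 0 -> rho a = sg 0 ->
  Sol s g g' mu a u rho -> Sol s g g' mu b v sg -> Sol s g g' mu (a + b) (glue a u v) (glue a rho sg).
Proof.
  intros Ha Hb E1 E2 [a1 a2 a3 a4 a5 a6 a7 a8] [b1 b2 b3 b4 b5 b6 b7 b8].
  split; try (intros t Ht; unfold glue; destruct (Rle_dec t a);
    match goal with h : forall t, _ |- _ => apply h; lra end).
  - now apply contN_glue.
  - now apply contN_glue.
  - apply derN_ext with (glue a u v) (glue a (fun t => Fu g mu (u t) (rho t)) (fun t => Fu g mu (v t) (sg t))); auto.
    + intros t Ht. unfold glue. destruct (Rle_dec t a); auto.
    + apply derN_glue; auto. now rewrite E1, E2.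
  - apply derN_ext with (glue a rho sg) (glue a (fun t => Fr g' (u t) (rho t)) (fun t => Fr g' (v t) (sg t))); auto.
    + intros t Ht. unfold glue. destruct (Rle_dec t a); auto.
    + apply derN_glue; auto. now rewrite E1, E2.
Qed.

Section Dependence.
Variables (s s' c c' g g' R0 : R).
Hypothesis Hs' : 3 / 2 < s'.
Hypothesis Hss : s' < s.
Hypothesis E : estimates s c.
Hypothesis E' : estimates s' c'.
Hypothesis HR : 1 <= R0.
Hypothesis Hg : Rabs g <= R0.
Hypothesis Hg' : Rabs g' <= R0.

Let tau := life c (R0 + 1).

(** Existence on all of [0, T] for nearby data is part of the property, so it also expresses lower
    semicontinuity of the lifespan. *)
Definition depends (mu T : R) (u rho : R -> fseq) : Prop :=
  forall eps, 0 < eps -> exists d, 0 < d /\ forall mu' v0 sg0, herm v0 -> herm sg0 -> Rabs (mu' - mu) <= d ->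
  nle (jp s) (fsub v0 (u 0)) d -> nle (jp (s - 1)) (fsub sg0 (rho 0)) d ->
  exists v sg, Sol s g g' mu' T v sg /\ v 0 = v0 /\ sg 0 = sg0 /\
  forall t, 0 <= t <= T -> nle (jp s) (fsub (v t) (u t)) eps /\ nle (jp (s - 1)) (fsub (sg t) (rho t)) eps.

(** Bounds by R0 - 1 leave one unit for the perturbed data and coefficient. *)
Lemma depends_short mu T u rho : 0 <= T <= tau -> Rabs mu <= R0 - 1 -> Sol s g g' mu T u rho ->
  nle (jp s) (u 0) (R0 - 1) -> nle (jp (s - 1)) (rho 0) (R0 - 1) -> depends mu T u rho.
Proof.
  intros HT Hmu HS N1 N2 eps Heps.
  assert (N1' : nle (jp s) (u 0) R0) by (eapply nle_weak; [exact N1|lra]).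
  assert (N2' : nle (jp (s - 1)) (rho 0) R0) by (eapply nle_weak; [exact N2|lra]).
  (* [local_dependence] works on the whole of [0, tau], so [u] is replaced by the solution there,
     equal to it on [0, T] by uniqueness. *)
  destruct (local_existence s s' c c' g g' mu R0 Hs' Hss E E' HR Hg Hg' ltac:(lra) (u 0) (rho 0)) as (U & P & HU & I1 & I2 & _); auto.
  { apply HS; lra. }
  { apply HS; lra. }
  fold tau in HU.
  assert (EqU : forall t, 0 <= t <= T -> U t = u t /\ P t = rho t).
  { apply (sol_unique s s' c' g g' Hs' Hss E' mu T); auto. apply sol_restrict with tau; auto; lra. }
  destruct (local_dependence s s' c' g g' Hs' Hss E' c E mu R0 U P HR Hg Hg' ltac:(lra) HU
    ltac:(rewrite I1; auto) ltac:(rewrite I2; auto) eps Heps) as (d & Hd & HD).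
  exists (Rmin d 1). split; [apply Rmin_glb_lt; lra|].
  intros mu' v0 sg0 hv hsg Dmu D1 D2.
  assert (B1 := Rmin_l d 1). assert (B2 := Rmin_r d 1).
  assert (M' : Rabs mu' <= R0).
  { replace mu' with (mu + (mu' - mu)) by ring. eapply Rle_trans; [apply Rabs_triang|]. lra. }
  assert (V1 : nle (jp s) v0 R0) by (eapply nle_weak; [apply (nle_near (jp s) _ _ _ _ (jp_pos s) N1 D1)|lra]).
  assert (V2 : nle (jp (s - 1)) sg0 R0) by (eapply nle_weak; [apply (nle_near (jp (s - 1)) _ _ _ _ (jp_pos (s - 1)) N2 D2)|lra]).
  destruct (local_existence s s' c c' g g' mu' R0 Hs' Hss E E' HR Hg Hg' M' v0 sg0) as (v & sg & Hv & J1 & J2 & _); auto.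
  exists v, sg. split; [apply sol_restrict with tau; [lra|exact Hv]|]. split; auto. split; auto.
  intros t Ht. destruct (EqU t Ht) as [<- <-].
  fold tau in HD. rewrite I1, I2 in HD. rewrite <- J1 in V1, D1. rewrite <- J2 in V2, D2.
  exact (HD mu' v sg M' Hv V1 V2 ltac:(lra) (nle_weak _ _ _ _ D1 B1) (nle_weak _ _ _ _ D2 B1) t ltac:(lra)).
Qed.

Lemma depends_long n : forall mu T u rho, 0 <= T <= INR n * tau -> Rabs mu <= R0 - 1 -> Sol s g g' mu T u rho ->
  (forall t, 0 <= t <= T -> nle (jp s) (u t) (R0 - 1) /\ nle (jp (s - 1)) (rho t) (R0 - 1)) ->
  depends mu T u rho.
Proof.
  assert (Htau : 0 < tau) by (apply (life_pos s c R0 E HR)).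
  induction n as [|n IH]; intros mu T u rho HT Hmu HS HB.
  - simpl in HT. destruct (HB 0 ltac:(lra)). apply depends_short; auto; lra.
  - rewrite S_INR in HT. destruct (Rle_dec T tau) as [Hle|Hgt].
    { destruct (HB 0 ltac:(lra)). apply depends_short; auto; lra. }
    set (a := T - tau).
    intros eps Heps.
    assert (HS2 := sol_shift s g g' mu T a u rho ltac:(unfold a; lra) HS).
    replace (T - a) with tau in HS2 by (unfold a; ring).
    destruct (HB a ltac:(unfold a; lra)) as [Na1 Na2].
    (* Tolerances are chosen backwards: the last stretch [a, T] fixes d1, which becomes part of the
       accuracy demanded on [0, a]. *)
    destruct (depends_short mu tau (fun t => u (a + t)) (fun t => rho (a + t)) ltac:(lra) Hmu HS2
      ltac:(cbv beta; rewrite Rplus_0_r; auto) ltac:(cbv beta; rewrite Rplus_0_r; auto) eps Heps)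
      as (d1 & Hd1 & H1). cbv beta in H1. rewrite Rplus_0_r in H1.
    destruct (IH mu a u rho ltac:(unfold a; lra) Hmu (sol_restrict _ _ _ _ T a _ _ ltac:(unfold a; lra) HS)
      ltac:(intros; apply HB; unfold a in *; lra) (Rmin eps d1) ltac:(now apply Rmin_glb_lt)) as (d2 & Hd2 & H2).
    exists (Rmin d1 d2). split; [now apply Rmin_glb_lt|].
    intros mu' v0 sg0 hv hsg Dmu D1 D2.
    assert (B1 := Rmin_l d1 d2). assert (B2 := Rmin_r d1 d2).
    assert (B3 := Rmin_l eps d1). assert (B4 := Rmin_r eps d1).
    destruct (H2 mu' v0 sg0 hv hsg ltac:(lra) (nle_weak _ _ _ _ D1 B2) (nle_weak _ _ _ _ D2 B2)) as (v & sg & HV & I1 & I2 & HC).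
    destruct (HC a ltac:(unfold a; lra)) as [C1 C2].
    destruct (H1 mu' (v a) (sg a)) as (w & et & HW & J1 & J2 & HC2).
    { apply HV. unfold a; lra. }
    { apply HV. unfold a; lra. }
    { lra. }
    { eapply nle_weak; [exact C1|lra]. }
    { eapply nle_weak; [exact C2|lra]. }
    exists (glue a v w), (glue a sg et). split; [|split; [|split]].
    + replace T with (a + tau) by (unfold a; ring). apply sol_glue; auto; unfold a; lra.
    + rewrite glue_left; auto. unfold a; lra.
    + rewrite glue_left; auto. unfold a; lra.
    + intros t Ht. destruct (Rle_dec t a) as [Hta|Hta].
      * rewrite !glue_left by auto. destruct (HC t ltac:(lra)). split; eapply nle_weak; eauto.
      * rewrite !glue_right by (auto; lra). specialize (HC2 (t - a) ltac:(unfold a in *; lra)).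
        now replace (a + (t - a)) with t in HC2 by ring.
Qed.

End Dependence.

(** * Finite-list bounds versus [inH], [normH] and half-open intervals *)

Lemma sweight_term r (a : fseq) k : sweight r k * Cmod (a k) ^ 2 = (jp r k * Cmod (a k)) ^ 2.
Proof. rewrite <- jp_sq. ring. Qed.

Lemma inH_nle r a : inH r a <-> herm a /\ exists B, nle (jp r) a B.
Proof.
  assert (Hp : forall k, 0 <= sweight r k * Cmod (a k) ^ 2) by (intros; rewrite sweight_term; apply pow2_ge_0).
  split.
  - intros [Hh Hs]. split; auto. exists (sqrt (sumZ (fun k => sweight r k * Cmod (a k) ^ 2))).
    split; [apply sqrt_pos|]. intros l Hl. rewrite pow2_sqrt.
    + rewrite (lsum_ext l _ (fun k => sweight r k * Cmod (a k) ^ 2)) by (intros; now rewrite sweight_term).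
      now apply lsum_le_sumZ.
    + generalize (lsum_le_sumZ _ [] Hp Hs (NoDup_nil _)). auto.
  - intros [Hh [B [HB H]]]. split; auto. apply summableZ_nonneg with (B ^ 2); auto.
    intros n. rewrite (lsum_ext _ _ (fun k => (jp r k * Cmod (a k)) ^ 2)) by (intros; now rewrite sweight_term).
    apply H, range_NoDup.
Qed.

Lemma nle_normH r a : inH r a -> nle (jp r) a (normH r a).
Proof.
  intros [Hh Hs].
  assert (Hp : forall k, 0 <= sweight r k * Cmod (a k) ^ 2) by (intros; rewrite sweight_term; apply pow2_ge_0).
  split; [apply sqrt_pos|]. intros l Hl. unfold normH. rewrite pow2_sqrt.
  + rewrite (lsum_ext l _ (fun k => sweight r k * Cmod (a k) ^ 2)) by (intros; now rewrite sweight_term).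
    now apply lsum_le_sumZ.
  + generalize (lsum_le_sumZ _ [] Hp Hs (NoDup_nil _)). auto.
Qed.

Lemma normH_le r a B : nle (jp r) a B -> normH r a <= B.
Proof.
  intros [HB H]. unfold normH. rewrite <- (sqrt_pow2 B HB). apply sqrt_le_1_alt.
  assert (HH : forall n, lsum (range n) (fun k => sweight r k * Cmod (a k) ^ 2) <= B ^ 2).
  { intros n. rewrite (lsum_ext _ _ (fun k => (jp r k * Cmod (a k)) ^ 2)) by (intros; now rewrite sweight_term).
    apply H, range_NoDup. }
  apply sumZ_le; auto. apply summableZ_nonneg with (B ^ 2); auto.
  intros; rewrite sweight_term; apply pow2_ge_0.
Qed.

Lemma inH_fsub r a b : inH r a -> inH r b -> inH r (fsub a b).
Proof.
  rewrite !inH_nle. intros [h1 [A HA]] [h2 [B HB]]. split; [now apply herm_fsub|].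
  exists (A + B). apply nle_sub; auto using jp_pos.
Qed.
Lemma inH_fscal r x a : inH r a -> inH r (fscal x a).
Proof.
  rewrite !inH_nle. intros [h1 [A HA]]. split; [now apply herm_fscal|].
  exists (Rabs x * A). apply nle_scal; auto using jp_pos.
Qed.
Lemma inH_le r q a : q <= r -> inH r a -> inH q a.
Proof. rewrite !inH_nle. intros H [h [A HA]]. split; auto. exists A. now apply nle_jp_le with r. Qed.

Lemma normH_pos r a : 0 <= normH r a.
Proof. apply sqrt_pos. Qed.

Lemma nle_of_normH r a e : inH r a -> normH r a < e -> nle (jp r) a e.
Proof. intros Ha H. eapply nle_weak; [now apply nle_normH|lra]. Qed.

Lemma normHH_ge s a b : normH s a <= normHH s a b /\ normH (s - 1) b <= normHH s a b.
Proof.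
  unfold normHH. generalize (normH_pos s a) (normH_pos (s - 1) b); intros.
  generalize (pow2_ge_0 (normH s a)) (pow2_ge_0 (normH (s - 1) b)); intros.
  split; (apply le_of_sq; [apply sqrt_pos|]); rewrite pow2_sqrt; lra.
Qed.

Lemma normHH_le s a b e : 0 <= e -> normH s a <= e -> normH (s - 1) b <= e -> normHH s a b <= 2 * e.
Proof.
  intros He H1 H2. unfold normHH. rewrite <- (sqrt_pow2 (2 * e)) by lra. apply sqrt_le_1_alt.
  generalize (normH_pos s a) (normH_pos (s - 1) b); intros. nra.
Qed.

Lemma estimates_pair s : 3 / 2 < s -> exists s' c c', 3 / 2 < s' /\ s' < s /\ estimates s c /\ estimates s' c'.
Proof.
  intros Hs. destruct (estimates_exist s Hs) as [c Hc].
  destruct (estimates_exist ((s + 3 / 2) / 2) ltac:(lra)) as [c' Hc'].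
  exists ((s + 3 / 2) / 2), c, c'. split; [lra|]. split; [lra|]. now split.
Qed.

Section Bridge.
Variables (s c g1 g2 : R).
Hypothesis E : estimates s c.

Lemma sol_inH mu T u rho t : Sol s g1 (2 * g2) mu T u rho -> 0 <= t <= T ->
  inH s (u t) /\ inH (s - 1) (rho t) /\ inH (s - 1) (Fu g1 mu (u t) (rho t)) /\ inH (s - 2) (Frho g2 (u t) (rho t)).
Proof.
  intros H Ht.
  assert (hu := sol_herm_u _ _ _ _ _ _ _ H t Ht). assert (hr := sol_herm_rho _ _ _ _ _ _ _ H t Ht).
  destruct (sol_u _ _ _ _ _ _ _ H t Ht) as [B1 H1]. destruct (sol_rho _ _ _ _ _ _ _ H t Ht) as [B2 H2].
  set (R0 := 1 + Rabs g1 + Rabs (2 * g2) + Rabs mu + Rmax 0 B1 + Rmax 0 B2).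
  assert (P1 := Rabs_pos g1). assert (P2 := Rabs_pos (2 * g2)). assert (P3 := Rabs_pos mu).
  assert (P4 := Rmax_l 0 B1). assert (P5 := Rmax_r 0 B1). assert (P6 := Rmax_l 0 B2). assert (P7 := Rmax_r 0 B2).
  assert (N1 : nle (jp s) (u t) R0) by (eapply nle_weak; [exact H1|unfold R0; lra]).
  assert (N2 : nle (jp (s - 1)) (rho t) R0) by (eapply nle_weak; [exact H2|unfold R0; lra]).
  (* The nonlinearity vanishes at the zero state, so its size follows from the Lipschitz bounds
     against that state. *)
  assert (Z : forall q, nle (jp q) (fun _ => RtoC 0) R0).
  { intros q. eapply nle_weak; [apply nle_zero, jp_pos|unfold R0; lra]. }
  assert (S0 : forall q a, nle (jp q) a R0 -> nle (jp q) (fsub a (fun _ => RtoC 0)) R0).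
  { intros q a Ha. apply nle_ext with a; auto. intros k. unfold fsub. ring. }
  rewrite !inH_nle. split; [|split; [|split]]; try (split; eauto; fail).
  - split; [apply (herm_Fu s c E g1 mu R0); auto; unfold R0; lra|].
    eexists. apply nle_ext with (fsub (Fu g1 mu (u t) (rho t)) (Fu g1 mu (fun _ => RtoC 0) (fun _ => RtoC 0))).
    + intros k. unfold fsub. rewrite Fu_zero. ring.
    + apply (Lip_Fu s c E g1 mu mu R0 (u t) (rho t)) with (d := R0) (e := 0); auto; try (unfold R0; lra).
      rewrite Rminus_diag, Rabs_R0. lra.
  - rewrite Fr_Frho. split; [apply (herm_Fr s c E (2 * g2) R0); auto; unfold R0; lra|].
    eexists. apply nle_ext with (fsub (Fr (2 * g2) (u t) (rho t)) (Fr (2 * g2) (fun _ => RtoC 0) (fun _ => RtoC 0))).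
    + intros k. unfold fsub. rewrite Fr_zero. ring.
    + apply (Lip_Fr s c E (2 * g2) R0 (u t) (rho t)) with (d := R0); auto; unfold R0; lra.
Qed.

Lemma sol_contN_F mu T u rho : 0 <= T -> Sol s g1 (2 * g2) mu T u rho ->
  contN (s - 1) T (fun t => Fu g1 mu (u t) (rho t)) /\ contN (s - 2) T (fun t => Frho g2 (u t) (rho t)).
Proof.
  intros HT H. destruct (sol_bounded _ _ _ _ _ _ _ HT H) as [B HB].
  set (R0 := 1 + Rabs g1 + Rabs (2 * g2) + Rabs mu + Rmax 0 B).
  assert (P1 := Rabs_pos g1). assert (P2 := Rabs_pos (2 * g2)). assert (P3 := Rabs_pos mu).
  assert (P4 := Rmax_l 0 B). assert (P5 := Rmax_r 0 B).
  apply (contN_F s c g1 (2 * g2) mu R0 T u rho E); try (unfold R0; lra).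
  - intros t Ht. destruct (HB t Ht). split; eapply nle_weak; eauto; unfold R0; lra.
  - apply H.
  - apply H.
Qed.

Lemma inI_below Tm T x : inI Tm T -> 0 <= x <= T -> inI Tm x.
Proof.
  intros [_ HT] Hx. split; [lra|]. apply Rbar_le_lt_trans with (Finite T); [simpl; lra|exact HT].
Qed.

Lemma inI_above Tm t : inI Tm t -> exists T, inI Tm T /\ t < T.
Proof.
  intros [H1 H2]. destruct Tm as [Tm| |]; simpl in H2; try tauto.
  - exists ((t + Tm) / 2). unfold inI; simpl. lra.
  - exists (t + 1). unfold inI; simpl. split; [split; [lra|exact I]|lra].
Qed.

(** Every time of the half-open interval lies strictly below some T in it; eps / 2 turns the
    non-strict bound into a strict one. *)
Lemma contH_of_contN r Tm f : (forall t, inI Tm t -> inH r (f t)) ->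
  (forall T, inI Tm T -> contN r T f) -> contH r Tm f.
Proof.
  intros Hi Hc. split; auto. intros t Ht eps Heps.
  destruct (inI_above Tm t Ht) as (T & HT & HtT).
  destruct (Hc T HT t ltac:(destruct Ht; lra) (eps / 2)) as (d & Hd & HH); [lra|].
  exists (Rmin d (T - t)). split; [apply Rmin_glb_lt; lra|]. intros t' Ht' Hdt.
  assert (B1 := Rmin_l d (T - t)). assert (B2 := Rmin_r d (T - t)). assert (B3 := Rle_abs (t' - t)).
  apply Rle_lt_trans with (eps / 2); [|lra]. apply normH_le, HH; [destruct Ht'; lra|lra].
Qed.

Lemma derH_of_derN r Tm f f' : (forall T, inI Tm T -> derN r T f f') -> derivH r Tm f f'.
Proof.
  intros Hc t Ht eps Heps.
  destruct (inI_above Tm t Ht) as (T & HT & HtT).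
  destruct (Hc T HT t ltac:(destruct Ht; lra) (eps / 2)) as (d & Hd & HH); [lra|].
  exists (Rmin d (T - t)). split; [apply Rmin_glb_lt; lra|]. intros h Hh Hth Hdt.
  assert (B1 := Rmin_l d (T - t)). assert (B2 := Rmin_r d (T - t)). assert (B3 := Rle_abs h).
  apply Rle_lt_trans with (eps / 2); [|lra]. apply normH_le, HH; auto; [destruct Hth; lra|lra].
Qed.

Lemma IsSol_of_Sol u0 rho0 Tm u rho : u 0 = u0 -> rho 0 = rho0 ->
  (forall T, inI Tm T -> Sol s g1 (2 * g2) (mean u0) T u rho) -> IsSol g1 g2 s u0 rho0 Tm u rho.
Proof.
  intros I1 I2 H.
  assert (Hi : forall t, inI Tm t -> 0 <= t <= t) by (intros t [Ht _]; lra).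
  split; [|split; [|split; [|split; [|split; [|split; [|split]]]]]]; auto.
  - apply contH_of_contN; intros t Ht; [now apply (sol_inH _ t u rho t (H t Ht) (Hi t Ht))|now apply H].
  - apply contH_of_contN; intros t Ht; [now apply (sol_inH _ t u rho t (H t Ht) (Hi t Ht))|now apply H].
  - apply contH_of_contN; intros t Ht; [now apply (sol_inH _ t u rho t (H t Ht) (Hi t Ht))|].
    apply sol_contN_F; auto. apply Ht.
  - apply contH_of_contN; intros t Ht; [now apply (sol_inH _ t u rho t (H t Ht) (Hi t Ht))|].
    apply (sol_contN_F (mean u0)); auto. apply Ht.
  - apply derH_of_derN. intros t Ht. now apply H.
  - apply derH_of_derN. intros t Ht. exact (sol_der_rho _ _ _ _ _ _ _ (H t Ht)).
Qed.

Lemma contN_of_contH r Tm f T : inI Tm T -> contH r Tm f -> contN r T f.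
Proof.
  intros HT [Hi Hc] t Ht eps Heps.
  assert (Hin := fun x => inI_below Tm T x HT).
  destruct (Hc t (Hin t Ht) eps Heps) as (d & Hd & HH). exists d. split; auto.
  intros t' Ht' Hdt. apply nle_of_normH; auto. apply inH_fsub; auto.
Qed.

Lemma Sol_of_IsSol u0 rho0 Tm u rho T : IsSol g1 g2 s u0 rho0 Tm u rho -> inI Tm T ->
  Sol s g1 (2 * g2) (mean u0) T u rho.
Proof.
  intros (C1 & C2 & C3 & C4 & D1 & D2 & _ & _) HT.
  assert (Hin := fun x => inI_below Tm T x HT).
  split.
  - intros t Ht. exact (proj1 (proj1 C1 t (Hin t Ht))).
  - intros t Ht. exact (proj1 (proj1 C2 t (Hin t Ht))).
  - intros t Ht. exact (proj2 (proj1 (inH_nle _ _) (proj1 C1 t (Hin t Ht)))).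
  - intros t Ht. exact (proj2 (proj1 (inH_nle _ _) (proj1 C2 t (Hin t Ht)))).
  - now apply contN_of_contH with Tm.
  - now apply contN_of_contH with Tm.
  - intros t Ht eps Heps. destruct (D1 t (Hin t Ht) eps Heps) as (d & Hd & HH). exists d. split; auto.
    intros h Hh Hth Hhd. apply nle_of_normH; auto.
    apply inH_fsub; [|now apply C3, Hin]. apply inH_fscal, inH_fsub; apply inH_le with s; try lra; now apply C1, Hin.
  - intros t Ht eps Heps. destruct (D2 t (Hin t Ht) eps Heps) as (d & Hd & HH). exists d. split; auto.
    intros h Hh Hth Hhd. apply nle_of_normH; auto.
    apply inH_fsub; [|now apply C4, Hin]. apply inH_fscal, inH_fsub; apply inH_le with (s - 1); try lra; now apply C2, Hin.
Qed.

End Bridge.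

(** * Maximal solutions *)

Lemma mean_le s a : 0 <= s -> inH s a -> Rabs (mean a) <= normH s a.
Proof.
  intros Hs Ha. unfold mean. eapply Rle_trans; [apply Re_le_Cmod|].
  generalize (nle_coef _ _ _ 0%Z (nle_normH s a Ha) (jp_pos s 0%Z)). rewrite jp_at0. lra.
Qed.

(** Closeness in C^1 is stated for the right-hand sides, which are the time derivatives by [IsSol].
    Perturbed data may have another maximal time, so their existence on [0, T') is asserted along
    with the estimate. *)
Theorem theorem3p2 (g1 g2 s : R) (hs : 3 / 2 < s) :
  exists Tf : R -> R, (forall r, 0 <= r -> 0 < Tf r) /\
  forall u0 rho0 : fseq, inH s u0 -> inH (s - 1) rho0 ->
  exists Tm : Rbar,
    (* the maximal time is bounded below by a positive quantity depending only on the norm *)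
    Rbar_le (Finite (Tf (normHH s u0 rho0))) Tm /\
    (* existence on [0,Tm) *)
    (exists u rho, IsSol g1 g2 s u0 rho0 Tm u rho) /\
    (* maximality *)
    (forall T' : R, Rbar_lt Tm (Finite T') ->
       ~ exists u rho, IsSol g1 g2 s u0 rho0 (Finite T') u rho) /\
    (* uniqueness *)
    (forall u rho v sigma, IsSol g1 g2 s u0 rho0 Tm u rho -> IsSol g1 g2 s u0 rho0 Tm v sigma ->
       forall t, inI Tm t -> u t = v t /\ rho t = sigma t) /\
    (* continuous dependence in C([0,T']; H^s x H^(s-1)) cap C^1([0,T']; H^(s-1) x H^(s-2)) *)
    (forall u rho, IsSol g1 g2 s u0 rho0 Tm u rho ->
     forall T' : R, 0 < T' -> Rbar_lt (Finite T') Tm ->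
     forall eps, 0 < eps -> exists delta, 0 < delta /\
     forall v0 sigma0, inH s v0 -> inH (s - 1) sigma0 ->
       normHH s (fsub v0 u0) (fsub sigma0 rho0) < delta ->
       exists v sigma, IsSol g1 g2 s v0 sigma0 (Finite T') v sigma /\
       forall v' sigma', IsSol g1 g2 s v0 sigma0 (Finite T') v' sigma' ->
       forall t, 0 <= t < T' ->
         normHH s (fsub (v' t) (u t)) (fsub (sigma' t) (rho t)) < eps /\
         normHH (s - 1)
           (fsub (Fu g1 (mean v0) (v' t) (sigma' t)) (Fu g1 (mean u0) (u t) (rho t)))
           (fsub (Frho g2 (v' t) (sigma' t)) (Frho g2 (u t) (rho t))) < eps).
Proof.
  destruct (estimates_pair s hs) as (s' & c & c' & Hs' & Hss & E & E').
  assert (Hc := est_c s c E).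
  set (B0 := 1 + Rabs g1 + Rabs (2 * g2)).
  assert (P1 := Rabs_pos g1). assert (P2 := Rabs_pos (2 * g2)).
  (* B0 + r bounds the transport constants, the mean and both data norms; the 1 is that of [R1] in
     [local_existence]. *)
  exists (fun r => life c (B0 + r + 1)). split.
  { intros r Hr. apply (life_pos s c (B0 + r) E). unfold B0. lra. }
  intros u0 rho0 Hu0 Hrho0.
  set (mu := mean u0). set (r0 := normHH s u0 rho0). set (tau := life c (B0 + r0 + 1)).
  destruct (normHH_ge s u0 rho0) as [G1 G2]. fold r0 in G1, G2.
  assert (G0 := normH_pos s u0).
  assert (hu0 := proj1 Hu0). assert (hr0 := proj1 Hrho0).
  assert (Hmu := mean_le s u0 ltac:(lra) Hu0). fold mu in Hmu.
  assert (Htau : 0 < tau) by (apply (life_pos s c (B0 + r0) E); unfold B0; lra).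
  set (S := fun T => exists u rho, Sol s g1 (2 * g2) mu T u rho /\ u 0 = u0 /\ rho 0 = rho0).
  assert (S0 : S tau).
  { destruct (local_existence s s' c c' g1 (2 * g2) mu (B0 + r0) Hs' Hss E E'
      ltac:(unfold B0; lra) ltac:(unfold B0; lra) ltac:(unfold B0; lra) ltac:(unfold B0; lra) u0 rho0)
      as (u & rho & HS & I1 & I2 & _); auto.
    - eapply nle_weak; [now apply nle_normH|unfold B0; lra].
    - eapply nle_weak; [now apply nle_normH|unfold B0; lra].
    - now exists u, rho. }
  set (Tm := Lub_Rbar S). destruct (Lub_Rbar_correct S) as [Ub Lb]. fold Tm in Ub, Lb.
  assert (HTm : Rbar_le (Finite tau) Tm) by now apply Ub.
  assert (Hext : forall t, inI Tm t -> exists T, t < T /\ S T).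
  { intros t [Ht1 Ht2]. destruct (classic (exists T, t < T /\ S T)) as [|Hn]; auto. exfalso.
    assert (Rbar_le Tm (Finite t)).
    { apply Lb. intros T HT. simpl. apply Rnot_lt_le. intros Hlt. apply Hn. now exists T. }
    apply (Rbar_lt_not_le _ _ Ht2 H). }
  assert (Huniq : forall mu T u rho v sg, Sol s g1 (2 * g2) mu T u rho -> Sol s g1 (2 * g2) mu T v sg ->
    u 0 = v 0 -> rho 0 = sg 0 -> forall t, 0 <= t <= T -> u t = v t /\ rho t = sg t).
  { intros m T u rho v sg H1 H2 I1 I2. exact (sol_unique s s' c' g1 (2 * g2) Hs' Hss E' m T u rho v sg H1 H2 I1 I2). }
  exists Tm. split; [exact HTm|]. split; [|split; [|split]].
  (* The value at t is read off any solution living beyond t; by uniqueness the choice is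
     immaterial. *)
  - set (isval := fun (t : R) (z : fseq * fseq) => exists T u rho, t < T /\ Sol s g1 (2 * g2) mu T u rho /\ u 0 = u0 /\ rho 0 = rho0 /\ z = (u t, rho t)).
    set (pick := fun t => epsilon (inhabits (u0, rho0)) (isval t)).
    assert (Hpick : forall t, inI Tm t -> isval t (pick t)).
    { intros t Ht. apply epsilon_spec. destruct (Hext t Ht) as (T & HtT & u & rho & HS & I1 & I2).
      exists (u t, rho t), T, u, rho. auto. }
    assert (H00 : inI Tm 0).
    { split; [lra|]. apply Rbar_lt_le_trans with (Finite tau); auto. }
    destruct (Hpick 0 H00) as (T0 & u1 & rho1 & _ & _ & K1 & K2 & K3).
    exists (fun t => fst (pick t)), (fun t => snd (pick t)).
    apply (IsSol_of_Sol s c g1 g2 E).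
    + rewrite K3. exact K1.
    + rewrite K3. exact K2.
    + intros T HT. destruct (Hext T HT) as (T1 & HT1 & u & rho & HS & I1 & I2).
      apply sol_ext with u rho; [|apply sol_restrict with T1; [lra|exact HS]].
      intros t Ht.
      assert (Hin : inI Tm t).
      { split; [lra|]. apply Rbar_le_lt_trans with (Finite T); [simpl; lra|apply HT]. }
      destruct (Hpick t Hin) as (T2 & u2 & rho2 & HT2 & HS2 & J1 & J2 & J3).
      rewrite J3. simpl.
      apply (Huniq mu t); try lra; try congruence.
      * apply sol_restrict with T1; [lra|exact HS].
      * apply sol_restrict with T2; [lra|exact HS2].
  - intros T' HT' (u & rho & HI).
    destruct Tm as [x| |]; simpl in *; try tauto.
    (* A solution on [0, T') restricts to closed intervals inside it, so a time strictly between the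
       supremum and T' gives the contradiction. *)
    assert (Hin : inI (Finite T') ((x + T') / 2)) by (unfold inI; simpl; lra).
    assert (HS := Sol_of_IsSol s g1 g2 _ _ _ _ _ _ HI Hin).
    assert (HSS : S ((x + T') / 2)) by (exists u, rho; split; [exact HS|apply HI]).
    specialize (Ub _ HSS). simpl in Ub. lra.
  - intros u rho v sg H1 H2 t Ht.
    apply (Huniq mu t); try (destruct Ht; lra).
    + exact (Sol_of_IsSol s g1 g2 _ _ _ _ _ _ H1 Ht).
    + exact (Sol_of_IsSol s g1 g2 _ _ _ _ _ _ H2 Ht).
    + transitivity u0; [apply H1|symmetry; apply H2].
    + transitivity rho0; [apply H1|symmetry; apply H2].
  - intros u rho HI T' HT' HTT eps Heps.
    assert (Hin : inI Tm T') by (split; [lra|auto]).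
    assert (HS := Sol_of_IsSol s g1 g2 _ _ _ _ _ _ HI Hin). fold mu in HS.
    assert (I1 : u 0 = u0) by apply HI. assert (I2 : rho 0 = rho0) by apply HI.
    destruct (sol_bounded _ _ _ _ _ _ _ (Rlt_le _ _ HT') HS) as [B HB].
    set (R0 := B0 + 1 + Rabs mu + Rmax 0 B).
    assert (P3 := Rabs_pos mu). assert (P4 := Rmax_l 0 B). assert (P5 := Rmax_r 0 B).
    assert (HR0 : 2 <= R0) by (unfold R0, B0; lra).
    assert (HB' : forall t, 0 <= t <= T' -> nle (jp s) (u t) (R0 - 1) /\ nle (jp (s - 1)) (rho t) (R0 - 1)).
    { intros t Ht. destruct (HB t Ht). split; eapply nle_weak; eauto; unfold R0, B0; lra. }
    destruct (INR_unbounded (T' / life c (R0 + 1))) as [n Hn].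
    assert (Hl : 0 < life c (R0 + 1)) by (apply (life_pos s c R0 E); lra).
    assert (HnT : T' <= INR n * life c (R0 + 1)).
    { apply Rlt_le in Hn. apply (Rmult_le_compat_r (life c (R0 + 1))) in Hn; [|lra].
      unfold Rdiv in Hn. rewrite Rmult_assoc, Rinv_l, Rmult_1_r in Hn; lra. }
    set (M := 12 * c * R0). assert (HM : 0 < M) by (unfold M; apply Rmult_lt_0_compat; lra).
    (* 1 keeps the perturbed states and mean below R0; eps / 4 serves the states and eps / (8 M) the
       time derivatives. *)
    set (e1 := Rmin 1 (Rmin (eps / 4) (eps / (8 * M)))).
    assert (He1 : 0 < e1) by (repeat apply Rmin_glb_lt; try lra; apply Rdiv_lt_0_compat; lra).
    assert (e1a : e1 <= 1) by apply Rmin_l.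
    assert (e1b : e1 <= eps / 4) by (eapply Rle_trans; [apply Rmin_r|apply Rmin_l]).
    assert (e1c : e1 <= eps / (8 * M)) by (eapply Rle_trans; [apply Rmin_r|apply Rmin_r]).
    assert (HMe : M * e1 <= eps / 8).
    { apply Rle_trans with (M * (eps / (8 * M))); [apply Rmult_le_compat_l; lra|apply Req_le; field; lra]. }
    destruct (depends_long s s' c c' g1 (2 * g2) R0 Hs' Hss E E' ltac:(lra) ltac:(unfold R0, B0; lra) ltac:(unfold R0, B0; lra)
      n mu T' u rho ltac:(lra) ltac:(unfold R0, B0; lra) HS HB' e1 He1) as (d & Hd & HD).
    exists (Rmin d e1). split; [now apply Rmin_glb_lt|].
    intros v0 sg0 Hv0 Hsg0 Hclose.
    assert (Bd1 := Rmin_l d e1). assert (Bd2 := Rmin_r d e1).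
    destruct (normHH_ge s (fsub v0 u0) (fsub sg0 rho0)) as [C1 C2].
    assert (D1 : nle (jp s) (fsub v0 u0) (Rmin d e1)) by (apply nle_of_normH; [now apply inH_fsub|lra]).
    assert (D2 : nle (jp (s - 1)) (fsub sg0 rho0) (Rmin d e1)) by (apply nle_of_normH; [now apply inH_fsub|lra]).
    (* The mean is the mode of frequency 0, where every Sobolev weight equals 1. *)
    assert (Dmu : Rabs (mean v0 - mu) <= Rmin d e1).
    { assert (Q := mean_le s (fsub v0 u0) ltac:(lra) (inH_fsub _ _ _ Hv0 Hu0)).
      replace (mean (fsub v0 u0)) with (mean v0 - mu) in Q by reflexivity. lra. }
    destruct (HD (mean v0) v0 sg0 (proj1 Hv0) (proj1 Hsg0)) as (v & sg & HV & J1 & J2 & HC).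
    { lra. }
    { rewrite I1. eapply nle_weak; eauto. }
    { rewrite I2. eapply nle_weak; eauto. }
    exists v, sg. split.
    { apply (IsSol_of_Sol s c g1 g2 E); auto. intros T [HT1 HT2]. simpl in HT2.
      apply sol_restrict with T'; [lra|exact HV]. }
    intros v' sg' HV' t Ht.
    assert (Hint : inI (Finite T') t) by (unfold inI; simpl; lra).
    destruct (Huniq (mean v0) t v' sg' v sg (Sol_of_IsSol s g1 g2 _ _ _ _ _ _ HV' Hint)
      (sol_restrict _ _ _ _ T' t _ _ ltac:(lra) HV)) with (t := t) as [-> ->]; try lra.
    { rewrite J1. apply HV'. }
    { rewrite J2. apply HV'. }
    destruct (HC t ltac:(lra)) as [N1 N2]. destruct (HB' t ltac:(lra)) as [N3 N4].
    assert (N5 := nle_near _ _ _ _ _ (jp_pos s) N3 N1). assert (N6 := nle_near _ _ _ _ _ (jp_pos (s - 1)) N4 N2).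
    split.
    + apply Rle_lt_trans with (2 * e1); [|lra]. apply normHH_le; [lra| |]; now apply normH_le.
    (* In the bound for [Fu], e1 enters twice: for the states and for the means. *)
    + apply Rle_lt_trans with (2 * (2 * (M * e1))); [|lra].
      assert (0 <= M * e1) by (apply Rmult_le_pos; lra).
      apply normHH_le; [lra| |]; apply normH_le.
      * replace (2 * (M * e1)) with (M * (e1 + e1)) by ring.
        assert (Rabs (mean v0) <= R0).
        { replace (mean v0) with (mu + (mean v0 - mu)) by ring. eapply Rle_trans; [apply Rabs_triang|]. unfold R0, B0. lra. }
        apply (Lip_Fu s c E); auto; try lra; try (unfold R0, B0; lra);
          try (eapply nle_weak; [eassumption|lra]).
      * replace (s - 1 - 1) with (s - 2) by ring. rewrite !Fr_Frho.
        apply nle_weak with (M * e1); [|lra].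
        apply (Lip_Fr s c E); auto; try lra; try (unfold R0, B0; lra);
          try (eapply nle_weak; [eassumption|lra]).
Qed.
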